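(* Given $T>0$, $R>0$, there are constants $\tau_R>0$ and $c_{R,T},C_{R,T}>0$ (depending on $R,T$ but not on $\tau$) such that the following holds for all $\tau\in(0,\tau_R)$. Let $u(t)$ be the exact solution of the KdV equation $\partial_tu+\partial_x^3u=\frac12\partial_x(u^2)$ on $[0,T]\times\mathbb{T}$ with $u(0)=u_0$, let $u^n$, $n\ge0$, be the iterates of the resonance-based midpoint rule with $u^0=u_0$, and let $t_n=n\tau$. (i) If $\sup_{t\in[0,T]}\|u(t)\|_{H^3}<R/2$, then $\|u(t_n)-u^n\|_{H^1}\le c_{R,T}\,\tau$ for all $0\le n\le\lfloor T/\tau\rfloor$. (ii) If $\sup_{t\in[0,T]}\|u(t)\|_{H^5}<R/2$, then $\|u(t_n)-u^n\|_{H^1}\le C_{R,T}\,\tau^2$ for all $0\le n\le\lfloor T/\tau\rfloor$.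
   Context: $\mathbb{T}=\mathbb{R}/(2\pi\mathbb{Z})$; $H^r=H^r(\mathbb{T})$ is the periodic Sobolev space with norm $\|u\|_{H^r}^2=\sum_{m}\langle m\rangle^{2r}|\hat u_m|^2$, $\langle m\rangle=|m|$ ($m\neq0$), $\langle0\rangle=1$. All functions are real-valued with zero mean. $\partial_x^{-1}$ is the Fourier multiplier $\widehat{(\partial_x^{-1}v)}_k=\hat v_k/(ik)$ for $k\ne0$ and $0$ for $k=0$. Resonance-based midpoint rule for KdV with step size $\tau$: $$u^{n+1}=e^{-\tau\partial_x^3}u^n+\tfrac1{24}\Big(\partial_x^{-1}u^{n+1}+e^{-\tau\partial_x^3}\partial_x^{-1}u^n\Big)^2-\tfrac1{24}e^{-\tau\partial_x^3}\Big(e^{\tau\partial_x^3}\partial_x^{-1}u^{n+1}+\partial_x^{-1}u^n\Big)^2 .$$ The implicit equation is solved by fixed-point iteration: $u^{n+1}$ is the limit of the iteration $w\mapsto e^{-\tau\partial_x^3}u^n+\frac1{24}(\partial_x^{-1}w+e^{-\tau\partial_x^3}\partial_x^{-1}u^n)^2-\frac1{24}e^{-\tau\partial_x^3}(e^{\tau\partial_x^3}\partial_x^{-1}w+\partial_x^{-1}u^n)^2$ started at $w=u^n$ (which exists for sufficiently small $\tau$). *)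

(* Defs.v *)
From HB Require Import structures.
From mathcomp Require Import all_boot all_order all_algebra.
From mathcomp Require Import all_classical all_reals all_analysis.
From mathcomp Require Import complex.

Set Implicit Arguments.
Unset Strict Implicit.
Unset Printing Implicit Defensive.
Import Order.TTheory GRing.Theory Num.Theory.
Import numFieldNormedType.Exports.
Local Open Scope classical_set_scope.
Local Open Scope ring_scope.

(* Functions on the torus are 2 pi-periodic functions on the line.  Only Sobolev
   spaces H^r with r >= 1 occur, and their elements are identified with their
   continuous representatives. *)

Section Torus.
Variable R : realType.
Implicit Types (v w : R -> R) (k : int).

Definition torus_int v : R :=
  Rintegral (@lebesgue_measure R) `[0, 2 * pi]%classic v.

Definition torus_fun v : Prop :=
  [/\ continuous v, periodic v (2 * pi) & torus_int v = 0].

(* e^{i theta} *)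
Definition cis (theta : R) : R[i] := Complex (cos theta) (sin theta).

(* (2 pi)^-1 * the integral of v(x) e^{-ikx} over one period *)
Definition fourier v k : R[i] :=
  Complex ((2 * pi)^-1 * torus_int (fun x => v x * cos (k%:~R * x)))
          (- ((2 * pi)^-1 * torus_int (fun x => v x * sin (k%:~R * x)))).

Definition japanese k : R := if k == 0 then 1 else `|k%:~R|.

(* Extended-real valued: +oo when v is not in H^r. *)
Definition Hnorm (r : nat) v : \bar R :=
  sqrte (\esum_(k in [set: int])
    (japanese k ^+ (2 * r) * ComplexField.Normc.normc (fourier v k) ^+ 2)%:E).

Definition sobolev (r : nat) v : Prop :=
  torus_fun v /\ (Hnorm r v < +oo)%E.

(* Sum of m(k) v_k e^{ikx} over all integers k, as the limit of the partial sums
   over -N <= k <= N.  The symbols m used below satisfy m(-k) = conj (m(k)), so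
   these partial sums are real when v is. *)
Definition fmult (m : int -> R[i]) v : R -> R := fun x =>
  limn (fun N : nat => \sum_(0 <= j < (2 * N).+1)
    let k := j%:Z - N%:Z in
    complex.Re (m k * fourier v k * cis (k%:~R * x))).

Definition dx_inv : (R -> R) -> R -> R :=
  fmult (fun k => if k == 0 then 0 else (Complex 0 1 * k%:~R)^-1).

(* exp (s d_x^3), whose symbol is e^{s (ik)^3} = e^{-i s k^3} *)
Definition exp_dx3 (s : R) : (R -> R) -> R -> R :=
  fmult (fun k => cis (- (s * k%:~R ^+ 3))).

Definition midpoint_map (tau : R) v w : R -> R :=
  let a x := dx_inv w x + exp_dx3 (- tau) (dx_inv v) x in
  let b x := exp_dx3 tau (dx_inv w) x + dx_inv v x in
  fun x => exp_dx3 (- tau) v x + 24^-1 * a x ^+ 2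
           - 24^-1 * exp_dx3 (- tau) (fun y => b y ^+ 2) x.

Definition midpoint_lim (tau : R) v w : Prop :=
  sobolev 1 w /\
  (fun j : nat => Hnorm 1 (iter j (midpoint_map tau v) v \- w)) @ \oo --> 0%E.

(* The H^1 limit of the fixed-point iteration started at v (unique when it
   exists); the junk value 0 is used when there is none. *)
Definition midpoint_step (tau : R) v : R -> R :=
  xget (cst 0) [set w | midpoint_lim tau v w].

Definition midpoint_iter (tau : R) (u0 : R -> R) (n : nat) : R -> R :=
  iter n (midpoint_step tau) u0.

Definition torus_smooth (phi : R -> R) : Prop :=
  periodic phi (2 * pi) /\ forall (n : nat) (x : R), derivable (derive1n n phi) x 1.

(* Weak form in space of d_t u + d_x^3 u = 1/2 d_x (u^2) on [0, T]: at the
   regularity H^3 the derivative d_x^3 u is in general only square integrable,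
   so the equation cannot be asked pointwise. *)
Definition KdV_solution (T : R) (u : R -> R -> R) (u0 : R -> R) : Prop :=
  [/\ forall t, 0 <= t <= T -> torus_fun (u t),
      u 0 = u0 &
      forall phi, torus_smooth phi ->
        {within `[0, T], continuous (fun t => torus_int (u t \* phi))} /\
        forall t, 0 < t < T ->
          is_derive t (1 : R) (fun s => torus_int (u s \* phi))
            (torus_int (fun x => u t x * derive1n 3 phi x)
             - 2^-1 * torus_int (fun x => u t x ^+ 2 * derive1n 1 phi x))].

Definition Hsup (r : nat) (T : R) (u : R -> R -> R) : \bar R :=
  ereal_sup [set Hnorm r (u t) | t in `[0, T]].

End Torus.

(* Main.v *)
(* In the twisted variable v(t) = exp(t d_x^3) u(t), which has the same Sobolev norms as u,
   KdV reads v_k' = (ik/2) sum_{k1+k2=k} exp(-3 i t k k1 k2) v_{k1} v_{k2}.  Freezing v at the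
   mean of its end values over a step and integrating the oscillating factor exactly gives
   the scheme.  The defect of the exact solution is therefore O(tau^2) in H^1 for H^3
   solutions, and O(tau^3) for H^5 solutions by the symmetry of the mean.  The increment
   is only O(sqrt tau) as a bilinear map of H^1, enough for the fixed-point iteration to be
   a contraction, but its pairing with the error in H^1 is O(tau) after symmetrizing the
   frequencies.  A discrete Gronwall argument, which also keeps the numerical solution in
   a ball of H^1, then sums up the defects. *)

Require Import Defs.
From mathcomp Require Import all_boot all_order all_algebra.
From mathcomp Require Import all_classical all_reals all_analysis.
From HB Require Import structures.
From mathcomp Require Import complex ring lra zify.
Set Implicit Arguments.
Unset Strict Implicit.
Unset Printing Implicit Defensive.
Import Order.TTheory GRing.Theory Num.Theory.
Import numFieldNormedType.Exports.
Local Open Scope classical_set_scope.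
Local Open Scope ring_scope.

Local Notation normc := ComplexField.Normc.normc.
Local Notation Re := complex.Re.
Local Notation Im := complex.Im.

(** * Sums over finite sets of frequencies *)

Section FiniteSums.
Context {R : realType}.
Implicit Types (f g p q : int -> R) (s t : seq int) (M P Q : R).

(** The data offer little to calculus: the equation holds only against test functions, the norms are
    extended-real sums, and a step of the scheme is a limit chosen by [xget]. All estimates are
    therefore made on Fourier coefficients, a Sobolev bound being a bound on every finite partial
    sum. Such bounds survive coefficientwise limits, and the time calculus is done one coefficient
    at a time. The squares in the scheme force a return from coefficients to functions, hence
    uniqueness of Fourier coefficients for continuous functions. A circularity shapes the error
    estimate: the cubic part of the error equation is harmless only when the error is already O(sqrt
    tau). The first-order bound supplies O(tau) at every earlier step, for both rates, and this
    closes the induction. In the constants, 3 bounds the l^2 norm of 1/<k>, 6 = 3 + 3 comes from the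
    two halves of a product estimate, and powers of 2 come from <k> <= 2 max(<j>, <k-j>). *)

Lemma sum_sub f s t : uniq s -> uniq t -> {subset s <= t} -> (forall k, 0 <= f k) ->
  \sum_(k <- s) f k <= \sum_(k <- t) f k.
Proof.
move=> us ut st f0; rewrite [leRHS](bigID (mem s))/=.
rewrite (_ : \sum_(k <- t | k \in s) f k = \sum_(k <- s) f k).
  by rewrite lerDl sumr_ge0.
rewrite -big_filter; apply: perm_big; apply: uniq_perm => //.
  exact: filter_uniq.
by move=> k; rewrite mem_filter; case: (boolP (k \in s)) => // /st ->.
Qed.

Lemma cauchy_schwarz s f g :
  (\sum_(k <- s) f k * g k) ^+ 2 <=
  (\sum_(k <- s) f k ^+ 2) * (\sum_(k <- s) g k ^+ 2).
Proof.
elim: s => [|k s IH]; first by rewrite !big_nil mulr0 expr0n.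
rewrite !big_cons; move: IH.
have := sumr_ge0 s (fun k _ => sqr_ge0 (f k) : true ==> _).
have := sumr_ge0 s (fun k _ => sqr_ge0 (g k) : true ==> _).
move=> /(_ xpredT) Y0 /(_ xpredT) X0; move: X0 Y0.
set A := \sum_(_ <- s) _ * _; set X := \sum_(_ <- s) f _ ^+ 2.
set Y := \sum_(_ <- s) _ ^+ 2 => X0 Y0 IH; set a := f k; set b := g k.
(* The cross term: its square is at most 4 X b^2 Y a^2 by the induction hypothesis, hence at most
   the square of the right-hand side. *)
suff : 2 * (A * (a * b)) <= X * b ^+ 2 + Y * a ^+ 2 by nra.
have H : 0 <= X * b ^+ 2 + Y * a ^+ 2 by apply: addr_ge0; apply: mulr_ge0 => //; exact: sqr_ge0.
apply: le_trans (ler_norm _) _; rewrite -(@ler_pXn2r _ 2) ?nnegrE//.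
rewrite real_normK ?num_real//.
have : A ^+ 2 * (a * b) ^+ 2 <= X * Y * (a * b) ^+ 2 by apply: ler_wpM2r => //; exact: sqr_ge0.
have := sqr_ge0 (X * b ^+ 2 - Y * a ^+ 2); nra.
Qed.

(** Each factor of Cauchy-Schwarz receives a square root of the weight. In a convolution the weight
    will be the l^1 factor. *)
Lemma weighted_cauchy_schwarz s p q : (forall k, 0 <= p k) ->
  (\sum_(k <- s) p k * q k) ^+ 2 <=
  (\sum_(k <- s) p k) * (\sum_(k <- s) p k * q k ^+ 2).
Proof.
move=> p0.
have := cauchy_schwarz s (fun k => Num.sqrt (p k)) (fun k => Num.sqrt (p k) * q k).
rewrite (eq_bigr (fun k => p k * q k)); last first.
  by move=> k _; rewrite mulrA -expr2 sqr_sqrtr.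
move/le_trans; apply; rewrite le_eqVlt; apply/orP; left; apply/eqP; congr (_ * _); apply: eq_bigr => k _.
  by rewrite sqr_sqrtr.
by rewrite exprMn sqr_sqrtr.
Qed.

End FiniteSums.

Section Bounds.
Context {R : realType}.
Implicit Types (f g p q : int -> R) (s t : seq int) (M P Q : R).

(** Norm bounds are stated on all finite duplicate-free lists: no infinite sum has to be formed, and
    the bounds pass to pointwise limits. *)
Definition l2b f M := forall s, uniq s -> \sum_(k <- s) f k ^+ 2 <= M ^+ 2.
Definition l1b f M := forall s, uniq s -> \sum_(k <- s) `|f k| <= M.

Lemma l2b_le f g M : (forall k, `|f k| <= `|g k|) -> l2b g M -> l2b f M.
Proof.
move=> fg gM s us; apply: le_trans (gM s us); apply: ler_sum => k _.
rewrite -(real_normK (num_real (f k))) -(real_normK (num_real (g k))).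
by apply: lerXn2r; rewrite ?nnegrE.
Qed.

Lemma l2b_mono f M M' : 0 <= M -> M <= M' -> l2b f M -> l2b f M'.
Proof.
move=> M0 MM' fM s us; apply: le_trans (fM s us) _.
by apply: lerXn2r; rewrite ?nnegrE// (le_trans M0).
Qed.

Lemma l2b_pt f M k : 0 <= M -> l2b f M -> `|f k| <= M.
Proof.
move=> M0 /(_ [:: k] isT); rewrite big_seq1 => H; rewrite -(@ler_pXn2r _ 2) ?nnegrE//.
by rewrite real_normK ?num_real.
Qed.

Lemma l2bZ f c M : l2b f M -> l2b (fun k => c * f k) (`|c| * M).
Proof.
move=> fM s us; under eq_bigr do rewrite exprMn.
rewrite -mulr_sumr exprMn real_normK ?num_real//; apply: ler_wpM2l (fM s us).
exact: sqr_ge0.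
Qed.

Lemma sum_mul_le s f g P Q : 0 <= P -> 0 <= Q ->
  \sum_(k <- s) f k ^+ 2 <= P ^+ 2 -> \sum_(k <- s) g k ^+ 2 <= Q ^+ 2 ->
  \sum_(k <- s) f k * g k <= P * Q.
Proof.
move=> P0 Q0 fP gQ; apply: le_trans (ler_norm _) _.
rewrite -(@ler_pXn2r _ 2) ?nnegrE ?mulr_ge0//.
rewrite real_normK ?num_real// (le_trans (cauchy_schwarz _ _ _))// exprMn.
by apply: ler_pM => //; apply: sumr_ge0 => k _; exact: sqr_ge0.
Qed.

Lemma l2bD f g P Q : 0 <= P -> 0 <= Q -> l2b f P -> l2b g Q ->
  l2b (fun k => f k + g k) (P + Q).
Proof.
move=> P0 Q0 fP gQ s us.
have H := sum_mul_le P0 Q0 (fP s us) (gQ s us).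
have -> : \sum_(k <- s) (f k + g k) ^+ 2 =
    \sum_(k <- s) f k ^+ 2 + 2 * (\sum_(k <- s) f k * g k) + \sum_(k <- s) g k ^+ 2.
  by rewrite mulr_sumr -!big_split/=; apply: eq_bigr => k _; ring.
have := fP s us; have := gQ s us; nra.
Qed.

Lemma l1b_le f g M : (forall k, `|f k| <= `|g k|) -> l1b g M -> l1b f M.
Proof. by move=> fg gM s us; apply: le_trans (gM s us); apply: ler_sum. Qed.

Lemma l1bZ f c M : l1b f M -> l1b (fun k => c * f k) (`|c| * M).
Proof.
move=> fM s us; under eq_bigr do rewrite normrM.
by rewrite -mulr_sumr; apply: ler_wpM2l (fM s us).
Qed.

Lemma l1bD f g P Q : l1b f P -> l1b g Q -> l1b (fun k => f k + g k) (P + Q).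
Proof.
move=> fP gQ s us; apply: le_trans (lerD (fP s us) (gQ s us)).
by rewrite -big_split/=; apply: ler_sum => k _; exact: ler_normD.
Qed.

Lemma l1b_inj f M (h : int -> int) : injective h -> l1b f M -> l1b (f \o h) M.
Proof.
move=> hi fM s us; apply: le_trans (fM (map h s) _); last by rewrite map_inj_uniq.
by rewrite big_map.
Qed.

Lemma l2b_inj f M (h : int -> int) : injective h -> l2b f M -> l2b (f \o h) M.
Proof.
move=> hi fM s us; apply: le_trans (fM (map h s) _); last by rewrite map_inj_uniq.
by rewrite big_map.
Qed.

Lemma l1b_mul f g P Q : 0 <= P -> 0 <= Q -> l2b f P -> l2b g Q ->
  l1b (fun k => f k * g k) (P * Q).
Proof.
move=> P0 Q0 fP gQ s us; under eq_bigr do rewrite normrM.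
by apply: sum_mul_le => //; under eq_bigr do rewrite real_normK ?num_real//; auto.
Qed.

(** Young's inequality: the l^1 factor is the weight of a Cauchy-Schwarz in j, and exchanging the
    sums leaves translates of q, which have the same l^2 bound. The sum over j is finite so that the
    result applies to truncated convolutions. *)
Lemma young12 p q P Q s : 0 <= P -> uniq s -> (forall k, 0 <= p k) ->
  l1b p P -> l2b q Q -> l2b (fun k => \sum_(j <- s) p j * q (k - j)) (P * Q).
Proof.
move=> P0 us p0 pP qQ t ut.
have pP' : \sum_(j <- s) p j <= P.
  by apply: le_trans (pP s us); apply: ler_sum => k _; rewrite ger0_norm.
apply: (@le_trans _ _ (\sum_(k <- t) P * \sum_(j <- s) p j * q (k - j) ^+ 2)).
  apply: ler_sum => k _; apply: le_trans (weighted_cauchy_schwarz _ _ p0) _.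
  by apply: ler_wpM2r => //; apply: sumr_ge0 => j _; rewrite mulr_ge0// sqr_ge0.
rewrite -mulr_sumr exchange_big/= exprMn expr2 -mulrA; apply: ler_wpM2l => //.
apply: (@le_trans _ _ (\sum_(j <- s) p j * Q ^+ 2)); last first.
  by rewrite -mulr_suml; apply: ler_wpM2r; rewrite ?sqr_ge0.
apply: ler_sum => j _; rewrite -mulr_sumr; apply: ler_wpM2l => //.
have hi : injective (fun k : int => k - j) by move=> a b /(congr1 (fun x => x + j)); rewrite !subrK.
exact: (l2b_inj hi qQ).
Qed.

(** The weight is now the second factor, so its mass is taken over the reflected set of the k -
    j. *)
Lemma young21 p q P Q s : 0 <= Q -> uniq s -> (forall k, 0 <= q k) ->
  l2b p P -> l1b q Q -> l2b (fun k => \sum_(j <- s) p j * q (k - j)) (P * Q).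
Proof.
move=> Q0 us q0 pP qQ t ut.
have qQ' (r : seq int) : uniq r -> \sum_(j <- r) q j <= Q.
  by move=> ur; apply: le_trans (qQ r ur); apply: ler_sum => k _; rewrite ger0_norm.
apply: (@le_trans _ _ (\sum_(k <- t) Q * \sum_(j <- s) q (k - j) * p j ^+ 2)).
  apply: ler_sum => k _.
  have := weighted_cauchy_schwarz s p (fun j => q0 (k - j)).
  under eq_bigr do rewrite mulrC.
  move/le_trans; apply.
  apply: ler_wpM2r; first by apply: sumr_ge0 => j _; rewrite mulr_ge0// sqr_ge0.
  apply: le_trans (qQ' (map (fun j => k - j) s) _); first by rewrite big_map.
  by rewrite map_inj_uniq// => a b /addrI /oppr_inj.
rewrite -mulr_sumr exchange_big/= exprMn expr2 (mulrC (P * P)) -mulrA; apply: ler_wpM2l => //.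
apply: (@le_trans _ _ (\sum_(j <- s) Q * p j ^+ 2)); last first.
  by rewrite -mulr_sumr; apply: ler_wpM2l => //; rewrite -expr2; exact: pP.
apply: ler_sum => j _; rewrite -mulr_suml; apply: ler_wpM2r; first exact: sqr_ge0.
apply: le_trans (qQ' (map (fun k => k - j) t) _); first by rewrite big_map.
by rewrite map_inj_uniq// => a b /(congr1 (fun x => x + j)); rewrite !subrK.
Qed.

End Bounds.

(** * Complex sums over the integers *)

Section ComplexNorm.
Context {R : realType}.
Implicit Types (z w : R[i]) (c : R).

Lemma normc_ge0 z : 0 <= normc z.
Proof. by case: z => a b; exact: sqrtr_ge0. Qed.

Lemma normcD z w : normc (z + w) <= normc z + normc w.
Proof. exact: le_normcD. Qed.

Lemma normcNN z : normc (- z) = normc z.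
Proof. exact: normcN. Qed.

Lemma normcB z w : normc (z - w) <= normc z + normc w.
Proof. by rewrite -(normcNN w) normcD. Qed.

Lemma normc_distC z w : normc (z - w) = normc (w - z).
Proof. by rewrite -normcNN opprB. Qed.

Lemma normcMM z w : normc (z * w) = normc z * normc w.
Proof. exact: ComplexField.Normc.normcM. Qed.

Lemma normc_sqr z : normc z ^+ 2 = Re z ^+ 2 + Im z ^+ 2.
Proof. by case: z => a b; rewrite /= sqr_sqrtr// addr_ge0 ?sqr_ge0. Qed.

Lemma normc00 : normc (0 : R[i]) = 0.
Proof. exact: ComplexField.Normc.normc0. Qed.

Lemma normc_conj z : normc (conjc z) = normc z.
Proof. by case: z => a b; rewrite /= sqrrN. Qed.

Lemma normc_real c : normc (c%:C)%C = `|c|.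
Proof. by rewrite /= expr0n/= addr0 sqrtr_sqr. Qed.

Lemma normcV z : normc z^-1 = (normc z)^-1.
Proof. exact: ComplexField.Normc.normcV. Qed.

Lemma Re_le z : `|Re z| <= normc z.
Proof.
rewrite -(@ler_pXn2r _ 2) ?nnegrE ?normc_ge0// normc_sqr real_normK ?num_real//.
by rewrite lerDl sqr_ge0.
Qed.

Lemma Im_le z : `|Im z| <= normc z.
Proof.
rewrite -(@ler_pXn2r _ 2) ?nnegrE ?normc_ge0// normc_sqr real_normK ?num_real//.
by rewrite lerDr sqr_ge0.
Qed.

Lemma normc_le z : normc z <= `|Re z| + `|Im z|.
Proof.
rewrite -(@ler_pXn2r _ 2) ?nnegrE ?normc_ge0 ?addr_ge0// normc_sqr sqrrD.
by rewrite !real_normK ?num_real// lerD2r lerDl mulrn_wge0// mulr_ge0.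
Qed.

Lemma normc_sum (I : Type) (s : seq I) (F : I -> R[i]) :
  normc (\sum_(k <- s) F k) <= \sum_(k <- s) normc (F k).
Proof.
elim/big_rec2: _ => [|k x y _ le]; first by rewrite normc00.
by apply: le_trans (normcD _ _) _; rewrite lerD2l.
Qed.

Lemma Re_add z w : Re (z + w) = Re z + Re w. Proof. by case: z w => [? ?] []. Qed.
Lemma Im_add z w : Im (z + w) = Im z + Im w. Proof. by case: z w => [? ?] []. Qed.
Lemma Re_opp z : Re (- z) = - Re z. Proof. by case: z. Qed.
Lemma Im_opp z : Im (- z) = - Im z. Proof. by case: z. Qed.
Lemma Re_mul z w : Re (z * w) = Re z * Re w - Im z * Im w. Proof. by case: z w => [? ?] []. Qed.
Lemma Im_mul z w : Im (z * w) = Re z * Im w + Im z * Re w. Proof. by case: z w => [? ?] []. Qed.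
Lemma Re_conjc z : Re (conjc z) = Re z. Proof. by case: z. Qed.
Lemma Im_conjc z : Im (conjc z) = - Im z. Proof. by case: z. Qed.
Lemma conjc_mul z w : conjc (z * w) = conjc z * conjc w. Proof. exact: rmorphM. Qed.
Lemma conjc_add z w : conjc (z + w) = conjc z + conjc w. Proof. exact: rmorphD. Qed.

Lemma Re_sum (I : Type) (s : seq I) (F : I -> R[i]) :
  Re (\sum_(k <- s) F k) = \sum_(k <- s) Re (F k).
Proof. by elim/big_rec2: _ => [//|k x y _ <-]; rewrite Re_add. Qed.

Lemma Im_sum (I : Type) (s : seq I) (F : I -> R[i]) :
  Im (\sum_(k <- s) F k) = \sum_(k <- s) Im (F k).
Proof. by elim/big_rec2: _ => [//|k x y _ <-]; rewrite Im_add. Qed.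

Lemma complex_ext z w : Re z = Re w -> Im z = Im w -> z = w.
Proof. by case: z w => [? ?] [? ?] /= -> ->. Qed.

Definition ccvg (u : nat -> R[i]) z := (fun n => normc (u n - z)) @ \oo --> (0 : R).

Lemma ccvgP u z : ccvg u z <->
  ((fun n => Re (u n)) @ \oo --> Re z) /\ ((fun n => Im (u n)) @ \oo --> Im z).
Proof.
split=> [H|[H1 H2]].
  split; apply/cvgrPdist_lt => e e0; move/cvgr0Pnorm_lt: H => /(_ e e0); apply: filterS => n.
    rewrite ger0_norm ?normc_ge0//; apply: le_lt_trans.
    by rewrite distrC -Re_opp -Re_add Re_le.
  rewrite ger0_norm ?normc_ge0//; apply: le_lt_trans.
  by rewrite distrC -Im_opp -Im_add Im_le.
apply: (@squeeze_cvgr _ _ _ _ (cst 0) (fun n => `|Re (u n) - Re z| + `|Im (u n) - Im z|)).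
- apply: nearW => n; rewrite normc_ge0/= -!Re_opp -!Im_opp -Re_add -Im_add; exact: normc_le.
- exact: cvg_cst.
- rewrite -[X in _ --> X](addr0 0); apply: cvgD.
    by rewrite -(normr0 R) -(subrr (Re z)); apply: cvg_norm; apply: cvgB => //; exact: cvg_cst.
  by rewrite -(normr0 R) -(subrr (Im z)); apply: cvg_norm; apply: cvgB => //; exact: cvg_cst.
Qed.

Lemma ccvg_unique u z w : ccvg u z -> ccvg u w -> z = w.
Proof.
move=> /ccvgP[a b] /ccvgP[a' b']; apply: complex_ext.
  exact: (cvg_unique _ a a').
exact: (cvg_unique _ b b').
Qed.

Lemma ccvgD u v z w : ccvg u z -> ccvg v w -> ccvg (fun n => u n + v n) (z + w).
Proof.
move=> /ccvgP[a b] /ccvgP[a' b']; apply/ccvgP; rewrite Re_add Im_add; split.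
  by under eq_fun do rewrite Re_add; exact: cvgD.
by under eq_fun do rewrite Im_add; exact: cvgD.
Qed.

Lemma ccvg_cst z : ccvg (fun=> z) z.
Proof. by apply/ccvgP; split; exact: cvg_cst. Qed.

Lemma ccvgM u v z w : ccvg u z -> ccvg v w -> ccvg (fun n => u n * v n) (z * w).
Proof.
move=> /ccvgP[a b] /ccvgP[a' b']; apply/ccvgP; rewrite Re_mul Im_mul; split.
  by under eq_fun do rewrite Re_mul; apply: cvgB; exact: cvgM.
by under eq_fun do rewrite Im_mul; apply: cvgD; exact: cvgM.
Qed.

Lemma ccvgZ u (c : R[i]) z : ccvg u z -> ccvg (fun n => c * u n) (c * z).
Proof. by move=> ?; apply: ccvgM => //; exact: ccvg_cst. Qed.

Lemma ccvg_norm u z : ccvg u z -> (fun n => normc (u n)) @ \oo --> normc z.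
Proof.
move=> H; apply/cvgrPdist_lt => e e0; move/cvgr0Pnorm_lt: H => /(_ e e0).
apply: filterS => n; rewrite ger0_norm ?normc_ge0//; apply: le_lt_trans.
rewrite ler_norml.
have H1 := normcD (z - u n) (u n); rewrite subrK (normc_distC z) in H1.
have H2 := normcD (u n - z) z; rewrite subrK in H2.
by apply/andP; split; lra.
Qed.

End ComplexNorm.

(** The symmetric index sets of the partial sums in [fmult], enumerated in the same order. *)
HB.lock Definition zbox (N : nat) : seq int := [seq j%:Z - N%:Z | j <- index_iota 0 (2 * N).+1].

Section Zbox.

Lemma mem_zbox N k : (k \in zbox N) = (`|k| <= N)%N.
Proof.
rewrite zbox.unlock; apply/mapP/idP => [[j]|kN].
  rewrite mem_index_iota => jN ->; lia.
exists (absz (k + N%:Z)%R); [rewrite mem_index_iota; lia|lia].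
Qed.

Lemma uniq_zbox N : uniq (zbox N).
Proof. by rewrite zbox.unlock map_inj_uniq ?iota_uniq// => a b /(congr1 (fun x => x + N%:Z)); rewrite !subrK => -[]. Qed.

Lemma zbox_sub (s : seq int) : exists N, {subset s <= zbox N}.
Proof.
exists (\max_(k <- s) `|k|%N) => k ks; rewrite mem_zbox.
by rewrite (big_rem k ks)/= leq_maxl.
Qed.

Lemma zboxS N M : (N <= M)%N -> {subset zbox N <= zbox M}.
Proof. by move=> NM k; rewrite !mem_zbox => /leq_trans; apply. Qed.

Lemma zbox_perm N : perm_eq (zbox N) (map (fun k => - k) (zbox N)).
Proof.
apply: uniq_perm; rewrite ?uniq_zbox//.
  by rewrite map_inj_uniq ?uniq_zbox//; exact: oppr_inj.
move=> k; apply/idP/mapP => [kN|[j jN ->]].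
  by exists (- k); [rewrite mem_zbox abszN -mem_zbox|rewrite opprK].
by rewrite mem_zbox abszN -mem_zbox.
Qed.

Lemma zbox_opp (V : nmodType) N (F : int -> V) :
  \sum_(k <- zbox N) F (- k) = \sum_(k <- zbox N) F k.
Proof. by rewrite [RHS](perm_big _ (zbox_perm N)) [RHS]big_map. Qed.

End Zbox.

Section Csum.
Context {R : realType}.
Implicit Types (F G : int -> R[i]) (M : R).

(** Limits of symmetric partial sums, as in [fmult]. For absolutely summable families the order is
    immaterial, by [csum_inj]. *)
Definition csum F : R[i] :=
  Complex (limn (fun N => \sum_(k <- zbox N) Re (F k)))
          (limn (fun N => \sum_(k <- zbox N) Im (F k))).

Definition csummable F := exists M, l1b (fun k => normc (F k)) M.

(** Writing h as the difference of h + |h| and |h| reduces convergence to two bounded monotone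
    sequences. *)
Lemma box_sum_cvg (h : int -> R) M : l1b h M -> cvgn (fun N => \sum_(k <- zbox N) h k).
Proof.
move=> hM.
have bnd (h1 : int -> R) M1 : (forall k, 0 <= h1 k) -> l1b h1 M1 ->
    cvgn (fun N => \sum_(k <- zbox N) h1 k).
  move=> h10 h1M; apply: nondecreasing_is_cvgn.
    by move=> m n mn; apply: sum_sub; rewrite ?uniq_zbox//; exact: zboxS.
  exists M1 => _ [n _ <-]; apply: le_trans (h1M _ (uniq_zbox n)).
  by apply: ler_sum => k _; rewrite ler_norm.
have -> : (fun N => \sum_(k <- zbox N) h k) =
    (fun N => \sum_(k <- zbox N) (h k + `|h k|)) \- (fun N => \sum_(k <- zbox N) `|h k|).
  by apply/funext => N /=; rewrite -sumrB; apply: eq_bigr => k _; rewrite addrK.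
apply: is_cvgB.
  apply: (bnd _ (M + M)) => [k|]; first by have := ler_norm (- h k); rewrite normrN; lra.
  by apply: l1bD => // s us; under eq_bigr do rewrite normr_id; exact: hM.
by apply: (bnd _ M) => // s us; under eq_bigr do rewrite normr_id; exact: hM.
Qed.

Lemma csum_cvg F : csummable F -> ccvg (fun N => \sum_(k <- zbox N) F k) (csum F).
Proof.
move=> [M FM]; apply/ccvgP; split => /=.
  under eq_fun do rewrite Re_sum; apply: (@box_sum_cvg _ M).
  by apply: l1b_le FM => k; rewrite [leRHS]ger0_norm ?normc_ge0// Re_le.
under eq_fun do rewrite Im_sum; apply: (@box_sum_cvg _ M).
by apply: l1b_le FM => k; rewrite [leRHS]ger0_norm ?normc_ge0// Im_le.
Qed.

Lemma csumE F z : csummable F -> ccvg (fun N => \sum_(k <- zbox N) F k) z -> csum F = z.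
Proof. by move=> /csum_cvg H; exact: ccvg_unique. Qed.

Lemma csummable_le F G : (forall k, normc (F k) <= normc (G k)) -> csummable G -> csummable F.
Proof.
by move=> FG [M GM]; exists M; apply: l1b_le GM => k; rewrite !ger0_norm ?normc_ge0.
Qed.

Lemma csummableD F G : csummable F -> csummable G -> csummable (fun k => F k + G k).
Proof.
move=> [M FM] [N GN]; exists (M + N); apply: l1b_le (l1bD FM GN) => k.
by rewrite !ger0_norm ?addr_ge0 ?normc_ge0// normcD.
Qed.

Lemma csummableZ F (c : R[i]) : csummable F -> csummable (fun k => c * F k).
Proof.
move=> [M FM]; exists (`|normc c| * M); apply: l1b_le (l1bZ (normc c) FM) => k.
by rewrite normcMM.
Qed.

Lemma csumD F G : csummable F -> csummable G ->
  csum (fun k => F k + G k) = csum F + csum G.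
Proof.
move=> sF sG; apply: csumE; first exact: csummableD.
under eq_fun do rewrite big_split/=; by apply: ccvgD; exact: csum_cvg.
Qed.

Lemma csumZ F (c : R[i]) : csummable F -> csum (fun k => c * F k) = c * csum F.
Proof.
move=> sF; apply: csumE; first exact: csummableZ.
under eq_fun do rewrite -mulr_sumr; by apply: ccvgZ; exact: csum_cvg.
Qed.

Lemma csumB F G : csummable F -> csummable G ->
  csum (fun k => F k - G k) = csum F - csum G.
Proof.
move=> sF sG; rewrite -[X in _ = _ + X]mulN1r -csumZ// -csumD//; last exact: csummableZ.
by congr csum; apply/funext => k; rewrite mulN1r.
Qed.

Lemma cvg_le_cst (u : nat -> R) l M : u @ \oo --> l -> (forall n, u n <= M) -> l <= M.
Proof.
move=> ul uM; rewrite -(cvg_lim _ ul)//; apply: limr_le; first by apply/cvg_ex; exists l.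
exact: nearW.
Qed.

Lemma csum_le F M : l1b (fun k => normc (F k)) M -> normc (csum F) <= M.
Proof.
move=> FM; have /ccvg_norm := csum_cvg (ex_intro _ M FM).
move=> /cvg_le_cst; apply => N; apply: le_trans (normc_sum _ _) _.
apply: le_trans (FM _ (uniq_zbox N)).
by apply: ler_sum => k _; rewrite ler_norm.
Qed.

End Csum.

(** * Japanese brackets and Sobolev bounds on coefficient sequences *)

Section Japanese.
Context {R : realType}.
Local Notation jp := (japanese R).
Implicit Types (k j : int).

Lemma jp_ge1 k : 1 <= jp k.
Proof.
rewrite /japanese; case: eqP => // /eqP k0.
rewrite -intr_norm -[leLHS]/(1%:~R) ler_int; lia.
Qed.

Lemma jp_gt0 k : 0 < jp k. Proof. exact: lt_le_trans (jp_ge1 k). Qed.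
Lemma jp_ge0 k : 0 <= jp k. Proof. exact: ltW (jp_gt0 k). Qed.
Hint Resolve jp_ge0 jp_gt0 jp_ge1 : core.

Lemma jpX_ge0 k r : 0 <= jp k ^+ r. Proof. exact: exprn_ge0. Qed.
Lemma jpX_ge1 k r : 1 <= jp k ^+ r. Proof. exact: exprn_ege1. Qed.

Lemma normr_le_jp k : `|k%:~R| <= jp k.
Proof. by rewrite /japanese; case: eqP => // ->; rewrite normr0. Qed.

Lemma jpN k : jp (- k) = jp k.
Proof. by rewrite /japanese oppr_eq0 mulrNz normrN. Qed.

Lemma jpD k j : jp (k + j) <= jp k + jp j.
Proof.
have [->|k0] := eqVneq (k + j) 0.
  by rewrite {1}/japanese eqxx (le_trans (jp_ge1 k))// lerDl.
rewrite {1}/japanese (negbTE k0) intrD.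
by apply: le_trans (ler_normD _ _) _; apply: lerD; exact: normr_le_jp.
Qed.

Lemma jp_split k j : jp k <= jp j + jp (k - j).
Proof. by have := jpD j (k - j); rewrite addrC subrK. Qed.

(** The larger of <j> and <k-j> is at least half of <k>. *)
Lemma jpX_split a k j : jp k ^+ a <= 2 ^+ a * (jp j ^+ a + jp (k - j) ^+ a).
Proof.
wlog le : k j / jp j <= jp (k - j).
  move=> H; have [|/ltW le] := leP (jp j) (jp (k - j)); first exact: H.
  by have := H k (k - j); rewrite subKr => /(_ le); rewrite [X in _ * X]addrC.
apply: (@le_trans _ _ ((2 * jp (k - j)) ^+ a)).
  apply: lerXn2r; rewrite ?nnegrE ?mulr_ge0//.
  by apply: le_trans (jp_split k j) _; rewrite mulrDl mul1r lerD2r.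
by rewrite exprMn ler_wpM2l ?exprn_ge0// lerDr jpX_ge0.
Qed.

Lemma big_zboxS (V : nmodType) N (F : int -> V) :
  \sum_(k <- zbox N.+1) F k =
  F N.+1%:Z + (F (- N.+1%:Z) + \sum_(k <- zbox N) F k).
Proof.
rewrite (_ : F N.+1%:Z + _ = \sum_(k <- [:: N.+1%:Z, - N.+1%:Z & zbox N]) F k); last by rewrite !big_cons.
apply: perm_big; apply: uniq_perm; first exact: uniq_zbox.
  rewrite /= uniq_zbox !inE !mem_zbox andbT; lia.
move=> k; rewrite !inE !mem_zbox; lia.
Qed.

(** The bound 1/(x+1)^2 <= 1/x - 1/(x+1) telescopes: the sum of <k>^-2 over a box stays below 5, and
    5 <= 3^2. *)
Lemma l2b_jpV : l2b (fun k => (jp k)^-1) (3 : R).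
Proof.
move=> s us; have [N sN] := zbox_sub s.
apply: (le_trans (sum_sub us (uniq_zbox N) sN _)) => [k|]; first exact: sqr_ge0.
suff H M : \sum_(k <- zbox M.+1) (jp k)^-1 ^+ 2 <= 5 - 2 / M.+1%:R.
  apply: le_trans (sum_sub (uniq_zbox N) (uniq_zbox N.+1) _ _) _ => [|k|].
  - exact: zboxS.
  - exact: sqr_ge0.
  apply: le_trans (H N) _; rewrite lerBlDr (@le_trans _ _ 9)//; first lra.
  by rewrite -natrX lerDl divr_ge0.
have jpn n : jp n.+1%:Z = n.+1%:R by rewrite /japanese/= ger0_norm.
elim: M => [|M IH].
  rewrite big_zboxS jpN jpn (_ : zbox 0 = [:: 0]) ?zbox.unlock// big_seq1 /japanese eqxx; lra.
rewrite big_zboxS jpN jpn; apply: le_trans (lerD (lexx _) (lerD (lexx _) IH)) _.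
rewrite -[M.+2%:R]natr1; set x := M.+1%:R.
have x0 : 0 < x :> R by rewrite ltr0n.
have xx : 2 / x - 2 / (x + 1) = 2 / (x * (x + 1)).
  by field; rewrite !lt0r_neq0// addr_gt0.
suff : (x + 1)^-1 ^+ 2 <= (x * (x + 1))^-1.
  move: xx;   set c := (x * (x + 1))^-1; set a := (x + 1)^-1 ^+ 2; set b := x^-1; set d := (x + 1)^-1.
  move: c a b d => c a b d xx ac; lra.
rewrite exprVn lef_pV2 ?posrE ?mulr_gt0 ?exprn_gt0 ?addr_gt0//.
by rewrite expr2 ler_pM2r ?addr_gt0// lerDl.
Qed.

Implicit Types (f g : int -> R[i]) (F G M : R).

(* [hb r f M]: the function with Fourier coefficients [f] has H^r norm at most [M]. *)
Definition hb (r : nat) f M := l2b (fun k => jp k ^+ r * normc (f k)) M.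

Lemma jpnormc_ge0 r k (z : R[i]) : 0 <= jp k ^+ r * normc z.
Proof. by rewrite mulr_ge0 ?jpX_ge0 ?normc_ge0. Qed.

Lemma hb_le r f g M : (forall k, normc (f k) <= normc (g k)) -> hb r g M -> hb r f M.
Proof.
move=> fg; apply: l2b_le => k; rewrite !ger0_norm ?jpnormc_ge0//.
by rewrite ler_wpM2l ?jpX_ge0.
Qed.

Lemma hb_w r r' f M : (r <= r')%N -> hb r' f M -> hb r f M.
Proof.
move=> rr'; apply: l2b_le => k; rewrite !ger0_norm ?jpnormc_ge0//.
by rewrite ler_wpM2r ?normc_ge0// ler_weXn2l.
Qed.

Lemma hb_mono r f M M' : 0 <= M -> M <= M' -> hb r f M -> hb r f M'.
Proof. exact: l2b_mono. Qed.

Lemma hbD r f g F G : 0 <= F -> 0 <= G -> hb r f F -> hb r g G ->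
  hb r (fun k => f k + g k) (F + G).
Proof.
move=> F0 G0 fF gG; apply: l2b_le (l2bD F0 G0 fF gG) => k.
rewrite !ger0_norm ?addr_ge0 ?jpnormc_ge0// -mulrDr ler_wpM2l ?jpX_ge0//.
exact: normcD.
Qed.

Lemma hbN r f F : hb r f F -> hb r (fun k => - f k) F.
Proof. by apply: hb_le => k; rewrite normcNN. Qed.

Lemma hbB r f g F G : 0 <= F -> 0 <= G -> hb r f F -> hb r g G ->
  hb r (fun k => f k - g k) (F + G).
Proof. by move=> F0 G0 fF gG; apply: hbD => //; exact: hbN. Qed.

Lemma hbZ r (c : R[i]) f F : hb r f F -> hb r (fun k => c * f k) (normc c * F).
Proof.
move=> /(l2bZ (normc c)); rewrite ger0_norm ?normc_ge0//; apply: l2b_le => k.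
by rewrite normcMM mulrCA.
Qed.

(** Sobolev embedding by Cauchy-Schwarz against 1/<k>: one derivative buys absolute summability, at
    the cost of the factor 3 of [l2b_jpV]. *)
Lemma hb_l1 r f F : 0 <= F -> hb r.+1 f F -> l1b (fun k => jp k ^+ r * normc (f k)) (3 * F).
Proof.
move=> F0 fF; have := l1b_mul (ler0n _ 3) F0 l2b_jpV fF.
by apply: l1b_le => k; rewrite exprS -mulrA mulKf// lt0r_neq0.
Qed.

Lemma hb_pt r f F k : 0 <= F -> hb r f F -> jp k ^+ r * normc (f k) <= F.
Proof. by move=> F0 /(l2b_pt k F0); rewrite ger0_norm ?jpnormc_ge0. Qed.

Lemma cvg_sumr (T : Type) (FF : set_system T) {fF : Filter FF} (I : Type) (s : seq I)
    (u : I -> T -> R) (l : I -> R) :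
  (forall i, u i @ FF --> l i) -> (fun x => \sum_(i <- s) u i x) @ FF --> \sum_(i <- s) l i.
Proof.
move=> H; elim: s => [|i s IH].
  by under eq_fun do rewrite big_nil; rewrite big_nil; exact: cvg_cst.
by under eq_fun do rewrite big_cons; rewrite big_cons; exact: cvgD.
Qed.

(** A Fatou property. It transfers bounds from truncated convolutions to [csum], and from the
    fixed-point iterates to their limit. *)
Lemma hb_lim r (u : nat -> int -> R[i]) f (b : nat -> R) B :
  (forall k, ccvg (fun n => u n k) (f k)) -> (forall n, hb r (u n) (b n)) ->
  b @ \oo --> B -> hb r f B.
Proof.
move=> uf ub bB s us.
rewrite -subr_le0.
apply: (@cvg_le_cst _ (fun n => \sum_(k <- s) (jp k ^+ r * normc (u n k)) ^+ 2 - b n ^+ 2)).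
  apply: cvgB; last by rewrite expr2; under eq_fun do rewrite expr2; exact: cvgM.
  apply: cvg_sumr => k.
  have H : (fun n => jp k ^+ r * normc (u n k)) @ \oo --> jp k ^+ r * normc (f k).
    by apply: cvgM; [exact: cvg_cst|exact: ccvg_norm].
  by rewrite expr2; under eq_fun do rewrite expr2; exact: cvgM.
by move=> n; rewrite subr_le0; exact: ub.
Qed.

End Japanese.
#[global] Hint Resolve jp_ge0 jp_gt0 jp_ge1 jpX_ge0 : core.

(** * Tails and rearrangement of absolutely convergent sums *)

Section Tails.
Context {R : realType}.

(** Take a box whose sum is within e of the limit of the box sums: a finite set outside it lies,
    together with it, in a larger box, whose sum cannot exceed that limit. *)
Lemma l1b_tail (h : int -> R) M e : l1b h M -> 0 < e ->
  exists N, forall s, uniq s -> (forall k, k \in s -> (N < `|k|)%N) ->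
    \sum_(k <- s) `|h k| <= e.
Proof.
move=> hM e0; set S := fun N => \sum_(k <- zbox N) `|h k|.
have cS : cvgn S.
  by apply: (@box_sum_cvg _ _ M) => s us; under eq_bigr do rewrite normr_id; exact: hM.
have ndS : nondecreasing_seq S.
  by move=> m n mn; apply: sum_sub; rewrite ?uniq_zbox//; exact: zboxS.
have /cvgrPdist_lt/(_ e e0)[N _ HN] := cS.
exists N => s us sN; have [P sP] := zbox_sub s.
have := HN N (leqnn N) => /= /ltr_normlW lS.
have := nondecreasing_cvgn_le ndS cS (maxn N P) => Sl.
suff : \sum_(k <- s) `|h k| + S N <= S (maxn N P) by lra.
rewrite /S -big_cat; apply: sum_sub; rewrite ?uniq_zbox//.
  rewrite cat_uniq us uniq_zbox andbT/=; apply/hasPn => k; rewrite mem_zbox => kN.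
  by apply/negP => /sN; lia.
move=> k; rewrite mem_cat !mem_zbox => /orP[/sP|]; rewrite ?mem_zbox; lia.
Qed.

(** Once the reindexed box contains [zbox N], it differs from any larger box only by two tails of
    size e/3; a third e/3 compares that box with the limit. *)
Lemma csum_inj (F : int -> R[i]) (h : int -> int) : injective h -> (forall k, exists j, h j = k) ->
  csummable F -> csum (F \o h) = csum F.
Proof.
move=> hi hs sF; have sFh : csummable (F \o h).
  by case: sF => M FM; exists M; exact: (l1b_inj hi FM).
have [M FM] := sF.
apply: csumE => //; apply/cvgr0Pnorm_le => e e0.
have e20 : 0 < e / 3 by rewrite divr_gt0.
have [N HN] := l1b_tail FM e20.
have [N' HN'] : exists N', forall k, (`|k| <= N)%N -> exists2 j, h j = k & (`|j| <= N')%N.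
  have [g hg] := choice hs.
  have [N' sN'] := zbox_sub (map g (zbox N)).
  exists N' => k kN; exists (g k) => //; rewrite -mem_zbox; apply: sN'.
  by apply: map_f; rewrite mem_zbox.
have /cvgr0Pnorm_le/(_ _ e20)[N1 _ HN1] := csum_cvg sF.
near=> n; rewrite ger0_norm ?normc_ge0//.
set P := maxn N1 N.
have := HN1 P (leq_maxl _ _); rewrite /= ger0_norm ?normc_ge0// => H1.
set A := \sum_(k <- zbox n) _; set B := \sum_(k <- zbox P) _ in H1.
have -> : A - csum F = (A - B) + (B - csum F) by ring.
apply: (le_trans (normcD _ _)).
suff : normc (A - B) <= e / 3 + e / 3 by lra.
have AE : A = \sum_(k <- map h (zbox n)) F k by rewrite [RHS]big_map.
have un : uniq (map h (zbox n)) by rewrite map_inj_uniq ?uniq_zbox.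
have sub : {subset zbox N <= map h (zbox n)}.
  move=> k; rewrite mem_zbox => /HN'[j <- jN']; apply: map_f; rewrite mem_zbox.
  by apply: leq_trans jN' _; near: n; exists N'.
have split s : uniq s -> {subset zbox N <= s} ->
    \sum_(k <- s) F k = \sum_(k <- zbox N) F k + \sum_(k <- s | k \notin zbox N) F k.
  move=> us ss; rewrite (bigID (mem (zbox N)))/=; congr (_ + _).
  rewrite -big_filter; apply: perm_big; apply: uniq_perm; rewrite ?filter_uniq ?uniq_zbox//.
  by move=> k; rewrite mem_filter; case: (boolP (k \in zbox N)) => // /ss ->.
rewrite AE (split _ un sub) /B (split _ (uniq_zbox P) (zboxS (leq_maxr _ _))).
rewrite opprD addrACA subrr add0r.
apply: (le_trans (normcB _ _)); apply: lerD; rewrite -big_filter.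
  apply: (le_trans (normc_sum _ _)); rewrite (eq_bigr (fun k => `|normc (F k)|)); last first.
    by move=> k _; rewrite ger0_norm ?normc_ge0.
  apply: HN => [|k]; first by rewrite filter_uniq.
  by rewrite mem_filter mem_zbox -ltnNge => /andP[].
apply: (le_trans (normc_sum _ _)); rewrite (eq_bigr (fun k => `|normc (F k)|)); last first.
  by move=> k _; rewrite ger0_norm ?normc_ge0.
apply: HN => [|k]; first by rewrite filter_uniq ?uniq_zbox.
by rewrite mem_filter mem_zbox -ltnNge => /andP[].
Unshelve. all: by end_near.
Qed.

Lemma csum_reflect (F : int -> R[i]) k : csummable F -> csum (fun j => F (k - j)) = csum F.
Proof.
apply: (@csum_inj F (fun j => k - j)); first by move=> a b /addrI /oppr_inj.
by move=> j; exists (k - j); rewrite subKr.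
Qed.

End Tails.

Ltac nneg := repeat match goal with
  | |- is_true (0 <= _ + _) => apply: addr_ge0
  | |- is_true (0 <= _ * _) => apply: mulr_ge0
  | |- is_true (0 <= _ ^+ 2) => exact: sqr_ge0
  | |- is_true (0 <= _ ^+ _) => apply: exprn_ge0
  | |- is_true (0 <= _^-1) => rewrite invr_ge0
  | |- _ => first [ exact: ler0n | exact: normc_ge0 | exact: jp_ge0 | exact: sqrtr_ge0
                  | exact: normr_ge0 | assumption | exact: ltW ]
  end.

(** * Convolutions with a symbol *)

Section Conv.
Context {R : realType}.
Local Notation jp := (japanese R).
Implicit Types (f g : int -> R[i]) (m : int -> int -> R[i]) (F G K M : R).

(** The coefficients of a bilinear Fourier multiplier applied to the functions with coefficients [f]
    and [g]. *)
Definition cv m f g (k : int) : R[i] := csum (fun j => m k j * f j * g (k - j)).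

(** Uniformity in j for each fixed k is all that absolute convergence at k asks for; the symbol [mN]
    grows with k. Together with square summability ([sq]) it makes [cv] bilinear. *)
Definition symb m := forall k, exists K, forall j, normc (m k j) <= K.
Definition sq f := exists M, 0 <= M /\ hb 0 f M.

Lemma hb_sq r f M : 0 <= M -> hb r f M -> sq f.
Proof. by move=> M0 fM; exists M; split => //; exact: hb_w fM. Qed.

Lemma sqD f g : sq f -> sq g -> sq (fun k => f k + g k).
Proof.
by move=> [F [F0 fF]] [G [G0 gG]]; exists (F + G); split; [exact: addr_ge0|exact: hbD].
Qed.

Lemma sqN f : sq f -> sq (fun k => - f k).
Proof. by move=> [F [F0 fF]]; exists F; split => //; exact: hbN. Qed.

Lemma sqB f g : sq f -> sq g -> sq (fun k => f k - g k).
Proof. by move=> ? ?; apply: sqD => //; exact: sqN. Qed.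

Lemma sqZ c f : sq f -> sq (fun k => c * f k).
Proof.
move=> [F [F0 fF]]; exists (normc c * F); split; first by rewrite mulr_ge0 ?normc_ge0.
exact: hbZ.
Qed.

Lemma cv_csummable m f g k : symb m -> sq f -> sq g ->
  csummable (fun j => m k j * f j * g (k - j)).
Proof.
move=> /(_ k)[K mK] [F [F0 fF]] [G [G0 gG]].
apply: (@csummable_le _ _ (fun j => K%:C%C * (f j * g (k - j)))).
  move=> j; rewrite -mulrA !normcMM normc_real; apply: ler_wpM2r; first by rewrite mulr_ge0 ?normc_ge0.
  by apply: le_trans (mK j) _; exact: ler_norm.
apply: csummableZ; exists (F * G).
have hi : injective (fun j : int => k - j) by move=> a b /addrI /oppr_inj.
have := l1b_mul F0 G0 fF (l2b_inj hi gG).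
by apply: l1b_le => j /=; rewrite !expr0 !mul1r normcMM.
Qed.

Lemma cvDl m f1 f2 g k : symb m -> sq f1 -> sq f2 -> sq g ->
  cv m (fun k => f1 k + f2 k) g k = cv m f1 g k + cv m f2 g k.
Proof.
move=> ? ? ? ?; rewrite /cv -csumD; [|exact: cv_csummable..].
by congr csum; apply/funext => j; ring.
Qed.

Lemma cvDr m f g1 g2 k : symb m -> sq f -> sq g1 -> sq g2 ->
  cv m f (fun k => g1 k + g2 k) k = cv m f g1 k + cv m f g2 k.
Proof.
move=> ? ? ? ?; rewrite /cv -csumD; [|exact: cv_csummable..].
by congr csum; apply/funext => j; ring.
Qed.

Lemma cvZl m c f g k : symb m -> sq f -> sq g ->
  cv m (fun k => c * f k) g k = c * cv m f g k.
Proof.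
move=> ? ? ?; rewrite /cv -csumZ; last exact: cv_csummable.
by congr csum; apply/funext => j; ring.
Qed.

Lemma cvZr m c f g k : symb m -> sq f -> sq g ->
  cv m f (fun k => c * g k) k = c * cv m f g k.
Proof.
move=> ? ? ?; rewrite /cv -csumZ; last exact: cv_csummable.
by congr csum; apply/funext => j; ring.
Qed.

Lemma cvBl m f1 f2 g k : symb m -> sq f1 -> sq f2 -> sq g ->
  cv m (fun k => f1 k - f2 k) g k = cv m f1 g k - cv m f2 g k.
Proof.
move=> ? ? ? ?; rewrite /cv -csumB; [|exact: cv_csummable..].
by congr csum; apply/funext => j; ring.
Qed.

Lemma cvBr m f g1 g2 k : symb m -> sq f -> sq g1 -> sq g2 ->
  cv m f (fun k => g1 k - g2 k) k = cv m f g1 k - cv m f g2 k.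
Proof.
move=> ? ? ? ?; rewrite /cv -csumB; [|exact: cv_csummable..].
by congr csum; apply/funext => j; ring.
Qed.

Lemma cvBm m1 m2 f g k : symb m1 -> symb m2 -> sq f -> sq g ->
  cv (fun k j => m1 k j - m2 k j) f g k = cv m1 f g k - cv m2 f g k.
Proof.
move=> ? ? ? ?; rewrite /cv -csumB; [|exact: cv_csummable..].
by congr csum; apply/funext => j; ring.
Qed.

Lemma symbB m1 m2 : symb m1 -> symb m2 -> symb (fun k j => m1 k j - m2 k j).
Proof.
move=> s1 s2 k; have [K1 H1] := s1 k; have [K2 H2] := s2 k; exists (K1 + K2) => j.
by apply: le_trans (normcB _ _) _; exact: lerD.
Qed.

Lemma cvC m f g k : symb m -> (forall k j, m k (k - j) = m k j) -> sq f -> sq g ->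
  cv m f g k = cv m g f k.
Proof.
move=> sm msym sf sg; rewrite /cv -(csum_reflect k); last exact: cv_csummable.
by congr csum; apply/funext => j; rewrite subKr msym; ring.
Qed.

(** In each of the two terms of the symbol bound one factor carries a derivatives and is measured in
    l^2, the other carries b < a and is in l^1 by [hb_l1]. Young's inequality gives 3 F G for each
    term, uniformly in the truncation of the sum over j. *)
Lemma cv_hb m f g F G K (r a b : nat) : symb m -> (b.+1 <= a)%N -> 0 <= F -> 0 <= G -> 0 <= K ->
  (forall k j, jp k ^+ r * normc (m k j) <=
     K * (jp j ^+ b * jp (k - j) ^+ a + jp j ^+ a * jp (k - j) ^+ b)) ->
  hb a f F -> hb a g G -> hb r (cv m f g) (6 * K * F * G).
Proof.
move=> sm ba F0 G0 K0 mK fF gG.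
have sf : sq f by exact: hb_sq fF.
have sg : sq g by exact: hb_sq gG.
set pf := fun e j => jp j ^+ e * normc (f j); set pg := fun e j => jp j ^+ e * normc (g j).
have pf0 e j : 0 <= pf e j by exact: jpnormc_ge0.
have pg0 e j : 0 <= pg e j by exact: jpnormc_ge0.
have F30 : 0 <= 3 * F by rewrite mulr_ge0.
have G30 : 0 <= 3 * G by rewrite mulr_ge0.
have f1 : l1b (pf b) (3 * F) by apply: hb_l1 => //; exact: hb_w fF.
have g1 : l1b (pg b) (3 * G) by apply: hb_l1 => //; exact: hb_w gG.
pose part N k := \sum_(j <- zbox N) m k j * f j * g (k - j).
apply: (@hb_lim _ _ part _ (fun=> 6 * K * F * G)); last exact: cvg_cst.
  by move=> k; apply: csum_cvg; exact: cv_csummable.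
move=> N.
have H1 := young12 F30 (uniq_zbox N) (pf0 b) f1 gG.
have H2 := young21 G30 (uniq_zbox N) (pg0 b) fF g1.
have -> : 6 * K * F * G = `|K| * (3 * F * G + F * (3 * G)) by rewrite ger0_norm//; ring.
have := l2bZ K (l2bD (mulr_ge0 F30 G0) (mulr_ge0 F0 G30) H1 H2).
apply: l2b_le => k; rewrite ger0_norm ?jpnormc_ge0//.
apply: le_trans (ler_norm _); rewrite -big_split/= mulr_sumr.
apply: (@le_trans _ _ (jp k ^+ r * \sum_(j <- zbox N) normc (m k j * f j * g (k - j)))).
  by apply: ler_wpM2l; [exact: jpX_ge0|exact: normc_sum].
rewrite mulr_sumr; apply: ler_sum => j _; rewrite !normcMM.
have := ler_wpM2r (mulr_ge0 (normc_ge0 (f j)) (normc_ge0 (g (k - j)))) (mK k j).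
rewrite /pf /pg; set x := _ ^+ r; rewrite -!mulrA; move/le_trans; apply.
by rewrite le_eqVlt; apply/orP; left; apply/eqP; ring.
Qed.

(** The power <k>^p is split onto the two factors by [jpX_split]. Since p > 0, the factor that
    receives none of it has a derivative to spare for the l^1 bound. *)
Lemma cv_hb_poly m f g F G K (r p b : nat) : (0 < p)%N -> 0 <= F -> 0 <= G -> 0 <= K -> symb m ->
  (forall k j, jp k ^+ r * normc (m k j) <= K * (jp k ^+ p * jp j ^+ b * jp (k - j) ^+ b)) ->
  hb (p + b) f F -> hb (p + b) g G -> hb r (cv m f g) (6 * (K * 2 ^+ p) * F * G).
Proof.
move=> p0 F0 G0 K0 sm mK; apply: (@cv_hb m f g F G _ r (p + b) b) => //.
- by lia.
- by rewrite mulr_ge0 ?exprn_ge0.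
move=> k j; apply: le_trans (mK k j) _; rewrite -[leRHS]mulrA; apply: ler_wpM2l => //.
rewrite -[leLHS]mulrA.
apply: le_trans (ler_wpM2r _ (jpX_split p k j)) _; first by rewrite mulr_ge0 ?jpX_ge0.
by rewrite le_eqVlt; apply/orP; left; apply/eqP; rewrite !exprD; ring.
Qed.

End Conv.

(** * Taylor estimates for e^{ix} *)

Section Cis.
Context {R : realType}.
Implicit Types x y : R.

Lemma cisD x y : cis (x + y) = cis x * cis y.
Proof. by apply: complex_ext; rewrite ?Re_mul ?Im_mul /= ?cosD ?sinD//; ring. Qed.

Lemma cis0 : cis 0 = 1 :> R[i].
Proof. by apply: complex_ext; rewrite /= ?cos0 ?sin0. Qed.

Lemma cisN x : cis (- x) = conjc (cis x).
Proof. by rewrite /cis/= cosN sinN. Qed.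

Lemma normc_cis x : normc (cis x) = 1.
Proof. by rewrite /= cos2Dsin2 sqrtr1. Qed.

Lemma cisK x z : cis x * (cis (- x) * z) = z :> R[i].
Proof. by rewrite mulrA -cisD subrr cis0 mul1r. Qed.

Lemma sin_le_norm x : `|sin x| <= `|x|.
Proof.
wlog x0 : x / 0 <= x.
  move=> H; have [/H//|/ltW x0] := leP 0 x.
  by have := H (- x); rewrite sinN !normrN oppr_ge0; apply.
have [->|xn0] := eqVneq x 0; first by rewrite sin0.
have xp : 0 < x by rewrite lt_def xn0.
have [c _] := MVT xp (fun z _ => is_derive_sin z) (continuous_subspaceT (@continuous_sin R)).
rewrite sin0 !subr0 => ->; rewrite normrM -[leRHS]mul1r.
by apply: ler_wpM2r => //; exact: cos_max.
Qed.

Lemma sin_sqr_le x : sin x ^+ 2 <= x ^+ 2.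
Proof.
rewrite -(real_normK (num_real (sin x))) -(real_normK (num_real x)).
by apply: lerXn2r; rewrite ?nnegrE ?sin_le_norm.
Qed.

(** The modulus is 2 |sin (x / 2)|. *)
Lemma normc_cis1 x : normc (cis x - 1) <= `|x|.
Proof.
rewrite -(@ler_pXn2r _ 2) ?nnegrE ?normc_ge0// normc_sqr Re_add Im_add Re_opp Im_opp /= oppr0 addr0.
have -> : x = (x / 2) *+ 2 by rewrite -mulr_natr divfK.
set y := x / 2; rewrite cos_mulr2n sin_mulr2n real_normK ?num_real//.
have H := sin_sqr_le y.
have -> : (cos y ^+ 2 *+ 2 - 1 - 1) ^+ 2 + ((cos y * sin y) *+ 2) ^+ 2 = 4 * sin y ^+ 2.
  have := cos2Dsin2 y => E.
  have -> : (cos y ^+ 2 *+ 2 - 1 - 1) = - (2 * sin y ^+ 2) by rewrite -mulr_natr; lra.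
  rewrite -mulr_natr; transitivity (4 * sin y ^+ 2 * (cos y ^+ 2 + sin y ^+ 2)); first by ring.
  by rewrite E mulr1.
by rewrite -mulr_natr; lra.
Qed.

Lemma normc_cis1_le2 x : normc (cis x - 1) <= 2.
Proof.
apply: le_trans (normcB _ _) _; rewrite normc_cis (_ : normc 1 = 1); last exact: ComplexField.Normc.normc1.
lra.
Qed.

(** Interpolation between the bounds 2 and |x|. It gains only the square root of the phase, which is
    the origin of the sqrt tau in [mB_bound], but it costs only half as many derivatives. *)
Lemma normc_cis1_sqr x : normc (cis x - 1) ^+ 2 <= 2 * `|x|.
Proof.
by rewrite expr2; apply: ler_pM; rewrite ?normc_ge0 ?normc_cis1_le2 ?normc_cis1.
Qed.

Lemma normc_cisB x y : normc (cis x - cis y) <= `|x - y|.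
Proof.
have -> : cis x - cis y = cis y * (cis (x - y) - 1).
  by rewrite mulrBr mulr1 -cisD (_ : y + (x - y) = x)//; ring.
by rewrite normcMM normc_cis mul1r normc_cis1.
Qed.

(** Real and imaginary parts are each at most x^2: cos x - 1 = -2 sin^2 (x / 2), and the mean value
    theorem for sin x - x gives (cos c - 1) x with |cos c - 1| <= |c|. *)
Lemma normc_cis2 x : normc (cis x - 1 - Complex 0 x) <= 2 * x ^+ 2.
Proof.
have sin2 : `|sin x - x| <= x ^+ 2.
  wlog x0 : x / 0 <= x.
    move=> H; have [/H//|/ltW x0] := leP 0 x.
    have := H (- x); rewrite sinN sqrrN oppr_ge0 -normrN => /(_ x0).
    by rewrite opprD !opprK.
  have [->|xn0] := eqVneq x 0; first by rewrite sin0 subr0 normr0 expr0n.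
  have xp : 0 < x by rewrite lt_def xn0.
  have d1 (z : R) : z \in `]0, x[%R -> is_derive z 1 (fun z => sin z - z) (cos z - 1).
    by move=> _; apply: is_deriveB.
  have c1 : {within `[0, x], continuous (fun z : R => sin z - z)}.
    by apply: continuous_subspaceT => z; apply: cvgB; [exact: continuous_sin|exact: cvg_id].
  have [c cx] := MVT xp d1 c1.
  move: cx; rewrite in_itv/= => /andP[c0 cx].
  rewrite /= sin0 !subr0 => E; rewrite [X in `|X|]E normrM expr2 (ger0_norm x0).
  apply: ler_wpM2r => //; apply: le_trans (ltW cx).
  rewrite -[leRHS](ger0_norm (ltW c0)).
  apply: le_trans (normc_cis1 c).
  by have := Re_le (cis c - 1); rewrite Re_add Re_opp.
have cos2 : `|cos x - 1| <= x ^+ 2.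
  have -> : x = (x / 2) *+ 2 by rewrite -mulr_natr divfK.
  set y := x / 2; rewrite cos_mulr2n.
  have H := sin_sqr_le y.
  have -> : (cos y ^+ 2 *+ 2 - 1 - 1) = - (2 * sin y ^+ 2).
    by rewrite -mulr_natr; have := cos2Dsin2 y; lra.
  rewrite normrN ger0_norm; last by apply: mulr_ge0 => //; exact: sqr_ge0.
  have -> : (y *+ 2) ^+ 2 = 4 * y ^+ 2 by ring.
  by have := sqr_ge0 y; lra.
apply: le_trans (normc_le _) _; rewrite !Re_add !Im_add !Re_opp !Im_opp/= !oppr0 !addr0.
by apply: le_trans (lerD cos2 sin2) _; rewrite -mulr2n -[leLHS]mulr_natl.
Qed.

End Cis.

(** * The symbols of the scheme and of the twisted equation *)

Section Symbols.
Context {R : realType}.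
Local Notation jp := (japanese R).
Implicit Types (f g e V : int -> R[i]) (s tau : R) (k j : int).

(* k^3 - j^3 - (k - j)^3, the resonance of the KdV dispersion relation. *)
Definition phase k j : R := 3 * k%:~R * j%:~R * (k - j)%:~R.

(* [cv (mB tau) f g] is the bilinear form whose value at f = g = (v^n + v^{n+1})/2
   is the increment of the scheme in the twisted variable v = exp(t d_x^3) u; for
   mean-zero f and g it is the integral over [0, tau] of [cv (mN s) f g], the nonlinearity
   of the twisted equation.
   Since 0^-1 = 0, the frequencies j = 0 and j = k do not contribute. *)
Definition mB tau k j : R[i] :=
  (- (6^-1 * j%:~R^-1 * (k - j)%:~R^-1))%:C%C * (cis (- (tau * phase k j)) - 1).

Definition mN s k j : R[i] := Complex 0 (k%:~R / 2) * cis (- (s * phase k j)).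

Lemma jpE k : k != 0 -> jp k = `|k%:~R|.
Proof. by rewrite /japanese => /negbTE ->. Qed.

Lemma norm_intV_le1 k : `|(k%:~R : R)^-1| <= 1.
Proof.
have [->|k0] := eqVneq k 0; first by rewrite invr0 normr0.
by rewrite normfV invf_le1 ?normr_gt0 ?intr_eq0// -jpE ?jp_ge1.
Qed.

Lemma symb_mB tau : symb (mB tau).
Proof.
move=> k; exists 1 => j; rewrite normcMM normc_real normrN !normrM.
have h1 := normc_cis1_le2 (- (tau * phase k j)); have h1' := normc_ge0 (cis (- (tau * phase k j)) - 1).
have h2 := norm_intV_le1 j; have h3 := norm_intV_le1 (k - j).
have h2' := normr_ge0 ((j%:~R : R)^-1); have h3' := normr_ge0 (((k - j)%:~R : R)^-1).
rewrite (ger0_norm (_ : 0 <= 6^-1)) ?invr_ge0//.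
set a := `|_^-1| in h2 h2' *; set b := `|_| in h3 h3' *; set c := normc _ in h1 h1' *.
have : a * b <= 1 by rewrite -[leRHS]mul1r; apply: ler_pM.
have := mulr_ge0 h2' h3'; rewrite -!mulrA; nra.
Qed.

Lemma normc_i (x : R) : normc (Complex 0 x) = `|x|.
Proof. by rewrite /= expr0n/= add0r sqrtr_sqr. Qed.

Lemma normc_mN s k j : normc (mN s k j) = `|k%:~R| / 2.
Proof. by rewrite normcMM normc_cis mulr1 normc_i normrM normfV (ger0_norm (_ : 0 <= 2)). Qed.

Lemma symb_mN s : symb (mN s).
Proof. by move=> k; exists (`|k%:~R| / 2) => j; rewrite normc_mN. Qed.

Lemma phase_sym k j : phase k (k - j) = phase k j.
Proof. by rewrite /phase subKr; ring. Qed.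

Lemma mB_sym tau k j : mB tau k (k - j) = mB tau k j.
Proof. by rewrite /mB phase_sym subKr; congr (_ %:C%C * _); ring. Qed.

Lemma norm_phase_le k j : `|phase k j| <= 3 * (jp k * jp j * jp (k - j)).
Proof.
rewrite /phase !normrM (ger0_norm (_ : 0 <= 3))// -!mulrA ler_wpM2l//.
by do !apply: ler_pM => //; rewrite ?mulr_ge0 ?normr_ge0 ?normr_le_jp.
Qed.

(** With a = <j>, b = <k-j>, c = <k>, the interpolated bound makes the square of the left side at
    most tau c^3 / (6 a b). Since c <= a + b and a + b <= 2 a b, this is at most tau (a + b)^2. *)
Lemma mB_bound tau k j : 0 <= tau ->
  jp k ^+ 1 * normc (mB tau k j) <=
  Num.sqrt tau * (jp j ^+ 0 * jp (k - j) ^+ 1 + jp j ^+ 1 * jp (k - j) ^+ 0).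
Proof.
move=> t0; rewrite !expr0 !expr1 mul1r mulr1.
have rhs0 : 0 <= Num.sqrt tau * (jp (k - j) + jp j).
  by rewrite mulr_ge0 ?sqrtr_ge0 ?addr_ge0 ?jp_ge0.
have [z|nz] := eqVneq (phase k j) 0.
  by rewrite /mB z mulr0 oppr0 cis0 subrr mulr0 normc00 mulr0.
have k0 : k != 0 by apply: contraNneq nz => ->; rewrite /phase; rewrite mulr0 !mul0r.
have j0 : j != 0 by apply: contraNneq nz => ->; rewrite /phase; rewrite mulr0 !mul0r.
have l0 : k - j != 0 by apply: contraNneq nz => e; rewrite /phase e mulr0.
have H := normc_cis1_sqr (- (tau * phase k j)).
rewrite normrN normrM (ger0_norm t0) in H.
have P : `|phase k j| = 3 * (jp k * jp j * jp (k - j)).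
  by rewrite /phase !normrM -!jpE// ger0_norm//; ring.
rewrite P in H.
rewrite normcMM normc_real normrN !normrM !normfV -!jpE// (ger0_norm (_ : 0 <= 6)) //.
move: (normc_ge0 (cis (- (tau * phase k j)) - 1)) H.
move: (normc (cis (- (tau * phase k j)) - 1)) => n n0 H.
rewrite -(@ler_pXn2r _ 2) ?nnegrE//; last first.
  by rewrite !mulr_ge0 ?invr_ge0 ?jp_ge0.
rewrite exprMn [(_ * n) ^+ 2]exprMn [in leRHS]exprMn sqr_sqrtr//.
have := jp_split (R := R) k j; have := jp_ge1 (R := R) j; have := jp_ge1 (R := R) (k - j).
have := jp_gt0 (R := R) k.
set a := jp j; set b := jp (k - j); set c := jp k => c0 b1 a1 cab.
have a0 : 0 < a by lra.
have b0 : 0 < b by lra.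
have ab0 : 0 < a * b by exact: mulr_gt0.
apply: (@le_trans _ _ (c ^+ 2 * ((6^-1 * a^-1 * b^-1) ^+ 2 * (2 * (tau * (3 * (c * a * b))))))).
  apply: ler_wpM2l; first exact: sqr_ge0. by apply: ler_wpM2l; [exact: sqr_ge0|exact: H].
have -> : c ^+ 2 * ((6^-1 * a^-1 * b^-1) ^+ 2 * (2 * (tau * (3 * (c * a * b))))) =
    tau * (c ^+ 3 / (6 * (a * b))).
  by field; rewrite !lt0r_neq0.
apply: ler_wpM2l => //; rewrite ler_pdivrMr; last by rewrite mulr_gt0.
have s1 : a + b <= 2 * (a * b) by nra.
have c3 : c ^+ 3 <= (b + a) ^+ 3.
  by rewrite addrC; apply: lerXn2r => //; rewrite nnegrE ltW// addr_gt0.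
apply: (le_trans c3); rewrite exprS mulrC; apply: ler_wpM2l; first exact: sqr_ge0.
by rewrite addrC; lra.
Qed.

Lemma B_hb tau f g (F G : R) : 0 <= tau -> 0 <= F -> 0 <= G -> hb 1 f F -> hb 1 g G ->
  hb 1 (cv (mB tau) f g) (6 * Num.sqrt tau * F * G).
Proof.
move=> t0 F0 G0 fF gG; apply: (@cv_hb _ _ f g F G (Num.sqrt tau) 1 1 0) => //.
- exact: symb_mB.
- by move=> k j; exact: mB_bound.
Qed.

(** The factor k of the symbol is the space derivative of the nonlinearity, hence the loss of one
    derivative; the oscillating factor has modulus 1. *)
Lemma N_hb s r f g (F G : R) : 0 <= F -> 0 <= G -> hb r.+1 f F -> hb r.+1 g G ->
  hb r (cv (mN s) f g) (6 * 2 ^+ r * F * G).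
Proof.
move=> F0 G0 fF gG.
have -> : 6 * 2 ^+ r * F * G = 6 * (2^-1 * 2 ^+ r.+1) * F * G by rewrite exprS; field.
apply: (@cv_hb_poly _ _ f g F G 2^-1 r r.+1 0); rewrite ?addn0//.
- exact: symb_mN.
move=> k j; rewrite normc_mN !expr0 !mulr1 exprSr.
by have := ler_wpM2l (jpX_ge0 (R := R) k r) (normr_le_jp (R := R) k); lra.
Qed.

(** The error of freezing the oscillating phase at time 0. *)
Definition mD s k j : R[i] := mN s k j - mN 0 k j.

Lemma symb_mD s : symb (mD s).
Proof. by apply: symbB; exact: symb_mN. Qed.

(** The phase contributes s times k j (k - j) in addition to the factor k of [mN]: two derivatives
    on the product and one on each factor, so three are lost in exchange for a power of s. *)
Lemma D_hb s r f g (F G : R) : 0 <= s -> 0 <= F -> 0 <= G -> hb r.+3 f F -> hb r.+3 g G ->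
  hb r (cv (mD s) f g) (36 * s * 2 ^+ r * F * G).
Proof.
move=> s0 F0 G0 fF gG.
have -> : 36 * s * 2 ^+ r * F * G = 6 * ((3 / 2 * s) * 2 ^+ r.+2) * F * G.
  by rewrite 2!exprS; field.
apply: (@cv_hb_poly _ _ f g F G (3 / 2 * s) r r.+2 1); rewrite ?addn1//.
- by rewrite mulr_ge0// divr_ge0.
- exact: symb_mD.
move=> k j; rewrite !expr1 /mD -mulrBr normcMM normc_i normrM.
rewrite (ger0_norm (_ : 0 <= 2^-1)) ?invr_ge0//.
have H := normc_cisB (- (s * phase k j)) (- (0 * phase k j)).
rewrite mul0r oppr0 subr0 normrN normrM (ger0_norm s0) in H.
rewrite mul0r oppr0.
have {}H := le_trans H (ler_wpM2l s0 (norm_phase_le k j)).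
rewrite -mulrA 2!exprSr.
have e1 := normr_le_jp (R := R) k.
have e2 := jpX_ge0 (R := R) k r.
have e3 := jp_ge0 (R := R) j.
have e4 := jp_ge0 (R := R) (k - j).
have e5 := jp_ge0 (R := R) k.
apply: (@le_trans _ _ (jp k ^+ r * (jp k * (2^-1 * (s * (3 * (jp k * jp j * jp (k - j)))))))).
  apply: ler_wpM2l => //; rewrite -[leLHS]mulrA; apply: ler_pM => //.
    by apply: mulr_ge0; rewrite ?invr_ge0//; exact: normc_ge0.
  by apply: ler_wpM2l; rewrite ?invr_ge0.
by rewrite le_eqVlt; apply/orP; left; apply/eqP; field.
Qed.

Lemma mNB s f g k : sq f -> sq g -> cv (mD s) f g k = cv (mN s) f g k - cv (mN 0) f g k.
Proof. by move=> *; apply: cvBm => //; exact: symb_mN. Qed.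

End Symbols.

(** * Stability in H^1 *)

Section Stability.
Context {R : realType}.
Local Notation jp := (japanese R).
Implicit Types (f g e V : int -> R[i]) (tau : R) (k j : int).

(** The Hermitian symmetry of the coefficients of a real-valued function. *)
Definition csym e := forall k, e (- k) = conjc (e k).

(** Truncating one argument at the box that also bounds k turns the energy pairing into a finite sum
    over a square, where k and j may be exchanged. *)
Definition trunc (M : nat) e k : R[i] := if k \in zbox M then e k else 0.

Lemma csum_box (F : int -> R[i]) M : (forall k, k \notin zbox M -> F k = 0) ->
  csum F = \sum_(k <- zbox M) F k.
Proof.
move=> F0.
have E s : uniq s -> {subset zbox M <= s} ->
    \sum_(k <- s) F k = \sum_(k <- zbox M) F k.
  move=> us ss; rewrite (bigID (mem (zbox M)))/= [X in _ + X]big1_seq ?addr0; last first.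
    by move=> k /andP[kM _]; exact: F0.
  rewrite -big_filter; apply: perm_big; apply: uniq_perm; rewrite ?filter_uniq ?uniq_zbox//.
  by move=> k; rewrite mem_filter; case: (boolP (k \in zbox M)) => // /ss ->.
apply: csumE.
  exists (\sum_(k <- zbox M) normc (F k)) => s us.
  rewrite (bigID (mem (zbox M)))/= [X in _ + X]big1_seq ?addr0; last first.
    by move=> k /andP[kM _]; rewrite F0// normc00 normr0.
  rewrite -big_filter; apply: (@le_trans _ _ (\sum_(k <- [seq i <- s | i \in zbox M]) normc (F k))).
    by apply: ler_sum => k _; rewrite ger0_norm ?normc_ge0.
  apply: sum_sub; rewrite ?filter_uniq ?uniq_zbox//.
    by move=> k; rewrite mem_filter => /andP[].
  by move=> k; exact: normc_ge0.
apply/cvgr0Pnorm_le => eps eps0; exists M => // n /= Mn.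
by rewrite E ?uniq_zbox ?subrr ?normc00 ?normr0 ?ltW//; exact: zboxS.
Qed.

Lemma hb_trunc_tail r e (E eps : R) : 0 <= E -> hb r e E -> 0 < eps ->
  exists N, forall M, (N <= M)%N -> hb r (fun k => e k - trunc M e k) eps.
Proof.
move=> E0 eE eps0.
have l1 : l1b (fun k => (jp k ^+ r * normc (e k)) ^+ 2) (E ^+ 2).
  by move=> s us; under eq_bigr do rewrite ger0_norm ?sqr_ge0//; exact: eE.
have [N HN] := l1b_tail l1 (exprn_gt0 2 eps0).
exists N => M NM s us.
rewrite (bigID (mem (zbox M)))/= [X in X + _]big1_seq ?add0r; last first.
  by move=> k /andP[kM _]; rewrite /trunc kM subrr normc00 mulr0 expr0n.
rewrite -big_filter; apply: le_trans (HN [seq k <- s | k \notin zbox M] _ _).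
- rewrite !big_filter; apply: ler_sum => k kM; rewrite /trunc (negbTE kM) subr0.
  exact: ler_norm.
- exact: filter_uniq.
by move=> k; rewrite mem_filter mem_zbox -ltnNge => /andP[kM _]; exact: leq_ltn_trans kM.
Qed.

Lemma cv_trunc m M e V k : cv m (trunc M e) V k =
  \sum_(j <- zbox M) m k j * e j * V (k - j).
Proof.
rewrite /cv (csum_box (M := M)).
  by apply: eq_big_seq => j jM; rewrite /trunc jM.
by move=> j jM; rewrite /trunc (negbTE jM) mulr0 mul0r.
Qed.

(** <k> and |k| differ only at k = 0, where the phase, and with it [mB], vanishes. The symmetrized
    algebra needs the polynomial weight k^2. *)
Lemma mB_jp tau k j : ((jp k ^+ 2)%:C * mB tau k j = (k%:~R ^+ 2)%:C * mB tau k j)%C.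
Proof.
have [->|k0] := eqVneq k 0; last by rewrite jpE// real_normK ?num_real.
by rewrite /mB /phase mulr0 !mul0r mulr0 oppr0 cis0 subrr !mulr0.
Qed.

(* The change of indices (k, j) -> (-j, -k) fixes k - j and the phase. *)
Lemma box_swap (A : int -> int -> R[i]) M :
  \sum_(k <- zbox M) \sum_(j <- zbox M) A k j =
  \sum_(k <- zbox M) \sum_(j <- zbox M) A (- j) (- k).
Proof.
rewrite exchange_big/= -zbox_opp; apply: eq_bigr => k _.
by rewrite -zbox_opp.
Qed.

(* Without symmetrization the weight k^2/(j (k - j)) costs two derivatives.  After it,
   k^2/j - j^2/k = (k - j) ((k - j)^2 + 3 k j)/(k j), which together with
   |cis - 1| <= tau |phase| leaves one derivative on each of the two factors e. *)
Lemma sym_term tau e V k j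
    (A := fun k j => ((k%:~R ^+ 2)%:C%C * conjc (e k)) * (mB tau k j * e j * V (k - j))) :
  0 <= tau -> csym e ->
  normc (A k j + A (- j) (- k)) <=
  tau / 2 * ((normc (e k) * (normc (e j) * (jp (k - j) ^+ 3 * normc (V (k - j)))))
   + 3 * ((jp k * normc (e k)) * ((jp j * normc (e j)) * (jp (k - j) * normc (V (k - j)))))).
Proof.
move=> t0 se.
have ph : phase (- j) (- k) = phase k j :> R.
  by rewrite /phase !mulrNz opprK (addrC (- j)); ring.
have -> : A k j + A (- j) (- k) = (conjc (e k) * e j * V (k - j)) *
   (((- (6^-1 * (k - j)%:~R^-1)) * (k%:~R ^+ 2 * j%:~R^-1 - j%:~R ^+ 2 * k%:~R^-1))%:C%C
     * (cis (- (tau * phase k j)) - 1)).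
  rewrite /A /mB ph !se opprK (addrC (- j)).
  rewrite (_ : conjc (conjc (e j)) = e j); last by case: (e j) => a b /=; rewrite opprK.
  rewrite !mulrNz !invrN !sqrrN.
  set c := cis _ - 1; move: c => c.
  set a := (k%:~R : R); set b := (j%:~R : R); set d := ((k - j)%:~R : R)^-1.
  set a' := a^-1; set b' := b^-1; set z := (_^-1 : R).
  have rM (x y : R) : (x * y)%:C%C = x%:C%C * y%:C%C by exact: rmorphM.
  have rN (x : R) : (- x)%:C%C = - x%:C%C by exact: rmorphN.
  have rB (x y : R) : (x - y)%:C%C = x%:C%C - y%:C%C by exact: rmorphB.
  rewrite !(rM, rN, rB, expr2).
  ring.
rewrite normcMM !normcMM normc_conj normc_real.
have rhs0 : 0 <= tau / 2 * ((normc (e k) * (normc (e j) * (jp (k - j) ^+ 3 * normc (V (k - j)))))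
   + 3 * ((jp k * normc (e k)) * ((jp j * normc (e j)) * (jp (k - j) * normc (V (k - j)))))).
  apply: mulr_ge0; first by rewrite divr_ge0.
  by rewrite addr_ge0 ?mulr_ge0 ?normc_ge0 ?jp_ge0 ?jpX_ge0.
(* A vanishing phase makes the term zero; this also disposes of every frequency at which an inverse
   takes the default value 0. *)
have [z|nz] := eqVneq (phase k j) (0 : R).
  by rewrite z mulr0 oppr0 cis0 subrr normc00 !mulr0.
have k0 : k != 0 by apply: contraNneq nz => ->; rewrite /phase mulr0 !mul0r.
have j0 : j != 0 by apply: contraNneq nz => ->; rewrite /phase mulr0 !mul0r.
have l0 : k - j != 0 by apply: contraNneq nz => h; rewrite /phase h mulr0.
have kR : k%:~R != 0 :> R by rewrite intr_eq0.
have jR : j%:~R != 0 :> R by rewrite intr_eq0.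
have lR : (k - j)%:~R != 0 :> R by rewrite intr_eq0.
have -> : (- (6^-1 * (k - j)%:~R^-1)) * (k%:~R ^+ 2 * j%:~R^-1 - j%:~R ^+ 2 * k%:~R^-1) =
   - (6^-1 * ((k - j)%:~R ^+ 2 + 3 * (k%:~R * j%:~R)) / (k%:~R * j%:~R)) :> R.
  by move: lR; rewrite intrD mulrNz => lR; field; rewrite kR jR lR.
have H := normc_cis1 (- (tau * phase k j)).
rewrite normrN normrM (ger0_norm t0) in H.
move: (normc_ge0 (cis (- (tau * phase k j)) - 1)) H.
move: (normc (cis (- (tau * phase k j)) - 1)) => n n0 H.
move: (normc_ge0 (e k)) (normc_ge0 (e j)) (normc_ge0 (V (k - j))) {rhs0}.
move: (normc (e k)) (normc (e j)) (normc (V (k - j))) => x y v x0 y0 v0.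
rewrite !(jpE k0) !(jpE j0) !(jpE l0).
rewrite normrN normrM normfV normrM (ger0_norm (_ : 0 <= 6^-1)) ?invr_ge0//.
apply: (@le_trans _ _ (x * y * v * ((6^-1 * (`|(k - j)%:~R| ^+ 2 + 3 * (`|k%:~R| * `|j%:~R|)) / (`|k%:~R| * `|j%:~R|)) *
   (tau * (3 * `|k%:~R| * `|j%:~R| * `|(k - j)%:~R|))))).
  apply: ler_wpM2l; first by rewrite !mulr_ge0.
  apply: ler_pM => //.
  - rewrite normrM; apply: ler_wpM2r; first by rewrite invr_ge0 mulr_ge0.
    apply: ler_wpM2l => //.
    apply: le_trans (ler_normD _ _) _; rewrite normrX !normrM.
    by rewrite (ger0_norm (_ : 0 <= 3)).
  - by apply: le_trans H _; rewrite /phase !normrM (ger0_norm (_ : 0 <= 3)).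
have kN : `|k%:~R : R| != 0 by rewrite normr_eq0.
have jN : `|j%:~R : R| != 0 by rewrite normr_eq0.
rewrite le_eqVlt; apply/orP; left; apply/eqP.
by field; rewrite kN jN.
Qed.

(** The sum is half of its symmetrization. In the first term of [sym_term], e is put in l^1 and V in
    H^3; in the second, one e is put in H^1 and <k> V in l^1. The constant is 1/2 times 1/2 times 3
    + 9. *)
Lemma trunc_energy tau e V (E Vn : R) M : 0 <= tau -> 0 <= E -> 0 <= Vn ->
  csym e -> hb 1 e E -> hb 3 V Vn ->
  `|\sum_(k <- zbox M) Re ((jp k ^+ 2)%:C%C * conjc (e k) * cv (mB tau) (trunc M e) V k)|
    <= 3 * tau * Vn * E ^+ 2.
Proof.
move=> t0 E0 Vn0 se eE VVn.
pose A k j := ((k%:~R ^+ 2)%:C%C * conjc (e k)) * (mB tau k j * e j * V (k - j)).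
have -> : \sum_(k <- zbox M) Re ((jp k ^+ 2)%:C%C * conjc (e k) * cv (mB tau) (trunc M e) V k)
    = Re (\sum_(k <- zbox M) \sum_(j <- zbox M) A k j).
  rewrite Re_sum; apply: eq_bigr => k _; rewrite cv_trunc mulr_sumr; congr Re.
  apply: eq_bigr => j _; rewrite /A.
  transitivity (conjc (e k) * ((jp k ^+ 2)%:C%C * mB tau k j) * e j * V (k - j)); first by ring.
  rewrite mB_jp; ring.
apply: (le_trans (Re_le _)).
set S := \sum_(k <- zbox M) _.
have -> : S = (2^-1)%:C%C * (\sum_(k <- zbox M) \sum_(j <- zbox M) (A k j + A (- j) (- k))).
  under eq_bigr do rewrite big_split/=.
  rewrite big_split/= -box_swap -/S.
  by move: S => [x y]; apply: complex_ext => /=; field.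
rewrite normcMM normc_real ger0_norm ?invr_ge0//.
have e1 : hb 0 e E by exact: hb_w eE.
have el1 : l1b (fun k => jp k ^+ 0 * normc (e k)) (3 * E) by exact: hb_l1.
have Vl1 : l1b (fun k => jp k ^+ 1 * normc (V k)) (3 * Vn).
  by apply: hb_l1 => //; exact: hb_w VVn.
have E30 : 0 <= 3 * E by rewrite mulr_ge0.
have V30 : 0 <= 3 * Vn by rewrite mulr_ge0.
have Y1 := young12 E30 (uniq_zbox M) (fun k => jpnormc_ge0 0 k (e k)) el1 VVn.
have Y2 := young21 V30 (uniq_zbox M) (fun k => jpnormc_ge0 1 k (V k)) eE Vl1.
have T1 := sum_mul_le E0 (mulr_ge0 E30 Vn0) (e1 _ (uniq_zbox M)) (Y1 _ (uniq_zbox M)).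
have T2 := sum_mul_le E0 (mulr_ge0 E0 V30) (eE _ (uniq_zbox M)) (Y2 _ (uniq_zbox M)).
rewrite ler_pdivrMl//.
apply: (@le_trans _ _ (tau / 2 * ((E * (3 * E * Vn)) + 3 * (E * (E * (3 * Vn)))))); last first.
  by rewrite le_eqVlt; apply/orP; left; apply/eqP; field.
apply: (le_trans (normc_sum _ _)).
apply: (@le_trans _ _ (\sum_(k <- zbox M) \sum_(j <- zbox M)
   tau / 2 * ((normc (e k) * (normc (e j) * (jp (k - j) ^+ 3 * normc (V (k - j)))))
   + 3 * ((jp k * normc (e k)) * ((jp j * normc (e j)) * (jp (k - j) * normc (V (k - j)))))))).
  apply: ler_sum => k _; apply: (le_trans (normc_sum _ _)); apply: ler_sum => j _.
  exact: sym_term.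
under eq_bigr do rewrite -mulr_sumr.
rewrite -mulr_sumr; apply: ler_wpM2l; first by rewrite divr_ge0.
under eq_bigr do rewrite big_split/=.
rewrite big_split/=; apply: lerD.
  apply: le_trans T1; rewrite le_eqVlt; apply/orP; left; apply/eqP.
  apply: eq_bigr => k _; rewrite mulr_sumr; apply: eq_bigr => j _; rewrite !expr0; ring.
under eq_bigr do rewrite -mulr_sumr.
rewrite -mulr_sumr; apply: ler_wpM2l => //.
apply: le_trans T2; rewrite le_eqVlt; apply/orP; left; apply/eqP.
apply: eq_bigr => k _; rewrite mulr_sumr; apply: eq_bigr => j _; rewrite !expr1; ring.
Qed.

Lemma sum_pairing_le r e d (E D : R) s : uniq s -> 0 <= E -> 0 <= D -> hb r e E -> hb r d D ->
  `|\sum_(k <- s) Re ((jp k ^+ (r + r))%:C%C * conjc (e k) * d k)| <= E * D.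
Proof.
move=> us E0 D0 eE dD; apply: (le_trans (ler_norm_sum _ _ _)).
apply: le_trans (sum_mul_le E0 D0 (eE s us) (dD s us)).
apply: ler_sum => k _; apply: (le_trans (Re_le _)).
rewrite !normcMM normc_conj normc_real ger0_norm ?jpX_ge0// exprD.
by rewrite le_eqVlt; apply/orP; left; apply/eqP; ring.
Qed.

(** The truncation is removed by applying the crude estimate [B_hb] to the tail of e, which is as
    small in H^1 as desired once the box is large. *)
Lemma energy_bound tau e V (E Vn eps : R) : 0 <= tau -> 0 <= E -> 0 <= Vn -> 0 < eps ->
  csym e -> hb 1 e E -> hb 3 V Vn ->
  exists N, forall M, (N <= M)%N ->
  `|\sum_(k <- zbox M) Re ((jp k ^+ 2)%:C%C * conjc (e k) * cv (mB tau) e V k)|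
    <= 3 * tau * Vn * E ^+ 2 + eps.
Proof.
move=> t0 E0 Vn0 eps0 se eE VVn.
have V1 : hb 1 V Vn by exact: hb_w VVn.
(* The factor by which the pairing amplifies the H^1 norm of the tail, plus 1 for positivity. *)
set K := E * (6 * Num.sqrt tau * Vn) + 1.
have K0 : 0 < K by rewrite ltr_wpDl// !mulr_ge0 ?sqrtr_ge0.
have [N HN] := hb_trunc_tail E0 eE (divr_gt0 eps0 K0).
exists N => M NM.
have tl := HN M NM.
have sqt : sq (trunc M e).
  exists E; split => //; apply: hb_le (hb_w (leq0n 1) eE) => k; rewrite /trunc.
  by case: ifP => // _; rewrite normc00 normc_ge0.
have sqe : sq e by exact: hb_sq eE.
have sqV : sq V by exact: hb_sq VVn.
have -> : \sum_(k <- zbox M) Re ((jp k ^+ 2)%:C%C * conjc (e k) * cv (mB tau) e V k) =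
  \sum_(k <- zbox M) Re ((jp k ^+ 2)%:C%C * conjc (e k) * cv (mB tau) (trunc M e) V k) +
  \sum_(k <- zbox M) Re ((jp k ^+ 2)%:C%C * conjc (e k) * cv (mB tau) (fun k => e k - trunc M e k) V k).
  have ee : (fun k => trunc M e k + (e k - trunc M e k)) = e.
    by apply/funext => j; rewrite addrC subrK.
  have split k := cvDl k (symb_mB tau) sqt (sqB sqe sqt) sqV.
  rewrite ee in split.
  by rewrite -big_split/=; apply: eq_bigr => k _; rewrite -Re_add -mulrDr -split.
apply: (le_trans (ler_normD _ _)); apply: lerD; first exact: trunc_energy.
have tl0 : 0 <= eps / K by rewrite ltW// divr_gt0.
have HB := B_hb t0 tl0 Vn0 tl V1.
have HB0 : 0 <= 6 * Num.sqrt tau * (eps / K) * Vn.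
  by rewrite !mulr_ge0 ?sqrtr_ge0 ?invr_ge0 ?(ltW eps0) ?(ltW K0).
apply: le_trans (sum_pairing_le (uniq_zbox M) E0 HB0 eE HB) _.
have -> : E * (6 * Num.sqrt tau * (eps / K) * Vn) = eps / K * (K - 1).
  have -> : K - 1 = E * (6 * Num.sqrt tau * Vn) by rewrite /K addrK.
  by move: K^-1 => x; ring.
have : eps / K * K = eps by rewrite divfK// gt_eqF.
by move=> EK; rewrite mulrBr mulr1 EK lerBlDr lerDl.
Qed.

End Stability.

(** * Propagation of the error over one step *)

Section Step.
Context {R : realType}.
Local Notation jp := (japanese R).
Implicit Types (f g e V : int -> R[i]) (tau : R) (k j : int).

(** The square root of the limit of the box sums. [l2b] only records some upper bound, whereas the
    energy estimate has the new error on both sides and needs the least one. *)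
Lemma l2b_exact (f : int -> R) M : l2b f M ->
  exists m, [/\ 0 <= m, l2b f m & forall B, (forall N, \sum_(k <- zbox N) f k ^+ 2 <= B) -> m ^+ 2 <= B].
Proof.
move=> fM; pose u N := \sum_(k <- zbox N) f k ^+ 2.
have ndu : nondecreasing_seq u.
  move=> m n mn; apply: sum_sub; rewrite ?uniq_zbox//; first exact: zboxS.
  by move=> k; exact: sqr_ge0.
have cu : cvgn u.
  apply: nondecreasing_is_cvgn => //; exists (M ^+ 2) => _ [n _ <-].
  by apply: fM; exact: uniq_zbox.
have u0 n : 0 <= u n by apply: sumr_ge0 => k _; exact: sqr_ge0.
have l0 : 0 <= limn u by apply: limr_ge => //; exact: nearW.
exists (Num.sqrt (limn u)); split; rewrite ?sqrtr_ge0//.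
  move=> s us; rewrite sqr_sqrtr//.
  have [N sN] := zbox_sub s.
  apply: le_trans (nondecreasing_cvgn_le ndu cu N).
  by apply: sum_sub; rewrite ?uniq_zbox// => k; exact: sqr_ge0.
by move=> B uB; rewrite sqr_sqrtr//; apply: limr_le => //; exact: nearW.
Qed.

Lemma le_eps_add (x y c : R) : 0 <= c -> (forall eps, 0 < eps -> x <= y + c * eps) -> x <= y.
Proof.
move=> c0 H; apply/ler_addgt0Pr => eps eps0.
have c10 : 0 < c + 1 by rewrite ltr_wpDl.
apply: le_trans (H _ (divr_gt0 eps0 c10)) _.
rewrite lerD2l mulrA ler_pdivrMr// mulrC ler_pM2l// lerDl//.
Qed.

(* Pairing the error equation with the mean [eb] of the two errors gives
   |e1|^2 - |e0|^2 on the left.  The cubic term is only O(sqrt tau) |eb|^3, and is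
   O(tau) |eb|^2 because [eb] itself is O(sqrt tau) by the smallness hypothesis. *)
Lemma step_error tau (rho E0 eta : R) e0 e1 V d
    (eb := fun k => (2^-1)%:C%C * (e0 k + e1 k)) :
  0 < tau -> 0 < rho -> 54 * rho * Num.sqrt tau <= 1 ->
  0 <= E0 -> 0 <= eta ->
  6 * Num.sqrt tau * (2 * E0 + eta) <= tau -> (6 * rho + 1) * tau <= 1 ->
  csym e0 -> csym e1 -> hb 3 V rho -> hb 1 e0 E0 -> hb 1 eb (4 * rho) -> hb 1 d eta ->
  (forall k, e1 k - e0 k =
     cv (mB tau) eb V k + cv (mB tau) V eb k - cv (mB tau) eb eb k + d k) ->
  hb 1 e1 ((1 + (12 * rho + 2) * tau) * E0 + 2 * eta).
Proof.
move=> t0 rho0 small E00 eta0 small2 small3 s0 s1 Vr e0E ebE dE eq.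
have sq0 := sqrtr_ge0 tau; have rho0' := ltW rho0.
have sqV : sq V by apply: hb_sq Vr; exact: ltW.
have sqe : sq eb by apply: hb_sq ebE; rewrite mulr_ge0// ltW.
have V1 : hb 1 V rho by exact: hb_w Vr.
have ebz k : eb k = (2^-1)%:C%C * (e0 k + e1 k) by [].
have {eq} eq k : e1 k - e0 k = 2 * cv (mB tau) eb V k - cv (mB tau) eb eb k + d k.
  rewrite eq [cv _ V eb k]cvC//; [ring|exact: symb_mB|exact: mB_sym].
(* From e1 = 2 eb - e0. This makes the norm of e1 finite, so that its exact value [E1] can be
   introduced. *)
have e1E : hb 1 e1 (2 * (4 * rho) + E0).
  have H := @hbB _ 1 (fun k => 2%:C%C * eb k) e0 (normc (2%:C : R[i])%C * (4 * rho)) E0.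
  rewrite normc_real ger0_norm// in H.
  apply: hb_le (H _ _ _ e0E) => //.
  - move=> k; rewrite ebz (_ : _ - _ = e1 k)//.
    by case: (e0 k) (e1 k) => [a b] [c' d']; apply: complex_ext => /=; field.
  - by rewrite !mulr_ge0.
  - have := hbZ (2%:C)%C ebE; by rewrite normc_real ger0_norm.
have [E1 [E10 e1E1 E1min]] := l2b_exact e1E.
have [Eb EbE] : {x : R | x = (E0 + E1) / 2} by exists ((E0 + E1) / 2).
have Eb0 : 0 <= Eb by rewrite EbE divr_ge0// addr_ge0.
have ebEb : hb 1 eb Eb.
  have := hbZ (2^-1)%:C%C (hbD E00 E10 e0E e1E1).
  by rewrite normc_real ger0_norm ?invr_ge0// mulrC -EbE.
have bV : hb 1 (cv (mB tau) eb V) (6 * Num.sqrt tau * Eb * rho).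
  by apply: B_hb => //; exact: ltW.
have bb : hb 1 (cv (mB tau) eb eb) (6 * Num.sqrt tau * Eb * Eb).
  by apply: B_hb => //; exact: ltW.
(* The increment is at most 36 rho sqrt tau Eb, hence at most 2/3 Eb = (E0 + E1) / 3 by the
   smallness hypothesis, where 54 = 36 * 3 / 2. The part with E1 is absorbed on the left. *)
have E1crude : E1 <= 2 * E0 + 2 * eta.
  have bb4 : hb 1 (cv (mB tau) eb eb) (6 * Num.sqrt tau * Eb * (4 * rho)).
    by apply: B_hb => //; [exact: ltW|rewrite mulr_ge0// ltW].
  set x1 := 6 * Num.sqrt tau * Eb * rho + 6 * Num.sqrt tau * Eb * rho.
  set x2 := 6 * Num.sqrt tau * Eb * (4 * rho).
  have xx : 0 <= 6 * Num.sqrt tau * Eb * rho by rewrite !mulr_ge0.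
  have x10 : 0 <= x1 by rewrite addr_ge0.
  have x20 : 0 <= x2 by rewrite !mulr_ge0.
  have bV2 : hb 1 (fun k => 2 * cv (mB tau) eb V k) x1.
    by apply: hb_le (hbD xx xx bV bV) => k; rewrite -mulr2n mulr_natl.
  have H := hbD (addr_ge0 E00 (addr_ge0 x10 x20)) eta0
    (hbD E00 (addr_ge0 x10 x20) e0E (hbB x10 x20 bV2 bb4)) dE.
  have {}H : hb 1 e1 (E0 + (x1 + x2) + eta).
    apply: hb_le H => k; rewrite (_ : _ + _ = e1 k)//.
    by rewrite -(subrK (e0 k) (e1 k)) eq; ring.
  have HB0 : 0 <= E0 + (x1 + x2) + eta by rewrite !addr_ge0.
  have {H} : E1 <= E0 + (x1 + x2) + eta.
    rewrite -(@ler_pXn2r _ 2) ?nnegrE//.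
    by apply: E1min => N; apply: H; exact: uniq_zbox.
  have -> : x1 + x2 = 2 / 3 * ((54 * rho * Num.sqrt tau) * Eb) by rewrite /x1 /x2; field.
  have : (54 * rho * Num.sqrt tau) * Eb <= Eb by rewrite -[leRHS]mul1r ler_wpM2r.
  rewrite EbE; lra.
(* The crude bound gives Eb <= 2 E0 + eta, and the smallness hypothesis applies. *)
have sEb : 6 * Num.sqrt tau * Eb <= tau.
  apply: le_trans small2; apply: ler_wpM2l; first by rewrite mulr_ge0.
  rewrite EbE; lra.
have seb : csym eb 
  by move=> k; rewrite !ebz s0 s1 -conjc_add; case: (e0 k + e1 k) => a b; apply: complex_ext => /=; ring.
have energy : E1 ^+ 2 <= E0 ^+ 2 + (Eb * ((12 * rho + 2) * tau * Eb + 2 * eta)).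
  (* The 4 is a 2 from the pairing with eb times a 2 from the two equal products with V. *)
  apply: (@le_eps_add _ _ 4) => // eps eps0.
  have [N0 HN0] := energy_bound (ltW t0) Eb0 (ltW rho0) eps0 seb ebEb Vr.
  apply: E1min => N.
  apply: (@le_trans _ _ (\sum_(k <- zbox (maxn N N0)) (jp k ^+ 1 * normc (e1 k)) ^+ 2)).
    apply: sum_sub; rewrite ?uniq_zbox//; first exact/zboxS/leq_maxl.
    by move=> k; exact: sqr_ge0.
  have := HN0 _ (leq_maxr N N0); set M := maxn N N0 => H1.
  have H2 : `|\sum_(k <- zbox M) Re ((jp k ^+ 2)%:C%C * conjc (eb k) * cv (mB tau) eb eb k)|
      <= Eb * (6 * Num.sqrt tau * Eb * Eb).
    by apply: (sum_pairing_le (uniq_zbox M) Eb0 _ ebEb bb); rewrite !mulr_ge0.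
  have H3 := sum_pairing_le (uniq_zbox M) Eb0 eta0 ebEb dE.
  have H4 := e0E _ (uniq_zbox M).
  (* Since e0 + e1 = 2 eb, the difference |e1|^2 - |e0|^2 is, at each frequency, twice the real part
     of the conjugate of eb times e1 - e0. *)
  have E : \sum_(k <- zbox M) (jp k ^+ 1 * normc (e1 k)) ^+ 2 =
    \sum_(k <- zbox M) (jp k ^+ 1 * normc (e0 k)) ^+ 2 +
    2 * (2 * (\sum_(k <- zbox M) Re ((jp k ^+ 2)%:C%C * conjc (eb k) * cv (mB tau) eb V k))
     - \sum_(k <- zbox M) Re ((jp k ^+ 2)%:C%C * conjc (eb k) * cv (mB tau) eb eb k)
     + \sum_(k <- zbox M) Re ((jp k ^+ 2)%:C%C * conjc (eb k) * d k)).
    rewrite mulr_sumr -sumrB -big_split/= mulr_sumr -big_split/=; apply: eq_bigr => k _.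
    rewrite !expr1 !exprMn !normc_sqr.
    transitivity (jp k ^+ 2 * (Re (e0 k) ^+ 2 + Im (e0 k) ^+ 2) +
      2 * Re ((jp k ^+ 2)%:C%C * conjc (eb k) * (e1 k - e0 k))).
      by rewrite ebz; case: (e0 k) (e1 k) => [a b] [a1 b1] /=; field.
    congr (_ + _ * _); rewrite eq.
    move: (cv (mB tau) eb V k) (cv (mB tau) eb eb k) (d k) (conjc (eb k)) => [x x'] [y y'] [z z'] [w w'] /=; ring.
  have l1 := le_trans (ler_norm _) H1.
  have /lerNnormlW l2 := H2.
  have l3 := le_trans (ler_norm _) H3.
  have l4 : Eb * (6 * Num.sqrt tau * Eb * Eb) <= tau * Eb ^+ 2.
    rewrite [leLHS](_ : _ = (6 * Num.sqrt tau * Eb) * Eb ^+ 2); last by ring.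
    by apply: ler_wpM2r => //; exact: sqr_ge0.
  rewrite E [leRHS](_ : _ = E0 ^+ 2 + 2 * (2 * (3 * tau * rho * Eb ^+ 2 + eps) + tau * Eb ^+ 2 + Eb * eta)); last by ring.
  apply: lerD => //; lra.
set a := (6 * rho + 1) * tau in small3.
have a0 : 0 <= a by rewrite mulr_ge0 ?addr_ge0 ?mulr_ge0// ltW.
suff HE : E1 <= (1 + (12 * rho + 2) * tau) * E0 + 2 * eta.
  by apply: l2b_mono HE e1E1.
have -> : (12 * rho + 2) * tau = 2 * a by rewrite /a; ring.
(* As 2 Eb = E0 + E1, the difference of squares factors and Eb can be cancelled unless it is
   zero. *)
have Hen : (E1 - E0) * (2 * Eb) <= (a * Eb + eta) * (2 * Eb).
  have -> : (E1 - E0) * (2 * Eb) = E1 ^+ 2 - E0 ^+ 2 by rewrite EbE; field.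
  rewrite lerBlDl; apply: (le_trans energy); rewrite lerD2l /a.
  by rewrite le_eqVlt; apply/orP; left; apply/eqP; ring.
have [Ebz|Ebn] := eqVneq Eb 0.
  have : E0 + E1 = 0 by move: Ebz; rewrite EbE; lra.
  move=> z; have -> : E1 = 0 by lra.
  by apply: addr_ge0; rewrite mulr_ge0// addr_ge0// mulr_ge0.
have Ebp : 0 < 2 * Eb by rewrite mulr_gt0// lt_def Ebn.
rewrite ler_pM2r// in Hen.
move: Hen; rewrite EbE => Hen.
have : E1 * (1 - a / 2) <= E0 * (1 + a / 2) + eta by lra.
move=> Hf.
have h1 : 0 < 1 - a / 2 by lra.
rewrite -(ler_pM2r h1); apply: (le_trans Hf).
have h2 : 0 <= 1 - a by lra.
(* a (1 - a) is the gap in 1 + a / 2 <= (1 + 2 a)(1 - a / 2); [h4] is the corresponding gap for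
   eta. *)
have h3 : 0 <= a * (1 - a) * E0 by apply: mulr_ge0 => //; exact: mulr_ge0.
have h4 : 0 <= (1 - a) * eta by exact: mulr_ge0.
move: a h1 h2 h3 h4 {Hf small3 a0 Hen} => a h1 h2 h3 h4.
lra.
Qed.

End Step.

(** * Local error *)

Section ComplexDerivative.
Context {R : realType}.
Local Notation jp := (japanese R).

Definition cder (y : R -> R[i]) (t : R) (d : R[i]) :=
  is_derive t (1 : R) (fun s => Re (y s)) (Re d) /\
  is_derive t (1 : R) (fun s => Im (y s)) (Im d).

Definition ccont (a b : R) (y : R -> R[i]) :=
  {within `[a, b], continuous (fun s => Re (y s))} /\
  {within `[a, b], continuous (fun s => Im (y s))}.

(** A quadratic remainder lets an infinite sum be differentiated from a Taylor bound that is
    summable over its terms. *)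
Lemma is_derive_quad (f : R -> R) (t d K : R) : 
  (forall s, `|f s - f t - (s - t) * d| <= K * (s - t) ^+ 2) -> is_derive t 1 f d.
Proof.
move=> H.
have cv : (fun h : R => h^-1 *: (f (h *: 1 + t) - f t)) @ 0^' --> d.
  apply/cvgrPdist_le => e e0.
  have K1 : 0 < `|K| + 1 by rewrite ltr_wpDl.
  near=> h.
  have h0 : h != 0 by near: h; exact: nbhs_dnbhs_neq.
  have he : `|h| <= e / (`|K| + 1).
    near: h; apply: (@dnbhs0_le _ R^o); exact: divr_gt0.
  have := H (h + t); rewrite addrK => H1.
  have -> : d - h^-1 *: (f (h *: 1 + t) - f t) = - (h^-1 * (f (h + t) - f t - h * d)).
    by rewrite /GRing.scale/= mulr1; field.
  rewrite normrN normrM normfV ler_pdivrMl ?normr_gt0//.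
  apply: (le_trans H1); rewrite -(real_normK (num_real h)) expr2 mulrCA.
  apply: ler_wpM2l => //; apply: (@le_trans _ _ ((`|K| + 1) * `|h|)).
    by apply: ler_wpM2r => //; have := ler_norm K; lra.
  by rewrite mulrC -ler_pdivlMr.
apply: DeriveDef.
  by apply/cvg_ex; exists d.
by rewrite /derive; apply/cvg_lim.
Unshelve. all: by end_near.
Qed.

Lemma cder_quad (y : R -> R[i]) t d K :
  (forall s, normc (y s - y t - (s - t)%:C%C * d) <= K * (s - t) ^+ 2) -> cder y t d.
Proof.
move=> H; split; apply: (@is_derive_quad _ _ _ K) => s; apply: le_trans (H s).
  have := Re_le (y s - y t - (s - t)%:C%C * d).
  by rewrite !Re_add !Re_opp Re_mul /= mul0r subr0.
have := Im_le (y s - y t - (s - t)%:C%C * d).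
by rewrite !Im_add !Im_opp Im_mul /= mul0r addr0.
Qed.

Lemma cderD y z t d e : cder y t d -> cder z t e -> cder (fun s => y s + z s) t (d + e).
Proof.
move=> [a b] [a' b']; split; rewrite ?Re_add ?Im_add.
  by under eq_fun do rewrite Re_add; exact: is_deriveD.
by under eq_fun do rewrite Im_add; exact: is_deriveD.
Qed.

Lemma cderN y t d : cder y t d -> cder (fun s => - y s) t (- d).
Proof.
move=> [a b]; split; rewrite ?Re_opp ?Im_opp.
  by under eq_fun do rewrite Re_opp; exact: is_deriveN.
by under eq_fun do rewrite Im_opp; exact: is_deriveN.
Qed.

Lemma cderB y z t d e : cder y t d -> cder z t e -> cder (fun s => y s - z s) t (d - e).
Proof. by move=> ? ?; apply: cderD => //; exact: cderN. Qed.

Lemma cder_cst t z : cder (fun=> z) t 0.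
Proof. by split; exact: is_derive_cst. Qed.

Lemma cderM y z t d e : cder y t d -> cder z t e ->
  cder (fun s => y s * z s) t (d * z t + y t * e).
Proof.
move=> [a b] [a' b']; split; rewrite ?Re_add ?Im_add ?Re_mul ?Im_mul.
  under eq_fun do rewrite Re_mul.
  apply: (is_derive_eq (is_deriveB (is_deriveM a a') (is_deriveM b b'))).
  by rewrite /GRing.scale/=; ring.
under eq_fun do rewrite Im_mul.
apply: (is_derive_eq (is_deriveD (is_deriveM a b') (is_deriveM b a'))).
by rewrite /GRing.scale/=; ring.
Qed.

Lemma cder_cont y a b : (forall t, exists d, cder y t d) -> ccont a b y.
Proof.
move=> H; split; apply: continuous_subspaceT => t; have [d [h1 h2]] := H t;
  by apply: differentiable_continuous; apply/derivable1_diffP; apply: ex_derive.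
Qed.

Lemma ccontD a b y z : ccont a b y -> ccont a b z -> ccont a b (fun s => y s + z s).
Proof.
move=> [h1 h2] [h3 h4]; split.
  rewrite (_ : (fun s => _) = (fun s => Re (y s) + Re (z s))); last by apply/funext => s; rewrite Re_add.
  by move=> x; apply: cvgD; [exact: h1|exact: h3].
rewrite (_ : (fun s => _) = (fun s => Im (y s) + Im (z s))); last by apply/funext => s; rewrite Im_add.
by move=> x; apply: cvgD; [exact: h2|exact: h4].
Qed.

Lemma ccontN a b y : ccont a b y -> ccont a b (fun s => - y s).
Proof.
move=> [h1 h2]; split.
  rewrite (_ : (fun s => _) = (fun s => - Re (y s))); last by apply/funext => s; rewrite Re_opp.
  by move=> x; apply: cvgN; exact: h1.
rewrite (_ : (fun s => _) = (fun s => - Im (y s))); last by apply/funext => s; rewrite Im_opp.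
by move=> x; apply: cvgN; exact: h2.
Qed.

Lemma ccontB a b y z : ccont a b y -> ccont a b z -> ccont a b (fun s => y s - z s).
Proof. by move=> ? ?; apply: ccontD => //; exact: ccontN. Qed.

Lemma ccontM a b y z : ccont a b y -> ccont a b z -> ccont a b (fun s => y s * z s).
Proof.
move=> [h1 h2] [h3 h4]; split.
  rewrite (_ : (fun s => _) = (fun s => Re (y s) * Re (z s) - Im (y s) * Im (z s))); last first.
    by apply/funext => s; rewrite Re_mul.
  by move=> x; apply: cvgB; apply: cvgM; [exact: h1|exact: h3|exact: h2|exact: h4].
rewrite (_ : (fun s => _) = (fun s => Re (y s) * Im (z s) + Im (y s) * Re (z s))); last first.
  by apply/funext => s; rewrite Im_mul.
by move=> x; apply: cvgD; apply: cvgM; [exact: h1|exact: h4|exact: h2|exact: h3].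
Qed.

Lemma ccont_sub a b a' b' y : a <= a' -> b' <= b -> ccont a b y -> ccont a' b' y.
Proof.
move=> aa bb [h1 h2].
have sub : `[a', b'] `<=` `[a, b] by apply: subset_itv; rewrite bnd_simp.
by split; [exact: continuous_subspaceW h1|exact: continuous_subspaceW h2].
Qed.

Lemma is_derive_bigsum (s : seq int) (F : int -> R -> R) (dF : int -> R) t :
  (forall k, is_derive t (1 : R) (F k) (dF k)) ->
  is_derive t (1 : R) (fun x => \sum_(k <- s) F k x) (\sum_(k <- s) dF k).
Proof.
move=> H; elim: s => [|k s IH].
  by under eq_fun do rewrite big_nil; rewrite big_nil; exact: is_derive_cst.
by under eq_fun do rewrite big_cons; rewrite big_cons; exact: is_deriveD.
Qed.

(* The scalar mean value theorem, applied to the pairing with the increment itself. *)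
Lemma vector_mvt r (y dy : R -> int -> R[i]) (a b M : R) : a <= b -> 0 <= M ->
  (forall k, ccont a b (fun s => y s k)) ->
  (forall s, a < s < b -> forall k, cder (fun s => y s k) s (dy s k)) ->
  (forall s, a < s < b -> hb r (dy s) M) ->
  hb r (fun k => y b k - y a k) ((b - a) * M).
Proof.
rewrite le_eqVlt => /predU1P[<- M0 _ _ _ s us|ab M0 yc yd dM s us].
  rewrite big1 ?sqr_ge0// => k _; by rewrite subrr normc00 mulr0 expr0n.
set z := fun k => y b k - y a k.
pose g t := \sum_(k <- s) (jp k ^+ (r + r) * (Re (z k) * Re (y t k) + Im (z k) * Im (y t k))).
pose dg t := \sum_(k <- s) (jp k ^+ (r + r) * (Re (z k) * Re (dy t k) + Im (z k) * Im (dy t k))).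
have gd t : t \in `]a, b[%R -> is_derive t 1 g (dg t).
  rewrite in_itv/= => tab; apply: is_derive_bigsum => k.
  have [h1 h2] := yd t tab k.
  by apply: is_deriveZ; apply: is_deriveD; apply: is_deriveZ.
have gc : {within `[a, b], continuous g}.
  rewrite /g; elim: (s) => [|k s' IH].
    rewrite (_ : (fun t => _) = (fun=> 0)); last by apply/funext => t; rewrite big_nil.
    by move=> x; exact: cvg_cst.
  rewrite (_ : (fun t => _) = (fun t => jp k ^+ (r + r) * (Re (z k) * Re (y t k) + Im (z k) * Im (y t k))
     + \sum_(k <- s') jp k ^+ (r + r) * (Re (z k) * Re (y t k) + Im (z k) * Im (y t k)))); last first.
    by apply/funext => t; rewrite big_cons.
  move=> x; apply: cvgD; last exact: IH.
  have [h1 h2] := yc k.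
  apply: cvgM; first exact: cvg_cst.
  by apply: cvgD; apply: cvgM; [exact: cvg_cst|exact: h1|exact: cvg_cst|exact: h2].
have [c cab E] := MVT ab gd gc.
move: cab; rewrite in_itv/= => cab.
set Z := \sum_(k <- s) (jp k ^+ r * normc (z k)) ^+ 2.
have Z0 : 0 <= Z by apply: sumr_ge0 => k _; exact: sqr_ge0.
have EZ : g b - g a = Z.
  rewrite /g -sumrB; apply: eq_bigr => k _; rewrite exprMn normc_sqr exprD /z !Re_add !Im_add !Re_opp !Im_opp.
  by rewrite expr2; ring.
have dgM : dg c <= Num.sqrt Z * M.
  apply: (@le_trans _ _ (\sum_(k <- s) (jp k ^+ r * normc (z k)) * (jp k ^+ r * normc (dy c k)))).
    apply: ler_sum => k _; rewrite exprD -!mulrA ler_wpM2l ?jpX_ge0//.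
    rewrite [leRHS]mulrCA ler_wpM2l ?jpX_ge0//.
    rewrite (_ : _ + _ = Re (conjc (z k) * dy c k)); last by rewrite Re_mul Re_conjc Im_conjc; ring.
    by apply: le_trans (ler_norm _) _; apply: le_trans (Re_le _) _; rewrite normcMM normc_conj.
  by apply: sum_mul_le; rewrite ?sqrtr_ge0 ?sqr_sqrtr//; exact: dM.
have ba0 : 0 < b - a by rewrite subr_gt0.
rewrite -/Z.
have sZ := sqrtr_ge0 Z.
have HZ : Num.sqrt Z ^+ 2 <= Num.sqrt Z * ((b - a) * M).
  rewrite sqr_sqrtr// -[leLHS]EZ E [leRHS](_ : _ = Num.sqrt Z * M * (b - a)); last by ring.
  by apply: ler_wpM2r => //; exact: ltW.
rewrite -[leLHS](sqr_sqrtr Z0); apply: lerXn2r; rewrite ?nnegrE//.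
  by rewrite mulr_ge0// ltW.
have [->|nz] := eqVneq (Num.sqrt Z) 0; first by rewrite mulr_ge0// ltW.
have sZp : 0 < Num.sqrt Z by rewrite lt_def nz.
by rewrite -(ler_pM2l sZp) -expr2.
Qed.

(** In the second-order remainder the squared phase 9 k^2 j^2 (k-j)^2 over 6 j (k-j) leaves k^2
    times one derivative on each factor, which H^1 can pay. The zero means are essential: [mB] drops
    the frequencies j = 0 and j = k while [mN] keeps them. *)
Lemma cder_mB f g (F G t : R) k : 0 <= F -> 0 <= G -> hb 1 f F -> hb 1 g G ->
  f 0 = 0 -> g 0 = 0 ->
  cder (fun s => cv (mB s) f g k) t (cv (mN t) f g k).
Proof.
move=> F0 G0 fF gG f0 g0.
have sf : sq f by exact: hb_sq fF.
have sg : sq g by exact: hb_sq gG.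
apply: (@cder_quad _ _ _ (3 * jp k ^+ 2 * (F * G))) => s.
have -> : cv (mB s) f g k - cv (mB t) f g k - (s - t)%:C%C * cv (mN t) f g k =
   csum (fun j => (mB s k j - mB t k j - (s - t)%:C%C * mN t k j) * (f j * g (k - j))).
  have s1 := cv_csummable k (symb_mB s) sf sg.
  have s2 := cv_csummable k (symb_mB t) sf sg.
  have s3 := cv_csummable k (symb_mN t) sf sg.
  have s12 : csummable (fun j => mB s k j * f j * g (k - j) - mB t k j * f j * g (k - j)).
    apply: csummableD => //; apply: csummable_le s2 => j; by rewrite normcNN.
  rewrite /cv -csumZ// -csumB// -csumB//; last exact: csummableZ.
  by congr csum; apply/funext => j; ring.
apply: csum_le => S uS.
have hi : injective (fun j : int => k - j) by move=> a b /addrI /oppr_inj.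
have := l1b_mul F0 G0 fF (l2b_inj hi gG).
move=> /(_ S uS) H; rewrite [leRHS]mulrAC.
apply: le_trans (ler_wpM2l (_ : 0 <= 3 * jp k ^+ 2 * (s - t) ^+ 2) H); last first.
  by nneg.
rewrite mulr_sumr; apply: ler_sum => j _ /=.
rewrite ger0_norm ?normc_ge0// ger0_norm; last by nneg.
rewrite !normcMM !expr1.
have rhs0 : 0 <= 3 * jp k ^+ 2 * (s - t) ^+ 2 * (jp j * normc (f j) * (jp (k - j) * normc (g (k - j)))).
  by nneg.
have [->|j0] := eqVneq j 0; first by rewrite f0 normc00 !(mul0r, mulr0).
have [e|l0] := eqVneq (k - j) 0; first by rewrite e g0 normc00 !(mul0r, mulr0).
have jR : j%:~R != 0 :> R by rewrite intr_eq0.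
have lR : (k - j)%:~R != 0 :> R by rewrite intr_eq0.
set P := phase k j : R.
have -> : mB s k j - mB t k j - (s - t)%:C%C * mN t k j =
   (- (6^-1 * j%:~R^-1 * (k - j)%:~R^-1))%:C%C * (cis (- (t * P)) *
     (cis (- ((s - t) * P)) - 1 - Complex 0 (- ((s - t) * P)))).
  rewrite /mB /mN -/P.
  have -> : cis (- (s * P)) = cis (- (t * P)) * cis (- ((s - t) * P)).
    by rewrite -cisD; congr cis; ring.
  have -> : Complex 0 (k%:~R / 2) = - ((- (6^-1 * j%:~R^-1 * (k - j)%:~R^-1))%:C%C * Complex 0 P) :> R[i].
    apply: complex_ext => /=; rewrite ?Re_opp ?Im_opp /=; first by ring.
    by rewrite /P /phase; move: lR; rewrite intrD mulrNz => lR; field; rewrite jR lR.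
  have -> : Complex 0 (- ((s - t) * P)) = - (s - t)%:C%C * Complex 0 P.
    by apply: complex_ext => /=; ring.
  ring.
rewrite !normcMM normc_cis mul1r normc_real.
have H2 := normc_cis2 (- ((s - t) * P)).
rewrite sqrrN exprMn in H2.
have PP : P ^+ 2 = 9 * (k%:~R ^+ 2 * j%:~R ^+ 2 * (k - j)%:~R ^+ 2) by rewrite /P /phase; ring.
rewrite normrN !normrM !normfV (ger0_norm (_ : 0 <= 6)) //.
rewrite !(jpE j0) !(jpE l0).
move: (normc_ge0 (f j)) (normc_ge0 (g (k - j))).
move: (normc (f j)) (normc (g (k - j))) => x y x0 y0 {rhs0}.
move: H2; move: (normc _) => n H2.
have jN : `|j%:~R : R| != 0 by rewrite normr_eq0.
have lN : `|(k - j)%:~R : R| != 0 by rewrite normr_eq0.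
apply: (@le_trans _ _ (6^-1 / `|j%:~R| / `|(k - j)%:~R| * (2 * ((s - t) ^+ 2 * P ^+ 2)) * (x * y))).
  apply: ler_wpM2r; first exact: mulr_ge0.
  by apply: ler_wpM2l => //; nneg.
rewrite PP -[j%:~R ^+ 2](real_normK (num_real _)) -[(k - j)%:~R ^+ 2](real_normK (num_real _)).
rewrite [leLHS](_ : _ = 3 * k%:~R ^+ 2 * ((s - t) ^+ 2 * ((`|j%:~R| * x) * (`|(k - j)%:~R| * y)))); last first.
  by field; rewrite jN lN.
rewrite -[leRHS]mulrA; apply: ler_wpM2r; first by nneg.
apply: ler_wpM2l => //; rewrite -(real_normK (num_real _)).
by apply: lerXn2r; rewrite ?nnegrE ?jp_ge0 ?normr_le_jp.
Qed.

End ComplexDerivative.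

(** * The defect of the exact solution over one step *)

Section LocalError.
Context {R : realType}.
Local Notation jp := (japanese R).
Variables (tau rho : R) (v : R -> int -> R[i]).
Hypothesis tau0 : 0 < tau.
Hypothesis rho0 : 0 < rho.
Hypothesis vcont : forall k, ccont 0 tau (fun s => v s k).
Hypothesis vder : forall s : R, 0 < s < tau -> forall k,
  cder (fun s => v s k) s (cv (mN s) (v s) (v s) k).
Hypothesis vz : forall s : R, 0 <= s <= tau -> v s 0 = 0.

Definition midv k : R[i] := (2^-1)%:C%C * (v 0 k + v tau k).
(** The residual left when the exact twisted solution is inserted in the scheme. *)
Definition defect k : R[i] := v tau k - v 0 k - cv (mB tau) midv midv k.

Let rho0' := ltW rho0.
Let tau0' := ltW tau0.

Lemma zero_in_step : (0 : R) <= 0 <= tau. Proof. by rewrite lexx tau0'. Qed.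
Lemma tau_in_step : 0 <= tau <= tau. Proof. by rewrite lexx tau0'. Qed.

Lemma lipschitz r a b : (forall s : R, 0 <= s <= tau -> hb r.+1 (v s) rho) ->
  0 <= a -> a <= b -> b <= tau ->
  hb r (fun k => v b k - v a k) ((b - a) * (6 * 2 ^+ r * rho * rho)).
Proof.
move=> vr a0 ab bt.
apply: (@vector_mvt _ r v (fun s => cv (mN s) (v s) (v s))) => //.
- by nneg.
- by move=> k; apply: ccont_sub (vcont k).
- by move=> s /andP[s1 s2] k; apply: vder; rewrite (le_lt_trans a0)// (lt_le_trans s2).
move=> s /andP[s1 s2]; have sI : 0 <= s <= tau.
  by rewrite (le_trans a0 (ltW s1)) (le_trans (ltW s2)).
by apply: N_hb => //; exact: vr.
Qed.

Lemma hb_midv r : hb r (v 0) rho -> hb r (v tau) rho -> hb r midv rho.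
Proof.
move=> h0 h1; have := hbZ (2^-1)%:C%C (hbD rho0' rho0' h0 h1).
by rewrite normc_real ger0_norm ?invr_ge0//; congr (hb _ _ _); field.
Qed.

(** v(s) - midv is half of v(s) - v(0) minus half of v(tau) - v(s), and the two time intervals add
    up to tau. *)
Lemma midv_dist r s : (forall s : R, 0 <= s <= tau -> hb r.+1 (v s) rho) -> 0 <= s <= tau ->
  hb r (fun k => v s k - midv k) (tau * (3 * 2 ^+ r * rho * rho)).
Proof.
move=> vr /andP[s0 st].
have h1 := lipschitz vr (lexx 0) s0 st.
have h2 := lipschitz vr s0 st (lexx tau).
set K := 6 * 2 ^+ r * rho * rho in h1 h2.
have K0 : 0 <= K by rewrite /K; nneg.
have k1 : 0 <= (s - 0) * K by rewrite subr0 mulr_ge0.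
have k2 : 0 <= (tau - s) * K by rewrite mulr_ge0// subr_ge0.
have := hbZ (2^-1)%:C%C (hbB k1 k2 h1 h2).
rewrite normc_real ger0_norm ?invr_ge0//.
rewrite (_ : 2^-1 * _ = tau * (3 * 2 ^+ r * rho * rho)); last by rewrite /K; field.
apply: hb_le => k; rewrite (_ : _ - _ = (2^-1)%:C%C * (v s k - v 0 k - (v tau k - v s k)))//.
rewrite /midv; case: (v s k) (v 0 k) (v tau k) => [a b] [c d] [e f].
by apply: complex_ext => /=; field.
Qed.

Section FirstOrder.
Hypothesis v3 : forall s : R, 0 <= s <= tau -> hb 3 (v s) rho.

Let m3 : hb 3 midv rho.
Proof. by apply: hb_midv; apply: v3; [exact: zero_in_step|exact: tau_in_step]. Qed.

Lemma sq_v s : 0 <= s <= tau -> sq (v s).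
Proof. by move=> /v3; exact: hb_sq. Qed.

Lemma sq_midv : sq midv.
Proof. exact: hb_sq m3. Qed.

Lemma midv0 : midv 0 = 0.
Proof. by rewrite /midv !vz ?zero_in_step ?tau_in_step// addr0 mulr0. Qed.

Lemma mB0 : mB 0 = fun k j => 0 :> R[i].
Proof. by apply/funext => k; apply/funext => j; rewrite /mB mul0r oppr0 cis0 subrr mulr0. Qed.

Lemma cv0 f g k : cv (fun k j => 0) f g k = 0 :> R[i].
Proof.
rewrite /cv (csum_box (M := 0)); first by rewrite big1// => j _; rewrite !mul0r.
by move=> j _; rewrite !mul0r.
Qed.

Lemma cvmB_der s k : cder (fun s => cv (mB s) midv midv k) s (cv (mN s) midv midv k).
Proof.
have m1 : hb 1 midv rho by exact: hb_w m3.
by apply: (cder_mB _ _ rho0' rho0' m1 m1); rewrite midv0.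
Qed.

Lemma cvmB_cont k : ccont 0 tau (fun s => cv (mB s) midv midv k).
Proof. by apply: cder_cont => t; exists (cv (mN t) midv midv k); exact: cvmB_der. Qed.

(** The function [y] below runs from 0 to the defect as s goes from 0 to tau. Its derivative is the
    nonlinearity at v minus that at midv, which bilinearity splits into two products with v - midv,
    O(tau) in H^2. Each contributes 144 rho^3 tau. *)
Lemma defect_first : hb 1 defect (12 * 24 * rho ^+ 3 * tau ^+ 2).
Proof.
pose y s k := v s k - v 0 k - cv (mB s) midv midv k.
pose dy s k := cv (mN s) (v s) (v s) k - 0 - cv (mN s) midv midv k.
have yc k : ccont 0 tau (fun s => y s k).
  apply: ccontB; last exact: cvmB_cont.
  by apply: ccontB; [exact: vcont|apply: cder_cont => t; exists 0; exact: cder_cst].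
have yd s : 0 < s < tau -> forall k, cder (fun s => y s k) s (dy s k).
  move=> sI k; apply: cderB; last exact: cvmB_der.
  by apply: cderB; [exact: vder|exact: cder_cst].
have dyb s : 0 < s < tau -> hb 1 (dy s) (12 * 24 * rho ^+ 3 * tau).
  move=> /andP[s1 s2]; have sI : 0 <= s <= tau by rewrite !ltW.
  have v2 s' : 0 <= s' <= tau -> hb 2 (v s') rho by move=> /v3; exact: hb_w.
  have m2 : hb 2 midv rho by exact: hb_w m3.
  have D := midv_dist v3 sI.
  have D0 : 0 <= tau * (3 * 2 ^+ 2 * rho * rho) by nneg.
  have A := N_hb s D0 rho0' D (v2 s sI).
  have B := N_hb s rho0' D0 m2 D.
  have A0 : 0 <= 6 * 2 ^+ 1 * (tau * (3 * 2 ^+ 2 * rho * rho)) * rho by nneg.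
  have B0 : 0 <= 6 * 2 ^+ 1 * rho * (tau * (3 * 2 ^+ 2 * rho * rho)) by nneg.
  have := hbD A0 B0 A B.
  rewrite (_ : _ + _ = 12 * 24 * rho ^+ 3 * tau); last by ring.
  apply: hb_le => k; rewrite (_ : dy s k = cv (mN s) (fun k => v s k - midv k) (v s) k +
    cv (mN s) midv (fun k => v s k - midv k) k)//.
  have svs := sq_v sI; have sm := sq_midv; have smN := symb_mN (R := R) s.
  by rewrite cvBl// cvBr// /dy; ring.
have M0 : 0 <= 12 * 24 * rho ^+ 3 * tau by nneg.
have := vector_mvt tau0' M0 yc yd dyb.
rewrite (_ : (tau - 0) * _ = 12 * 24 * rho ^+ 3 * tau ^+ 2); last by ring.
by apply: hb_le => k; rewrite /y mB0 cv0 subrr !subr0.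
Qed.

End FirstOrder.

Section SecondOrder.
Hypothesis v5 : forall s : R, 0 <= s <= tau -> hb 5 (v s) rho.

Let v4 s : 0 <= s <= tau -> hb 4 (v s) rho. Proof. by move=> /v5; exact: hb_w. Qed.
Let v3 s : 0 <= s <= tau -> hb 3 (v s) rho. Proof. by move=> /v5; exact: hb_w. Qed.
Let m5 : hb 5 midv rho.
Proof. by apply: hb_midv; apply: v5; [exact: zero_in_step|exact: tau_in_step]. Qed.

Let w := cv (mN 0) (v 0) (v 0).
(** The Lipschitz constant in time of v' in H^2: 144 rho^2 from the moving phase, and 24 * 48 rho^3
    from each of the two moving arguments. *)
Let Q := 144 * rho ^+ 2 + 2 * 24 * 48 * rho ^+ 3.
Let Q0 : 0 <= Q. Proof. by rewrite /Q; nneg. Qed.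
Let w4 : hb 4 w (96 * rho ^+ 2).
Proof.
have := N_hb 0 rho0' rho0' (v5 zero_in_step) (v5 zero_in_step).
by rewrite (_ : 6 * 2 ^+ 4 * rho * rho = 96 * rho ^+ 2)//; ring.
Qed.

(** The phase is frozen, then the arguments are moved one at a time. Freezing costs three
    derivatives, from H^5 to H^2; moving an argument uses that v is Lipschitz in H^3. *)
Lemma derivative_lipschitz s : 0 <= s <= tau ->
  hb 2 (fun k => cv (mN s) (v s) (v s) k - w k) (s * Q).
Proof.
move=> /andP[s0 st]; have sI : 0 <= s <= tau by rewrite s0.
have A := D_hb s0 rho0' rho0' (v5 sI) (v5 sI).
have L := lipschitz v4 (lexx 0) s0 st.
have L0 : 0 <= (s - 0) * (6 * 2 ^+ 3 * rho * rho) by rewrite subr0; nneg.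
have B := N_hb 0 L0 rho0' L (v3 sI).
have C := N_hb 0 rho0' L0 (v3 zero_in_step) L.
have A0 : 0 <= 36 * s * 2 ^+ 2 * rho * rho by nneg.
have B0 : 0 <= 6 * 2 ^+ 2 * ((s - 0) * (6 * 2 ^+ 3 * rho * rho)) * rho by nneg.
have C0 : 0 <= 6 * 2 ^+ 2 * rho * ((s - 0) * (6 * 2 ^+ 3 * rho * rho)) by nneg.
have := hbD (addr_ge0 A0 B0) C0 (hbD A0 B0 A B) C.
rewrite (_ : _ + _ = s * Q); last by rewrite /Q; ring.
apply: hb_le => k; rewrite (_ : _ - _ =
  cv (mD s) (v s) (v s) k + cv (mN 0) (fun k => v s k - v 0 k) (v s) k +
  cv (mN 0) (v 0) (fun k => v s k - v 0 k) k)//.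
have s1 := sq_v v3 sI; have s2 := sq_v v3 zero_in_step; have sm := symb_mN (R := R) 0.
by rewrite cvBl// cvBr// mNB// /w; ring.
Qed.

Lemma taylor s : 0 <= s <= tau ->
  hb 2 (fun k => v s k - v 0 k - s%:C%C * w k) (s ^+ 2 * Q).
Proof.
move=> /andP[s0 st].
pose y t k := v t k - t%:C%C * w k.
pose dy t k := cv (mN t) (v t) (v t) k - 1 * w k.
have idc t : cder (fun t : R => t%:C%C) t 1.
  split=> /=; [exact: is_derive_id|exact: is_derive_cst].
have lin t k : cder (fun t : R => t%:C%C * w k) t (1 * w k).
  have := cderM (idc t) (cder_cst t (w k)); by rewrite mulr0 addr0.
have yc k : ccont 0 s (fun t => y t k).
  apply: ccontB; first by apply: ccont_sub (vcont k).
  by apply: cder_cont => t; exists (1 * w k).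
have yd t : 0 < t < s -> forall k, cder (fun s => y s k) t (dy t k).
  move=> /andP[t0 ts] k; apply: cderB => //; apply: vder; rewrite t0/=.
  exact: lt_le_trans st.
have dyb t : 0 < t < s -> hb 2 (dy t) (s * Q).
  move=> /andP[t0 ts]; have tI : 0 <= t <= tau by rewrite ltW//= (le_trans (ltW ts)).
  have tQ : 0 <= t * Q by rewrite mulr_ge0// ltW.
  have le : t * Q <= s * Q by rewrite ler_wpM2r// ltW.
  apply: hb_mono tQ le _; apply: hb_le (derivative_lipschitz tI) => k.
  by rewrite /dy mul1r.
have M0 : 0 <= s * Q by rewrite mulr_ge0.
have := vector_mvt s0 M0 yc yd dyb.
rewrite (_ : (s - 0) * _ = s ^+ 2 * Q); last by ring.
by apply: hb_le => k; rewrite /y mul0r subr0 addrAC.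
Qed.

(** The remainder is the Taylor remainder at s minus half of the one at tau; the other half of the
    mean is v(0), where the expansion is exact. *)
Lemma midv_taylor s : 0 <= s <= tau ->
  hb 2 (fun k => v s k - midv k - (s - tau / 2)%:C%C * w k) (2 * tau ^+ 2 * Q).
Proof.
move=> sI; have A := taylor sI; have B := hbZ (2^-1)%:C%C (taylor tau_in_step).
rewrite normc_real ger0_norm ?invr_ge0// in B.
have [s0 st] := andP sI.
have A0 : 0 <= s ^+ 2 * Q by nneg.
have B0 : 0 <= 2^-1 * (tau ^+ 2 * Q) by nneg.
have AB : 0 <= s ^+ 2 * Q + 2^-1 * (tau ^+ 2 * Q) by exact: addr_ge0.
apply: (hb_mono AB).
  have : s ^+ 2 * Q <= tau ^+ 2 * Q by apply: ler_wpM2r => //; exact: lerXn2r.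
  have : 0 <= tau ^+ 2 * Q by nneg.
  lra.
apply: hb_le (hbB A0 B0 A B) => k.
rewrite (_ : _ - _ = v s k - v 0 k - s%:C%C * w k -
  (2^-1)%:C%C * (v tau k - v 0 k - tau%:C%C * w k))//.
rewrite /midv; case: (v s k) (v 0 k) (v tau k) (w k) => [a b] [c d] [e f] [g h].
by apply: complex_ext => /=; field.
Qed.

(** The three parts bound, in this order, the phase corrections [mD], the Taylor remainder of v -
    midv, and the term quadratic in v - midv. *)
Definition second_order_constant := 2 * (72 * 48 * rho ^+ 3 + 24 * Q * rho) + 12 * 48 * 48 * rho ^+ 4.

(* With w the derivative of v at 0, v(s) - midv is (s - tau/2) w up to O(tau^2), and the
   contribution of (s - tau/2) w integrates to zero over [0, tau]. *)
Lemma defect_second : hb 1 defect (second_order_constant * tau ^+ 3).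
Proof.
set K := second_order_constant.
have K0 : 0 <= K by rewrite /K /second_order_constant; nneg.
pose c k := cv (mN 0) w midv k + cv (mN 0) midv w k.
(* [c] is the linearization at midv, in the direction w, of the nonlinearity with phase frozen at 0.
   The subtracted primitive of (s - tau / 2) c vanishes at both ends of the step, so y still ends at
   the defect. *)
pose y s k := v s k - v 0 k - cv (mB s) midv midv k - (2^-1 * (s * (s - tau)))%:C%C * c k.
pose dy s k := cv (mN s) (v s) (v s) k - 0 - cv (mN s) midv midv k - (s - tau / 2)%:C%C * c k.
have quad s : cder (fun s : R => (2^-1 * (s * (s - tau)))%:C%C) s (s - tau / 2)%:C%C.
  split=> /=; last exact: is_derive_cst.
  apply: (@is_derive_quad _ _ _ _ 2^-1) => t.
  rewrite (_ : _ - _ = 2^-1 * (t - s) ^+ 2); last by field.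
  by rewrite ger0_norm// mulr_ge0 ?sqr_ge0.
have quadc s k : cder (fun s : R => (2^-1 * (s * (s - tau)))%:C%C * c k) s ((s - tau / 2)%:C%C * c k).
  have := cderM (quad s) (cder_cst s (c k)); by rewrite mulr0 addr0.
have yc k : ccont 0 tau (fun s => y s k).
  apply: ccontB; last by apply: cder_cont => t; exists ((t - tau / 2)%:C%C * c k).
  apply: ccontB; last exact: cvmB_cont.
  by apply: ccontB; [exact: vcont|apply: cder_cont => t; exists 0; exact: cder_cst].
have yd s : 0 < s < tau -> forall k, cder (fun s => y s k) s (dy s k).
  move=> sI k; apply: cderB => //; apply: cderB; last exact: cvmB_der.
  by apply: cderB; [exact: vder|exact: cder_cst].
have dyb s : 0 < s < tau -> hb 1 (dy s) (K * tau ^+ 2).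
  move=> /andP[s1 s2]; have sI : 0 <= s <= tau by rewrite !ltW.
  have s0 := ltW s1.
  pose D k := v s k - midv k.
  pose E k := D k - (s - tau / 2)%:C%C * w k.
  have D4 : hb 4 D (tau * (3 * 2 ^+ 4 * rho * rho)) by exact: midv_dist.
  have E2 : hb 2 E (2 * tau ^+ 2 * Q) by exact: midv_taylor.
  have m4 : hb 4 midv rho by exact: hb_w m5.
  have m2 : hb 2 midv rho by exact: hb_w m5.
  have D2 : hb 2 D (tau * (3 * 2 ^+ 4 * rho * rho)) by exact: hb_w D4.
  have d0 : 0 <= tau * (3 * 2 ^+ 4 * rho * rho) by nneg.
  have e0 : 0 <= 2 * tau ^+ 2 * Q by nneg.
  have h1 := D_hb s0 d0 rho0' D4 m4.
  have h2 := D_hb s0 rho0' d0 m4 D4.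
  have h3 := N_hb 0 e0 rho0' E2 m2.
  have h4 := N_hb 0 rho0' e0 m2 E2.
  have h5 := N_hb s d0 d0 D2 D2.
  set b1 := (X in hb _ _ X) in h1; set b2 := (X in hb _ _ X) in h2.
  set b3 := (X in hb _ _ X) in h3; set b4 := (X in hb _ _ X) in h4.
  set b5 := (X in hb _ _ X) in h5.
  have b10 : 0 <= b1 by rewrite /b1; nneg.
  have b20 : 0 <= b2 by rewrite /b2; nneg.
  have b30 : 0 <= b3 by rewrite /b3; nneg.
  have b40 : 0 <= b4 by rewrite /b4; nneg.
  have b50 : 0 <= b5 by rewrite /b5; nneg.
  have h12 := hbD b10 b20 h1 h2; have b12 := addr_ge0 b10 b20.
  have h123 := hbD b12 b30 h12 h3; have b123 := addr_ge0 b12 b30.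
  have h1234 := hbD b123 b40 h123 h4; have b1234 := addr_ge0 b123 b40.
  have H := hbD b1234 b50 h1234 h5; have B := addr_ge0 b1234 b50.
  apply: hb_mono B _ _.
    have -> : b1 + b2 + b3 + b4 + b5 =
      s * (tau * (2 * 72 * 48 * rho ^+ 3)) + tau ^+ 2 * (48 * Q * rho + 12 * 48 * 48 * rho ^+ 4).
      by rewrite /b1 /b2 /b3 /b4 /b5; ring.
    have -> : K * tau ^+ 2 = tau * (tau * (2 * 72 * 48 * rho ^+ 3)) + tau ^+ 2 * (48 * Q * rho + 12 * 48 * 48 * rho ^+ 4).
      by rewrite /K /second_order_constant; ring.
    by rewrite lerD2r; apply: ler_wpM2r; [nneg|exact: ltW].
  apply: hb_le H => k.
  (* With v = midv + D, the terms linear in D have their phase frozen, and there D = (s - tau / 2) w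
     + E, whose first part is removed by [c]. Every remaining term is O(tau^2). *)
  rewrite (_ : dy s k = cv (mD s) D midv k + cv (mD s) midv D k + cv (mN 0) E midv k +
     cv (mN 0) midv E k + cv (mN s) D D k)//.
  have sqv := sq_v v3 sI; have sm := sq_midv v3; have sN := symb_mN (R := R) s.
  have sN0 := symb_mN (R := R) 0.
  have sw : sq w by apply: hb_sq w4; nneg.
  have sD : sq D by exact: sqB.
  have szw : sq (fun k => (s - tau / 2)%:C%C * w k) by exact: sqZ.
  have expand (d m : int -> R[i]) : sq d -> sq m ->
      cv (mN s) (fun k => d k + m k) (fun k => d k + m k) k =
      cv (mN s) m m k + cv (mN s) d m k + cv (mN s) m d k + cv (mN s) d d k.
    by move=> sd sm'; rewrite cvDl//; [rewrite !cvDr//; ring|exact: sqD].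
  have expl (d u m : int -> R[i]) z : sq d -> sq u -> sq m ->
      cv (mN 0) (fun k => d k - z * u k) m k = cv (mN 0) d m k - z * cv (mN 0) u m k.
    by move=> sd su sm'; rewrite cvBl ?cvZl//; exact: sqZ.
  have expr (d u m : int -> R[i]) z : sq d -> sq u -> sq m ->
      cv (mN 0) m (fun k => d k - z * u k) k = cv (mN 0) m d k - z * cv (mN 0) m u k.
    by move=> sd su sm'; rewrite cvBr ?cvZr//; exact: sqZ.
  have vE : v s = fun k => D k + midv k by apply/funext => j; rewrite /D subrK.
  have := expand D midv sD sm; rewrite -vE /dy => ->.
  rewrite (expl D w midv (s - tau / 2)%:C%C sD sw sm) (expr D w midv (s - tau / 2)%:C%C sD sw sm).
  by rewrite (mNB s k sD sm) (mNB s k sm sD) /c; ring.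
have M0 : 0 <= K * tau ^+ 2 by nneg.
have := vector_mvt tau0' M0 yc yd dyb.
rewrite (_ : (tau - 0) * _ = K * tau ^+ 3); last by ring.
have z0 : 0%:C%C = 0 :> R[i] by [].
have yT k : y tau k = defect k by rewrite /y (subrr tau) !mulr0 z0 mul0r subr0.
have y0 k : y 0 k = 0 by rewrite /y mB0 cv0 subrr !(mul0r, mulr0) ?z0 ?mul0r !subr0.
by apply: hb_le => k; rewrite yT y0 subr0.
Qed.

End SecondOrder.
End LocalError.

(** * Fourier series *)

Section TorusIntegral.
Context {R : realType}.
Implicit Types (f g v : R -> R) (c x : R) (k j : int).

Lemma is_derive_sinc c x : is_derive x (1 : R) (fun x => sin (c * x)) (c * cos (c * x)).
Proof.
have h : is_derive x (1 : R) (fun x => c * x) c.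
  have := is_deriveZ c (is_derive_id x (1 : R)); by rewrite /GRing.scale/= mulr1.
have := is_derive1_comp (is_derive_sin (c * x)) h; by rewrite mulrC.
Qed.

Lemma is_derive_cosc c x : is_derive x (1 : R) (fun x => cos (c * x)) (- (c * sin (c * x))).
Proof.
have h : is_derive x (1 : R) (fun x => c * x) c.
  have := is_deriveZ c (is_derive_id x (1 : R)); by rewrite /GRing.scale/= mulr1.
have := is_derive1_comp (is_derive_cos (c * x)) h; by rewrite mulrC mulrN.
Qed.

Lemma derive_continuous f (df : R -> R) : (forall x, is_derive x (1 : R) f (df x)) -> continuous f.
Proof.
by move=> H x; apply: differentiable_continuous; apply/derivable1_diffP; have [] := H x.
Qed.

Lemma cont_sinc c : continuous (fun x => sin (c * x)).
Proof. exact: derive_continuous (is_derive_sinc c). Qed.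

Lemma cont_cosc c : continuous (fun x => cos (c * x)).
Proof. exact: derive_continuous (is_derive_cosc c). Qed.

Lemma contM f g : continuous f -> continuous g -> continuous (fun x => f x * g x).
Proof. by move=> cf cg x; apply: cvgM; [exact: cf|exact: cg]. Qed.

Lemma contD f g : continuous f -> continuous g -> continuous (fun x => f x + g x).
Proof. by move=> cf cg x; apply: cvgD; [exact: cf|exact: cg]. Qed.

Lemma contB f g : continuous f -> continuous g -> continuous (fun x => f x - g x).
Proof. by move=> cf cg x; apply: cvgB; [exact: cf|exact: cg]. Qed.

Lemma cont_cst c : continuous (fun _ : R => c).
Proof. by move=> x; exact: cvg_cst. Qed.

Lemma pi2_gt0 : 0 < 2 * pi :> R.
Proof. by rewrite mulr_gt0// pi_gt0. Qed.

Lemma torus_integrable f : continuous f ->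
  (@lebesgue_measure R).-integrable `[0, 2 * pi] (EFin \o f).
Proof.
move=> cf; apply: continuous_compact_integrable; first exact: segment_compact.
exact: continuous_subspaceT.
Qed.

Lemma torus_intD f g : continuous f -> continuous g ->
  torus_int (fun x => f x + g x) = torus_int f + torus_int g.
Proof. by move=> cf cg; apply: RintegralD => //; exact: torus_integrable. Qed.

Lemma torus_intB f g : continuous f -> continuous g ->
  torus_int (fun x => f x - g x) = torus_int f - torus_int g.
Proof. by move=> cf cg; apply: RintegralB => //; exact: torus_integrable. Qed.

Lemma torus_intZ c f : continuous f -> torus_int (fun x => c * f x) = c * torus_int f.
Proof. by move=> cf; apply: RintegralZl => //; exact: torus_integrable. Qed.

Lemma torus_int_derive f (df : R -> R) : (forall x, is_derive x (1 : R) f (df x)) ->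
  continuous df -> torus_int df = f (2 * pi) - f 0.
Proof.
move=> H cdf; rewrite /torus_int /Rintegral (@continuous_FTC2 _ _ f _ _ pi2_gt0)//.
- exact: continuous_subspaceT.
- have cf := derive_continuous H.
  split; first by move=> x _; have [] := H x.
  + by apply: cvg_at_right_filter; exact: cf.
  + by apply: cvg_at_left_filter; exact: cf.
by move=> x _; rewrite derive1E; apply: derive_val.
Qed.

Lemma torus_int_cst c : torus_int (fun=> c) = 2 * pi * c.
Proof.
have d x : is_derive x (1 : R) (fun x => c * x) c.
  by have := is_deriveZ c (is_derive_id x (1 : R)); rewrite /GRing.scale/= mulr1.
by have := torus_int_derive d (@cont_cst c); rewrite mulr0 subr0 mulrC.
Qed.

Lemma cos_int_pi k : cos (k%:~R * (2 * pi)) = 1 :> R.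
Proof.
wlog: k / exists n : nat, k = n%:Z.
  move=> H; case: (intP k) => [|n|n]; [by rewrite mul0r cos0|by apply: H; exists n.+1|].
  by rewrite mulrNz mulNr cosN; apply: H; exists n.+1.
move=> [n ->]; rewrite -[RHS]cos0.
have := periodicn (@cosD2pi R) n 0; rewrite add0r => <-.
by congr cos; rewrite -[RHS]mulr_natl -[pi *+ 2]mulr_natl.
Qed.

Lemma sin_int_pi k : sin (k%:~R * (2 * pi)) = 0 :> R.
Proof.
by apply: cos1sin0; rewrite cos_int_pi normr1.
Qed.

Lemma torus_int_cos k : torus_int (fun x => cos (k%:~R * x)) = if k == 0 then 2 * pi else 0 :> R.
Proof.
case: eqVneq => [->|k0].
  rewrite (_ : (fun x => _) = fun=> 1) ?torus_int_cst ?mulr1//.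
  by apply/funext => x; rewrite mul0r cos0.
have kR : k%:~R != 0 :> R by rewrite intr_eq0.
have d x : is_derive x (1 : R) (fun x => k%:~R^-1 * sin (k%:~R * x)) (cos (k%:~R * x)).
  by have := is_deriveZ (k%:~R^-1) (is_derive_sinc k%:~R x); rewrite /GRing.scale/= mulKf.
have := torus_int_derive d (@cont_cosc _).
by rewrite sin_int_pi !mulr0 sin0 mulr0 subrr.
Qed.

Lemma torus_int_sin k : torus_int (fun x => sin (k%:~R * x)) = 0 :> R.
Proof.
case: (eqVneq k 0) => [->|k0].
  rewrite (_ : (fun x => _) = fun=> 0) ?torus_int_cst ?mulr0//.
  by apply/funext => x; rewrite mul0r sin0.
have kR : k%:~R != 0 :> R by rewrite intr_eq0.
have d x : is_derive x (1 : R) (fun x => - k%:~R^-1 * cos (k%:~R * x)) (sin (k%:~R * x)).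
  by have := is_deriveZ (- k%:~R^-1) (is_derive_cosc k%:~R x); rewrite /GRing.scale/= mulrNN mulKf.
have := torus_int_derive d (@cont_sinc _).
by rewrite cos_int_pi mulr0 cos0 subrr.
Qed.

Lemma torus_int_le f M : continuous f -> (forall x, `|f x| <= M) -> `|torus_int f| <= 2 * pi * M.
Proof.
move=> cf fM; rewrite -torus_int_cst.
have cn : continuous (fun x => `|f x|) by move=> x; apply: cvg_norm; exact: cf.
apply: le_trans; first by apply: le_normr_Rintegral => //; exact: torus_integrable.
by apply: le_Rintegral => //; apply: torus_integrable => //; exact: cont_cst.
Qed.

Lemma periodic_int f n x : periodic f (2 * pi) -> f (x + n%:~R * (2 * pi)) = f x.
Proof.
move=> pf; wlog: n x / exists m : nat, n = m%:Z.
  move=> H; case: (intP n) => [|m|m]; [by rewrite mul0r addr0|by apply: H; exists m.+1|].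
  have := H m.+1 (x - m.+1%:~R * (2 * pi)); rewrite subrK mulrNz mulNr => ->//.
  by exists m.+1.
move=> [m ->]; rewrite (_ : m%:~R * (2 * pi) = (2 * pi) *+ m); last by rewrite -pmulrn; move: (2 * pi) => p; rewrite mulr_natl.
exact: periodicn.
Qed.

Lemma periodic_representative f x : periodic f (2 * pi) -> exists x1, 0 <= x1 <= 2 * pi /\ f x1 = f x.
Proof.
move=> pf; have p0 := pi2_gt0.
set n := Num.floor (x / (2 * pi)).
exists (x + (- n)%:~R * (2 * pi)); split; last exact: periodic_int.
rewrite mulrNz mulNr subr_ge0 lerBlDr -ler_pdivlMr// floor_le//=.
rewrite -{1}[2 * pi]mul1r -mulrDl -ler_pdivrMr// addrC -[1]/(1%:~R) -intrD.
by rewrite ltW// floorD1_gt.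
Qed.

Lemma periodic_bounded f : continuous f -> periodic f (2 * pi) ->
  exists M, 0 <= M /\ forall x, `|f x| <= M.
Proof.
move=> cf pf.
have cn : {within `[0, 2 * pi], continuous (fun x => `|f x|)}.
  by apply: continuous_subspaceT => x; apply: cvg_norm; exact: cf.
have [c _ cM] := EVT_max (ltW pi2_gt0) cn.
exists `|f c|; split => // x; have [x1 [x1I <-]] := periodic_representative x pf.
by apply: cM; rewrite in_itv.
Qed.

End TorusIntegral.

Section Fourier.
Context {R : realType}.
Implicit Types (f g v : R -> R) (x : R) (k j : int) (c : int -> R[i]).

Lemma fourierD f g k : continuous f -> continuous g ->
  fourier (fun x => f x + g x) k = fourier f k + fourier g k.
Proof.
move=> cf cg; have e (h : R -> R) : continuous h ->
    torus_int (fun x => (f x + g x) * h x) =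
    torus_int (fun x => f x * h x) + torus_int (fun x => g x * h x).
  move=> ch; rewrite -torus_intD; [|exact: contM..].
  by congr torus_int; apply/funext => x; rewrite mulrDl.
apply: complex_ext; rewrite ?Re_add ?Im_add /= e; [ring|exact: cont_cosc|ring|exact: cont_sinc].
Qed.

Lemma fourierZ a f k : continuous f -> fourier (fun x => a * f x) k = a%:C%C * fourier f k.
Proof.
move=> cf; have e (h : R -> R) : continuous h ->
    torus_int (fun x => a * f x * h x) = a * torus_int (fun x => f x * h x).
  move=> ch; rewrite -torus_intZ; last exact: contM.
  by congr torus_int; apply/funext => x; rewrite mulrA.
apply: complex_ext => /=; rewrite e; [ring|exact: cont_cosc|ring|exact: cont_sinc].
Qed.

Lemma fourierB f g k : continuous f -> continuous g ->
  fourier (fun x => f x - g x) k = fourier f k - fourier g k.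
Proof.
move=> cf cg; rewrite (_ : (fun x => f x - g x) = (fun x => f x + (-1) * g x)); last first.
  by apply/funext => x; rewrite mulN1r.
rewrite fourierD//; last by apply: contM => //; exact: cont_cst.
by rewrite fourierZ// (_ : (-1)%:C%C = -1) ?mulN1r//; apply: complex_ext => //=; rewrite oppr0.
Qed.

Lemma fourier_csym v : continuous v -> csym (fourier v).
Proof.
move=> cv k; apply: complex_ext => /=.
  congr (_ * torus_int _); apply/funext => x.
  by rewrite mulrNz mulNr cosN.
rewrite opprK -mulrN; congr (_ * _).
rewrite (_ : (fun x => v x * sin ((- k)%:~R * x)) = (fun x => -1 * (v x * sin (k%:~R * x)))); last first.
  by apply/funext => x; rewrite mulN1r mulrNz mulNr sinN mulrN.
rewrite torus_intZ ?mulN1r ?opprK//; apply: contM => //; exact: cont_sinc.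
Qed.

Lemma fourier_le v M k : continuous v -> (forall x, `|v x| <= M) -> normc (fourier v k) <= 2 * M.
Proof.
move=> cv vM; have M0 : 0 <= M by exact: le_trans (vM 0).
have p0 := @pi2_gt0 R.
have e (h : R -> R) : continuous h -> (forall x, `|h x| <= 1) ->
    `|(2 * pi)^-1 * torus_int (fun x => v x * h x)| <= M.
  move=> ch h1; rewrite normrM gtr0_norm ?invr_gt0// ler_pdivrMl//.
  apply: torus_int_le; first exact: contM.
  by move=> x; rewrite normrM -[leRHS]mulr1; apply: ler_pM.
apply: (le_trans (normc_le _)) => /=; rewrite normrN.
rewrite (_ : 2 * M = M + M); last by ring.
apply: lerD; apply: e.
- exact: cont_cosc.
- by move=> x; exact: cos_max.
- exact: cont_sinc.
- by move=> x; exact: sin_max.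
Qed.

Lemma fourier_one k : fourier (fun=> 1) k = if k == 0 then 1 else 0 :> R[i].
Proof.
have p0 : 2 * pi != 0 :> R by rewrite gt_eqF// pi2_gt0.
rewrite /fourier.
rewrite (_ : (fun x => 1 * cos _) = (fun x => cos (k%:~R * x))); last by apply/funext => x; rewrite mul1r.
rewrite (_ : (fun x => 1 * sin _) = (fun x => sin (k%:~R * x))); last by apply/funext => x; rewrite mul1r.
rewrite torus_int_cos torus_int_sin mulr0 oppr0.
by case: eqP => _; rewrite ?mulVf ?mulr0.
Qed.

(** The real part is half the sum of a monomial of frequency j and its conjugate, and these shift
    the coefficients of g in opposite directions. *)
Lemma fourier_trig (a : R[i]) g j k : continuous g ->
  fourier (fun x => Re (a * cis (j%:~R * x)) * g x) k =
  (2^-1)%:C%C * (a * fourier g (k - j) + conjc a * fourier g (k + j)).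
Proof.
move=> cg; case: a => a b.
pose C i := torus_int (fun x => g x * cos (i%:~R * x)).
pose S i := torus_int (fun x => g x * sin (i%:~R * x)).
have cC i : continuous (fun x => g x * cos (i%:~R * x)) by apply: contM => //; exact: cont_cosc.
have cS i : continuous (fun x => g x * sin (i%:~R * x)) by apply: contM => //; exact: cont_sinc.
have lin4 (a1 a2 a3 a4 : R) (f1 f2 f3 f4 : R -> R) :
    continuous f1 -> continuous f2 -> continuous f3 -> continuous f4 ->
    torus_int (fun x => a1 * f1 x + a2 * f2 x + (a3 * f3 x + a4 * f4 x)) =
    a1 * torus_int f1 + a2 * torus_int f2 + (a3 * torus_int f3 + a4 * torus_int f4).
  move=> c1 c2 c3 c4.
  have z (r : R) (h : R -> R) : continuous h -> continuous (fun x => r * h x).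
    by move=> ch; apply: contM => //; exact: cont_cst.
  rewrite -!torus_intZ//.
  rewrite -(torus_intD (z a1 _ c1) (z a2 _ c2)) -(torus_intD (z a3 _ c3) (z a4 _ c4)).
  by rewrite -torus_intD//; apply: contD; exact: z.
have eB x : (k - j)%:~R * x = k%:~R * x - j%:~R * x by rewrite intrD mulrNz mulrBl.
have eD x : (k + j)%:~R * x = k%:~R * x + j%:~R * x by rewrite intrD mulrDl.
have E1 : torus_int (fun x => Re (Complex a b * cis (j%:~R * x)) * g x * cos (k%:~R * x)) =
    2^-1 * a * C (k - j) + 2^-1 * a * C (k + j) + ((2^-1 * b) * S (k - j) + (- 2^-1 * b) * S (k + j)).
  rewrite -lin4//; congr torus_int; apply/funext => x /=.
  by rewrite eB eD cosB cosD sinB sinD; field.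
have E2 : torus_int (fun x => Re (Complex a b * cis (j%:~R * x)) * g x * sin (k%:~R * x)) =
    2^-1 * a * S (k - j) + 2^-1 * a * S (k + j) + ((- 2^-1 * b) * C (k - j) + (2^-1 * b) * C (k + j)).
  rewrite -lin4//; congr torus_int; apply/funext => x /=.
  by rewrite eB eD cosB cosD sinB sinD; field.
rewrite /fourier E1 E2 -/(C (k - j)) -/(C (k + j)) -/(S (k - j)) -/(S (k + j)).
by apply: complex_ext => /=; ring.
Qed.

Definition synth c x : R := limn (fun N => \sum_(k <- zbox N) Re (c k * cis (k%:~R * x))).

Lemma fmultE m v : fmult m v = synth (fun k => m k * fourier v k).
Proof.
apply/funext => x; rewrite /fmult /synth; congr (limn _); apply/funext => N.
by rewrite zbox.unlock big_map.
Qed.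

Definition l1c c := exists M, l1b (fun k => normc (c k)) M.

Lemma synth_cvg c x : l1c c ->
  (fun N => \sum_(k <- zbox N) Re (c k * cis (k%:~R * x))) @ \oo --> synth c x.
Proof.
move=> [M cM]; apply: (@box_sum_cvg _ _ M); apply: l1b_le cM => k.
by rewrite [leRHS]ger0_norm ?normc_ge0//; apply: le_trans (Re_le _) _; rewrite normcMM normc_cis mulr1.
Qed.

(** Absolute summability bounds the tail by a number independent of x: the partial sums converge
    uniformly. *)
Lemma synth_tail c (e : R) : l1c c -> 0 < e ->
  exists N, forall n, (N <= n)%N -> forall x : R,
    `|synth c x - \sum_(k <- zbox n) Re (c k * cis (k%:~R * x))| <= e.
Proof.
move=> lc e0; have [M cM] := lc.
have [N HN] := l1b_tail cM e0.
exists N => n Nn x; set S := \sum_(k <- zbox n) _.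
have H := @synth_cvg c x lc.
have cv2 : (fun m => `|\sum_(k <- zbox m) Re (c k * cis (k%:~R * x)) - S|) @ \oo --> `|synth c x - S|.
  by apply: cvg_norm; apply: cvgB => //; exact: cvg_cst.
rewrite -(cvg_lim _ cv2)//; apply: limr_le; first by apply/cvg_ex; eexists; exact: cv2.
near=> m; have nm : (n <= m)%N by near: m; exists n.
have -> : \sum_(k <- zbox m) Re (c k * cis (k%:~R * x)) =
   S + \sum_(k <- [seq k <- zbox m | k \notin zbox n]) Re (c k * cis (k%:~R * x)).
  rewrite (bigID (mem (zbox n)))/= big_filter; congr (_ + _).
  rewrite -big_filter; apply: perm_big; apply: uniq_perm; rewrite ?filter_uniq ?uniq_zbox//.
  by move=> k; rewrite mem_filter; case: (boolP (k \in zbox n)) => // /(zboxS nm) ->.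
rewrite addrAC subrr add0r; apply: (le_trans (ler_norm_sum _ _ _)).
apply: le_trans (HN [seq k <- zbox m | k \notin zbox n] _ _).
- apply: ler_sum => k _; rewrite [leRHS]ger0_norm ?normc_ge0//.
  by apply: le_trans (Re_le _) _; rewrite normcMM normc_cis mulr1.
- by rewrite filter_uniq ?uniq_zbox.
by move=> k; rewrite mem_filter mem_zbox -ltnNge => /andP[kn _]; exact: leq_ltn_trans kn.
Unshelve. all: by end_near.
Qed.

Lemma cont_trig (a : R[i]) j : continuous (fun x => Re (a * cis (j%:~R * x))).
Proof.
rewrite (_ : (fun x => _) = (fun x => Re a * cos (j%:~R * x) - Im a * sin (j%:~R * x))); last first.
  by apply/funext => x; rewrite Re_mul.
by apply: contB; apply: contM; do ?[exact: cont_cst|exact: cont_cosc|exact: cont_sinc].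
Qed.

Lemma cont_trig_sum c (s : seq int) : continuous (fun x => \sum_(k <- s) Re (c k * cis (k%:~R * x))).
Proof.
elim: s => [|j s IH].
  rewrite (_ : (fun x => _) = fun=> 0); first exact: cont_cst.
  by apply/funext => x; rewrite big_nil.
rewrite (_ : (fun x => _) = (fun x => Re (c j * cis (j%:~R * x)) +
   \sum_(k <- s) Re (c k * cis (k%:~R * x)))); last by apply/funext => x; rewrite big_cons.
by apply: contD => //; exact: cont_trig.
Qed.

Lemma synth_cont c : l1c c -> continuous (synth c).
Proof.
move=> lc x; apply/cvgrPdist_le => e e0.
have e30 : 0 < e / 3 by rewrite divr_gt0.
have [N HN] := synth_tail lc e30.
have := @cont_trig_sum c (zbox N) x => /cvgrPdist_le/(_ _ e30).
apply: filterS => y /= Hy.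
have h1 := HN N (leqnn N) x; have h2 := HN N (leqnn N) y.
move: h1 h2 Hy; rewrite !ler_norml; set a := synth c x; set b := synth c y.
set a' := \sum_(_ <- _) _; set b' := \sum_(_ <- _) _.
by move=> /andP[? ?] /andP[? ?] /andP[? ?]; apply/andP; split; lra.
Qed.

Lemma synth_periodic c : periodic (synth c) (2 * pi).
Proof.
move=> x; rewrite /synth; congr (limn _); apply/funext => N; apply: eq_bigr => k _.
by rewrite mulrDr cisD {2}/cis cos_int_pi sin_int_pi (_ : Complex 1 0 = 1) ?mulr1.
Qed.

Lemma fourier_trig_sum c g (s : seq int) k : continuous g ->
  fourier (fun x => (\sum_(j <- s) Re (c j * cis (j%:~R * x))) * g x) k =
  \sum_(j <- s) ((2^-1)%:C%C * (c j * fourier g (k - j) + conjc (c j) * fourier g (k + j))).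
Proof.
move=> cg; elim: s => [|j s IH].
  rewrite big_nil (_ : (fun x => _) = (fun x => 0 * 1)); last first.
    by apply/funext => x; rewrite big_nil !mul0r.
  by rewrite (fourierZ 0 k (@cont_cst _ 1)) mul0r.
rewrite big_cons -IH -fourier_trig// -fourierD//.
- by congr fourier; apply/funext => x; rewrite big_cons mulrDl.
- by apply: contM => //; exact: cont_trig.
by apply: contM => //; exact: cont_trig_sum.
Qed.

(** Uniform convergence against the bounded g passes to the coefficients. Hermitian symmetry makes
    the two shifts of [fourier_trig] equal after reflecting the box, which cancels the factor
    1/2. *)
Lemma fourier_synthM c g k : l1c c -> csym c -> continuous g -> periodic g (2 * pi) ->
  ccvg (fun N => \sum_(j <- zbox N) c j * fourier g (k - j)) (fourier (fun x => synth c x * g x) k).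
Proof.
move=> lc sc cg pg; have [M [M0 gM]] := periodic_bounded cg pg.
have E N : \sum_(j <- zbox N) c j * fourier g (k - j) =
    fourier (fun x => (\sum_(j <- zbox N) Re (c j * cis (j%:~R * x))) * g x) k.
  rewrite fourier_trig_sum// -mulr_sumr big_split/=.
  have -> : \sum_(j <- zbox N) conjc (c j) * fourier g (k + j) =
      \sum_(j <- zbox N) c j * fourier g (k - j).
    by rewrite -zbox_opp; apply: eq_bigr => j _; rewrite -sc opprK.
  by move: (\sum_(j <- _) _) => [a b]; apply: complex_ext => /=; field.
apply/cvgr0Pnorm_le => e e0.
have M10 : 0 < 2 * (M + 1) by rewrite mulr_gt0// ltr_wpDl.
have [N HN] := synth_tail lc (divr_gt0 e0 M10).
exists N => // n /= Nn; rewrite ger0_norm ?normc_ge0// E -fourierB; first last.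
- by apply: contM => //; exact: synth_cont.
- by apply: contM => //; exact: cont_trig_sum.
have := @fourier_le (fun x => (\sum_(j <- zbox n) Re (c j * cis (j%:~R * x))) * g x - synth c x * g x)
  (e / (2 * (M + 1)) * M) k.
move=> H; apply: le_trans (H _ _) _.
- apply: contB; apply: contM => //; [exact: cont_trig_sum|exact: synth_cont].
- move=> x; rewrite -mulrBl normrM; apply: ler_pM => //.
  by rewrite distrC; exact: HN.
have e2 : e / (2 * (M + 1)) * (2 * (M + 1)) = e by rewrite divfK// gt_eqF.
rewrite mulrCA -[leRHS]e2; apply: ler_wpM2l; first by rewrite ltW// divr_gt0.
by lra.
Qed.

Lemma fourier_synth c k : l1c c -> csym c -> fourier (synth c) k = c k.
Proof.
move=> lc sc; have H := @fourier_synthM c (fun=> 1) k lc sc (@cont_cst _ 1) (fun _ => erefl).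
rewrite (_ : (fun x => synth c x * 1) = synth c) in H; last by apply/funext => x; rewrite mulr1.
apply: (ccvg_unique H); apply/cvgr0Pnorm_le => e e0.
exists `|k|%N => // n /= kn; rewrite (bigD1_seq k)/= ?uniq_zbox ?mem_zbox//.
rewrite subrr fourier_one eqxx mulr1 big1; last first.
  by move=> j jk; rewrite fourier_one subr_eq0 eq_sym (negbTE jk) mulr0.
by rewrite addr0 subrr normc00 normr0 ltW.
Qed.

End Fourier.

(** * Uniqueness, inversion and the product formula for Fourier coefficients *)

Section Uniqueness.
Context {R : realType}.
Implicit Types (f g v : R -> R) (x : R) (k j : int) (c : int -> R[i]).

Lemma torus_int_ge g eta a b : continuous g -> (forall x, 0 <= g x) ->
  0 <= a -> a <= b -> b <= 2 * pi -> (forall x, a <= x <= b -> eta <= g x) ->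
  eta * (b - a) <= torus_int g.
Proof.
move=> cg g0 a0 ab b2 ge.
have sub : `[a, b] `<=` `[0, 2 * pi] by apply: subset_itv; rewrite bnd_simp.
have ig := torus_integrable cg.
have fin : ((torus_int g)%:E = \int[lebesgue_measure]_(x in `[0%R, (2 * pi)%R]) (g x)%:E)%E.
  by rewrite /torus_int /Rintegral fineK//; exact: integrable_fin_num.
rewrite -lee_fin fin.
apply: (@le_trans _ _ (\int[lebesgue_measure]_(x in `[a, b]) (g x)%:E)%E); last first.
  apply: ge0_subset_integral => //; first by case/integrableP : ig.
  by move=> x _; rewrite lee_fin.
have -> : (eta * (b - a))%:E = (\int[lebesgue_measure]_(x in `[a, b]) (cst eta%:E x))%E.
  rewrite integral_cst//= lebesgue_measure_itv/= lte_fin.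
  case: ltP => // ba.
  by have -> : b = a; [apply/le_anti; rewrite ba ab|rewrite subrr mulr0 mule0].
apply: le_integral => //.
- apply: (@continuous_compact_integrable _ (fun=> eta)); first exact: segment_compact.
  by apply: continuous_subspaceT; exact: cont_cst.
- by apply: integrableS ig.
by move=> x; rewrite inE/= in_itv/= => xab; rewrite lee_fin; exact: ge.
Qed.

(** Multiplication by cos(x - x0) only combines the coefficients at k - 1 and k + 1, so it preserves
    the vanishing of all of them. *)
Lemma fourier0_kernel f (x0 al : R) n k : continuous f -> (forall k, fourier f k = 0) ->
  continuous (fun x => f x * (al + cos (x - x0)) ^+ n) /\
  fourier (fun x => f x * (al + cos (x - x0)) ^+ n) k = 0.
Proof.
move=> cf f0.
have cq : continuous (fun x => Re (cis (- x0) * cis (1%:~R * x))) by exact: cont_trig.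
have qE x : cos (x - x0) = Re (cis (- x0) * cis (1%:~R * x)).
  by rewrite mul1r -cisD addrC.
elim: n k => [|n IH] k.
  rewrite (_ : (fun x => _) = f) ?f0//; apply/funext => x; by rewrite expr0 mulr1.
set g := fun x => f x * (al + cos (x - x0)) ^+ n in IH.
have cg : continuous g by have [] := IH 0.
have g0 k' : fourier g k' = 0 by have [] := IH k'.
rewrite (_ : (fun x => _) = (fun x => al * g x + Re (cis (- x0) * cis (1%:~R * x)) * g x)); last first.
  by apply/funext => x; rewrite -qE /g exprS; ring.
have c1 : continuous (fun x => al * g x) by apply: contM => //; exact: cont_cst.
have c2 : continuous (fun x => Re (cis (- x0) * cis (1%:~R * x)) * g x) by exact: contM.
split; first exact: contD.
by rewrite fourierD// fourierZ// fourier_trig// !g0 !mulr0 addr0 mulr0 addr0.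
Qed.

(** As x0 keeps distance d from both ends of the period, |x - x0| lies in [d, 2 pi - d]; cosine
    decreases on [0, pi] and is symmetric about pi. *)
Lemma cos_far (x x0 d : R) : 0 <= d -> d <= x0 -> x0 <= 2 * pi - d -> 0 <= x <= 2 * pi ->
  d <= `|x - x0| -> cos (x - x0) <= cos d.
Proof.
move=> d0 dx x2 /andP[xa xb] far.
rewrite -cos_norm; set y := `|x - x0| in far *.
have y2 : y <= 2 * pi - d by rewrite /y ler_norml; apply/andP; split; lra.
have main z : d <= z -> z <= pi -> cos z <= cos d.
  move=> dz zp; rewrite le_eqVlt; have [->|nz] := eqVneq z d; first by rewrite eqxx.
  apply/orP; right; rewrite ltr_cos ?in_itv/=; first by rewrite lt_def nz.
    by apply/andP; split; lra.
  by apply/andP; split; lra.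
have [yp|yp] := leP y pi; first exact: main.
have -> : cos y = cos (2 * pi - y).
  by rewrite cosB mulr_natl cos2pi sin2pi mul1r mul0r addr0.
by apply: main; lra.
Qed.

(* If f > 0 near x0, the powers of q(x) = 1 - cos d + cos(x - x0), trigonometric
   polynomials with |q| <= 1 away from x0 and q >= 1 near x0, make the integral of f q^n
   tend to infinity, while it vanishes for all n. *)
Lemma fourier_nonpos f x : continuous f -> periodic f (2 * pi) ->
  (forall k, fourier f k = 0) -> f x <= 0.
Proof.
move=> cf pf f0; rewrite leNgt; apply/negP => fx.
have p0 := pi_gt0 R.
have [M [M0 fM]] := periodic_bounded cf pf.
(* an interior point of the period where f is positive, with a margin *)
have [x0 [d [c [d0 dx x2 c0 fc]]]] : exists x0 d c : R,
   [/\ 0 < d, d <= x0, x0 <= 2 * pi - d, 0 < c & forall y, `|y - x0| <= d -> c <= f y].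
  have [x1 [x10 x12 fx1]] : exists x1, [/\ 0 <= x1, x1 <= 2 * pi & 0 < f x1].
    have [x1 [x1I fE]] := periodic_representative x pf.
    by exists x1; move: x1I => /andP[? ?]; split => //; rewrite fE.
  have c20 : 0 < f x1 / 2 by rewrite divr_gt0.
  have /cvgrPdist_lt/(_ _ c20)/nbhs_ballP[dl /= dl0 Hdl] := cf x1.
  (* A quarter, so that after moving x1 inward by d the d-neighborhood of the new point stays within
     2 d of x1 and inside the period. *)
  pose d := Num.min dl pi / 4.
  have d0 : 0 < d by rewrite divr_gt0// lt_min dl0.
  have d4 : 4 * d = Num.min dl pi by rewrite /d; field.
  have d1 : 4 * d <= dl by rewrite d4 ge_min lexx.
  have d2 : 4 * d <= pi by rewrite d4 ge_min lexx orbT.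
  have near_x1 y : `|y - x1| <= 2 * d -> f x1 / 2 <= f y.
    move=> yx; have : `|x1 - y| < dl by rewrite distrC; apply: le_lt_trans yx _; lra.
    by move=> /Hdl /= /ltr_normlW; lra.
  have [xp|xp] := leP x1 pi.
    exists (x1 + d), d, (f x1 / 2); split => //; [lra|lra|].
    by move=> y; rewrite ler_norml => /andP[? ?]; apply: near_x1; rewrite ler_norml; apply/andP; split; lra.
  exists (x1 - d), d, (f x1 / 2); split => //; [lra|lra|].
  by move=> y; rewrite ler_norml => /andP[? ?]; apply: near_x1; rewrite ler_norml; apply/andP; split; lra.
have dpi : d <= pi by lra.
pose al := 1 - cos d.
pose z y : R := cos (y - x0) - cos d.
(* The positive part of [z]. By Bernoulli's inequality, c n h - M is a lower bound for f (1 + z)^n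
   over the whole period. *)
pose h y : R := 2^-1 * (z y + `|z y|).
have cz : continuous z.
  apply: contB; last exact: cont_cst.
  rewrite (_ : (fun y => cos (y - x0)) = (fun y => Re (cis (- x0) * cis (1%:~R * y)))); first exact: cont_trig.
  by apply/funext => y; rewrite mul1r -cisD addrC.
have ch : continuous h.
  apply: contM; first exact: cont_cst.
  by apply: contD => // y; apply: cvg_norm; exact: cz.
have h0 y : 0 <= h y.
  by rewrite mulr_ge0// ?invr_ge0//; have := ler_norm (- z y); rewrite normrN; lra.
have hz y : z y <= h y by rewrite /h; have := ler_norm (z y); lra.
pose eta := cos (d / 2) - cos d.
have eta0 : 0 < eta.
  by rewrite subr_gt0 ltr_cos ?in_itv/=; [lra|apply/andP; split; lra|apply/andP; split; lra].
have hint : eta * (d / 2) <= torus_int h.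
  rewrite -[d / 2](addrK x0) [d / 2 + x0]addrC.
  apply: torus_int_ge => //; [lra|lra|lra|].
  move=> y /andP[y1 y2]; apply: le_trans (hz y).
  rewrite lerD2r; have [->|ne] := eqVneq (y - x0) (d / 2); first exact: lexx.
  rewrite ltW// ltr_cos ?in_itv/=; [|apply/andP; split; lra..].
  by rewrite lt_def eq_sym ne/=; lra.
(* The left side grows linearly in n, so this contradicts the Archimedean property. *)
have key n : c * n%:R * (eta * (d / 2)) <= 2 * pi * M.
  have [cg g0] := @fourier0_kernel f x0 al n 0 cf f0.
  set g := fun x => _ in cg g0.
  have gint : torus_int g = 0.
    have := congr1 (@complex.Re R) g0 => /= /eqP; rewrite mulf_eq0 invr_eq0 gt_eqF ?pi2_gt0//=.
    move=> /eqP <-; congr torus_int; apply/funext => y; by rewrite mul0r cos0 mulr1.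
  have low y : 0 <= y <= 2 * pi -> c * n%:R * h y - M <= g y.
    move=> yI; have qE : al + cos (y - x0) = 1 + z y by rewrite /al /z; ring.
    rewrite /g qE; have [near|/ltW far] := leP `|y - x0| d.
      have z0 : 0 <= z y.
        rewrite subr_ge0 -(cos_norm (y - x0)).
        have [->//|ne] := eqVneq `|y - x0| d.
        rewrite ltW// ltr_cos ?in_itv/=; first by rewrite lt_def eq_sym ne near.
          by rewrite normr_ge0 (le_trans near).
        by rewrite dpi ltW.
      have -> : h y = z y by rewrite /h ger0_norm//; field.
      have fy := fc y near.
      have bern : 1 + n%:R * z y <= (1 + z y) ^+ n.
        elim: n {cg g0 g gint} => [|n IHn]; first by rewrite mul0r addr0.
        rewrite exprS; apply: le_trans (ler_wpM2l (_ : 0 <= 1 + z y) IHn); last by rewrite addr_ge0.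
        rewrite -natr1; have : 0 <= n%:R * z y ^+ 2 by rewrite mulr_ge0 ?sqr_ge0.
        by lra.
      have nz : 0 <= n%:R * z y by rewrite mulr_ge0.
      apply: (@le_trans _ _ (c * (1 + n%:R * z y))).
        rewrite (_ : c * (1 + n%:R * z y) = c + c * n%:R * z y); last by ring.
        by move: (c * n%:R * z y) => w; lra.
      by apply: ler_pM => //; [exact: ltW|rewrite addr_ge0].
    have z0 : z y <= 0 by rewrite subr_le0; apply: (cos_far (ltW d0)).
    have -> : h y = 0 by rewrite /h ler0_norm// subrr mulr0.
    rewrite mulr0 sub0r; apply: lerNnormlW; rewrite normrM -[leRHS]mulr1.
    apply: ler_pM => //; rewrite normrX; apply: exprn_ile1 => //.
    rewrite ler_norml; apply/andP; split; last by lra.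
    by rewrite /z; have := cos_geN1 (y - x0); have := cos_le1 d; lra.
  have cc : continuous (fun y => c * n%:R * h y) by apply: contM => //; exact: cont_cst.
  have : torus_int (fun y => c * n%:R * h y - M) <= torus_int g.
    have cl : continuous (fun y => c * n%:R * h y - M) by apply: contB => //; exact: cont_cst.
    apply: (le_Rintegral _ (torus_integrable cl) (torus_integrable cg)) => //.
  rewrite gint torus_intB//; last exact: cont_cst.
  rewrite torus_intZ// torus_int_cst subr_le0; apply: le_trans.
  by apply: ler_wpM2l => //; rewrite mulr_ge0// ltW.
pose K := c * (eta * (d / 2)).
have K0 : 0 < K by rewrite !mulr_gt0// invr_gt0.
have nn : 0 <= 2 * pi * M / K.
  by apply: divr_ge0; [rewrite mulr_ge0// ltW// pi2_gt0|exact: ltW].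
have := archi_boundP nn; rewrite ltr_pdivrMr//; move: (Num.bound _) => n.
by rewrite (_ : n%:R * K = c * n%:R * (eta * (d / 2))) ?ltNge ?key// /K; ring.
Qed.

Lemma fourier_inj f : continuous f -> periodic f (2 * pi) ->
  (forall k, fourier f k = 0) -> f = cst 0.
Proof.
move=> cf pf f0; apply/funext => x; apply/le_anti; rewrite fourier_nonpos//=.
have cn : continuous (fun x => -1 * f x) by apply: contM => //; exact: cont_cst.
have := @fourier_nonpos (fun x => -1 * f x) x cn.
rewrite mulN1r oppr_le0; apply.
  by move=> y; rewrite pf.
by move=> k; rewrite fourierZ// f0 mulr0.
Qed.

Lemma fourier_inversion v : continuous v -> periodic v (2 * pi) -> l1c (fourier v) ->
  v = synth (fourier v).
Proof.
move=> cv pv lv; have cs := synth_cont lv.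
have : (fun x => v x - synth (fourier v) x) = cst 0.
  apply: fourier_inj; first exact: contB.
    by move=> x; rewrite pv synth_periodic.
  by move=> k; rewrite fourierB// fourier_synth ?subrr//; exact: fourier_csym.
by move=> e; apply/funext => x; apply/eqP; rewrite -subr_eq0 -[X in X == 0]/((fun x => v x - synth (fourier v) x) x) e.
Qed.

Lemma fourierM_synth c1 c2 k : l1c c1 -> csym c1 -> l1c c2 -> csym c2 ->
  fourier (fun x => synth c1 x * synth c2 x) k = csum (fun j => c1 j * c2 (k - j)).
Proof.
move=> l1 s1 l2 s2.
have H := @fourier_synthM _ c1 (synth c2) k l1 s1 (synth_cont l2) (@synth_periodic _ c2).
apply/esym/csumE; last by move: H; under eq_fun do under eq_bigr do rewrite fourier_synth//.
have [M1 cM1] := l1; have [M2 cM2] := l2.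
have M20 : 0 <= M2 by have := cM2 [::] isT; rewrite big_nil.
exists (M1 * M2) => s us.
apply: (@le_trans _ _ (\sum_(j <- s) `|normc (c1 j)| * M2)); last first.
  by rewrite -mulr_suml; apply: ler_wpM2r => //; exact: cM1.
apply: ler_sum => j _; rewrite normcMM normrM; apply: ler_wpM2l => //.
by have := cM2 [:: k - j] isT; rewrite big_seq1.
Qed.

(** The bridge between the extended-real norm of the statement and the finite-sum bounds of the
    proof. *)
Lemma HnormP r v M : 0 <= M -> (Hnorm r v <= M%:E)%E <-> hb r (fourier v) M.
Proof.
move=> M0; have E : (M%:E = sqrte (M ^+ 2)%:E)%E by rewrite /= sqrtr_sqr ger0_norm.
have t k : (japanese R k ^+ (2 * r) * normc (fourier v k) ^+ 2)%:E =
    ((japanese R k ^+ r * normc (fourier v k)) ^+ 2)%:E.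
  by rewrite exprMn -exprM mulnC.
rewrite /Hnorm E lee_sqrt ?lee_fin ?sqr_ge0//; split=> [H s us|H].
  rewrite -lee_fin; apply: le_trans H; apply: esum_ge.
  exists [set` s]; first by split => //; exact: finite_seq.
  by rewrite -fsbig_seq// -sumEFin; under [leRHS]eq_bigr do rewrite t.
apply: ub_ereal_sup => _ [A [fA _] <-].
rewrite fsbig_finite//=; under eq_bigr do rewrite t.
by rewrite sumEFin lee_fin; apply: H; exact: finmap.fset_uniq.
Qed.

End Uniqueness.

(** * The fixed-point iteration *)

Section MidpointMap.
Context {R : realType}.
Local Notation jp := (japanese R).
Implicit Types (f g v w : R -> R) (x : R) (k j : int) (c : int -> R[i]).

(** H^1 without the zero-mean condition, which the squares inside [midpoint_map] do not satisfy. *)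
Definition good v := [/\ continuous v, periodic v (2 * pi) & exists M, 0 <= M /\ hb 1 (fourier v) M].

Lemma hb_l1c c M : 0 <= M -> hb 1 c M -> l1c c.
Proof.
move=> M0 cM; exists (3 * M); apply: l1b_le (hb_l1 M0 cM) => k.
by rewrite expr0 mul1r.
Qed.

Lemma good_l1c v : good v -> l1c (fourier v).
Proof. by move=> [_ _ [M [M0 vM]]]; exact: hb_l1c vM. Qed.

Lemma good_csym v : good v -> csym (fourier v).
Proof. by move=> [cv _ _]; exact: fourier_csym. Qed.

Lemma fourierK c : l1c c -> csym c -> fourier (synth c) = c.
Proof. by move=> l s; apply/funext => k; exact: fourier_synth. Qed.

Lemma good_synth c M : 0 <= M -> hb 1 c M -> csym c -> good (synth c).
Proof.
move=> M0 cM sc; have lc := hb_l1c M0 cM; split.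
- exact: synth_cont.
- exact: synth_periodic.
by exists M; rewrite fourierK.
Qed.

Lemma good_fourierD f g : good f -> good g ->
  fourier (fun x => f x + g x) = fun k => fourier f k + fourier g k.
Proof. by move=> [cf _ _] [cg _ _]; apply/funext => k; exact: fourierD. Qed.

Lemma goodD f g : good f -> good g -> good (fun x => f x + g x).
Proof.
move=> gf gg; have E := good_fourierD gf gg.
case: gf gg E => [cf pf [F [F0 fF]]] [cg pg [G [G0 gG]]] E; split.
- exact: contD.
- by move=> x; rewrite pf pg.
by exists (F + G); rewrite E; split; [exact: addr_ge0|exact: hbD].
Qed.

Lemma goodZ a f : good f -> good (fun x => a * f x).
Proof.
move=> [cf pf [F [F0 fF]]]; split.
- by apply: contM => //; exact: cont_cst.
- by move=> x; rewrite pf.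
exists (normc a%:C%C * F); split; first by rewrite mulr_ge0 ?normc_ge0.
by apply: hb_le (hbZ a%:C%C fF) => k; rewrite fourierZ.
Qed.

Lemma fourier_sqr f : good f -> fourier (fun x => f x ^+ 2) = cv (fun _ _ => 1) (fourier f) (fourier f).
Proof.
move=> gf; have lf := good_l1c gf; have sf := good_csym gf; apply/funext => k.
have [cf pf _] := gf.
rewrite /cv (_ : (fun j => _) = (fun j => fourier f j * fourier f (k - j))); last first.
  by apply/funext => j; rewrite mul1r.
rewrite -fourierM_synth//; congr (fourier _ k); apply/funext => x.
by rewrite -fourier_inversion// expr2.
Qed.

Lemma symb_one : symb (fun _ _ => 1 : R[i]).
Proof. by move=> k; exists 1 => j; rewrite (_ : normc 1 = 1)//; exact: ComplexField.Normc.normc1. Qed.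

(** H^1 is an algebra: the symbol 1 with <k> <= <j> + <k-j> fits the product estimate. *)
Lemma good_sqr f : good f -> good (fun x => f x ^+ 2).
Proof.
move=> gf; have E := fourier_sqr gf; case: gf E => [cf pf [F [F0 fF]]] E; split.
- by under eq_fun do rewrite expr2; exact: contM.
- by move=> x; rewrite pf.
exists (6 * 1 * F * F); split; first by rewrite !mulr_ge0.
rewrite E; apply: (@cv_hb _ _ _ _ F F 1 1 1 0) => //; first exact: symb_one.
move=> k j; rewrite !expr0 !expr1 (_ : normc 1 = 1); last exact: ComplexField.Normc.normc1.
by rewrite !mul1r !mulr1 addrC; exact: jp_split.
Qed.

Lemma hb_mult r (m : int -> R[i]) c M : (forall k, normc (m k) <= 1) -> hb r c M ->
  hb r (fun k => m k * c k) M.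
Proof.
move=> m1; apply: hb_le => k; rewrite normcMM -[leRHS]mul1r; apply: ler_wpM2r => //.
exact: normc_ge0.
Qed.

Lemma csymM (m c : int -> R[i]) : csym m -> csym c -> csym (fun k => m k * c k).
Proof. by move=> sm sc k; rewrite sm sc conjc_mul. Qed.

Lemma fmult_good (m : int -> R[i]) v : (forall k, normc (m k) <= 1) -> csym m -> good v ->
  good (fmult m v) /\ fourier (fmult m v) = fun k => m k * fourier v k.
Proof.
move=> m1 sm gv; have sv := good_csym gv; have [_ _ [M [M0 vM]]] := gv.
have h := hb_mult m1 vM; have s := csymM sm sv.
by rewrite fmultE; split; [exact: good_synth h s|apply: fourierK => //; exact: hb_l1c h].
Qed.

(** 1 / (ik) = -i / k, with k = 0 covered by 0^-1 = 0. *)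
Definition dmul k : R[i] := Complex 0 (- k%:~R^-1).
Definition twist (s : R) k : R[i] := cis (- (s * k%:~R ^+ 3)).

Lemma dmulE k : (if k == 0 then 0 else (Complex 0 1 * k%:~R)^-1) = dmul k.
Proof.
case: eqVneq => [->|k0]; first by rewrite /dmul invr0 oppr0.
have kR : k%:~R != 0 :> R by rewrite intr_eq0.
have kC : (k%:~R : R[i]) = (k%:~R)%:C%C by rewrite rmorph_int.
apply: (@mulrI _ (Complex 0 1 * k%:~R)).
  rewrite unitfE kC; apply/eqP => /(congr1 (@complex.Im R)) /= /eqP.
  by rewrite mul0r mul1r add0r (negbTE kR).
rewrite divrr; last first.
  rewrite unitfE kC; apply/eqP => /(congr1 (@complex.Im R)) /= /eqP.
  by rewrite mul0r mul1r add0r (negbTE kR).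
by rewrite kC; apply: complex_ext => /=; field.
Qed.

Lemma dmul_le k : normc (dmul k) <= 1.
Proof. by rewrite /dmul normc_i normrN; exact: norm_intV_le1. Qed.

Lemma dmul_csym : csym dmul.
Proof. by move=> k; rewrite /dmul mulrNz invrN. Qed.

Lemma twist_le s k : normc (twist s k) <= 1.
Proof. by rewrite normc_cis. Qed.

Lemma twist_csym s : csym (twist s).
Proof. by move=> k; rewrite /twist -cisN; congr cis; rewrite mulrNz; ring. Qed.

Lemma twistK s k z : twist s k * (twist (- s) k * z) = z.
Proof. by rewrite /twist (_ : - (- s * _) = - - (s * k%:~R ^+ 3)) ?cisK//; ring. Qed.

Lemma twistNK s k z : twist (- s) k * (twist s k * z) = z.
Proof. by rewrite -{2}(opprK s) twistK. Qed.

Lemma dx_inv_good v : good v ->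
  good (dx_inv v) /\ fourier (dx_inv v) = fun k => dmul k * fourier v k.
Proof.
move=> gv; rewrite /dx_inv (_ : (fun k => _) = dmul); last by apply/funext => k; exact: dmulE.
by apply: fmult_good => //; [exact: dmul_le|exact: dmul_csym].
Qed.

Lemma exp_dx3_good s v : good v ->
  good (exp_dx3 s v) /\ fourier (exp_dx3 s v) = fun k => twist s k * fourier v k.
Proof. by move=> gv; apply: fmult_good => //; [exact: twist_le|exact: twist_csym]. Qed.

(** Twisting a product while untwisting its two factors leaves exactly the resonance. *)
Lemma twist_phase (tau : R) k j :
  twist tau k * (twist (- tau) j * twist (- tau) (k - j)) = cis (- (tau * phase k j)).
Proof.
by rewrite /twist -!cisD; congr cis; rewrite /phase intrD mulrNz; ring.
Qed.

(** The two inverse derivatives multiply to -1 / (j (k - j)), and 24 = 6 * 2 * 2 with the two 2s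
    absorbed in the means; this is where the formula of the scheme becomes the form [mB]. *)
Lemma midpoint_map_good tau v w : good v -> good w ->
  good (midpoint_map tau v w) /\
  forall k, twist tau k * fourier (midpoint_map tau v w) k = fourier v k +
    cv (mB tau) (fun k => (2^-1)%:C%C * (fourier v k + twist tau k * fourier w k))
                (fun k => (2^-1)%:C%C * (fourier v k + twist tau k * fourier w k)) k.
Proof.
move=> gv gw.
have [gdw Edw] := dx_inv_good gw; have [gdv Edv] := dx_inv_good gv.
have [gev Eev] := exp_dx3_good (- tau) gv.
have [gedv Eedv] := exp_dx3_good (- tau) gdv.
have [gedw Eedw] := exp_dx3_good tau gdw.
pose a x := dx_inv w x + exp_dx3 (- tau) (dx_inv v) x.
pose b x := exp_dx3 tau (dx_inv w) x + dx_inv v x.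
have ga : good a by exact: goodD.
have gb : good b by exact: goodD.
have ga2 := good_sqr ga; have gb2 := good_sqr gb.
have [geb Eeb] := exp_dx3_good (- tau) gb2.
have mE : midpoint_map tau v w = (fun x => exp_dx3 (- tau) v x + 24^-1 * a x ^+ 2 +
    (- 24^-1) * exp_dx3 (- tau) (fun y => b y ^+ 2) x).
  by apply/funext => x; rewrite mulNr.
have g1 := goodD gev (goodZ 24^-1 ga2); have g2 := goodZ (- 24^-1) geb.
have gm := goodD g1 g2.
split; first by rewrite mE.
move=> k; rewrite mE (good_fourierD g1 g2) (good_fourierD gev (goodZ 24^-1 ga2)).
have [ca2 _ _] := ga2; have [ceb _ _] := geb.
rewrite !fourierZ// Eeb (fourier_sqr ga) (fourier_sqr gb) Eev.
(* Twice the mean in the twisted variable. [b] has coefficients [dmul] U and [a] the same ones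
   twisted by - tau, so that a^2 yields the phase factor of [mB] and b^2 its term 1. *)
pose U k := fourier v k + twist tau k * fourier w k.
have Eb : fourier b = fun k => dmul k * U k.
  by rewrite (good_fourierD gedw gdv) Eedw Edw Edv; apply/funext => j; rewrite /U; ring.
have Ea : fourier a = fun k => twist (- tau) k * (dmul k * U k).
  rewrite (good_fourierD gdw gedv) Eedv Edw Edv; apply/funext => j.
  by rewrite /U !mulrDr [dmul j * (_ * _)]mulrCA twistNK addrC.
have sU : sq U.
  have [_ _ [V [V0 vV]]] := gv; have [_ _ [W [W0 wW]]] := gw.
  by apply: sqD; [exact: hb_sq vV|apply: (hb_sq W0); exact: hb_mult (twist_le tau) wW].
have sb : sq (fun k => dmul k * U k).
  have [_ _ [B [B0 bB]]] := gb; rewrite -Eb; exact: hb_sq bB.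
have sa : sq (fun k => twist (- tau) k * (dmul k * U k)).
  have [_ _ [A [A0 aA]]] := ga; rewrite -Ea; exact: hb_sq aA.
rewrite Ea Eb [X in _ = _ + X]cvZl; last 3 first.
- exact: symb_mB.
- exact: sU.
- exact: sqZ.
rewrite [cv (mB tau) _ _ k]cvZr//; last exact: symb_mB.
have s1 := cv_csummable k symb_one sa sa.
have s2 := cv_csummable k symb_one sb sb.
have s3 := cv_csummable k (symb_mB tau) sU sU.
rewrite !mulrDr twistK -addrA; congr (_ + _).
rewrite mulrCA [twist tau k * (_ * _)]mulrCA twistK.
rewrite /cv -(csumZ (twist tau k))// -(csumZ (24^-1)%:C%C); last exact: csummableZ.
rewrite -(csumZ (- 24^-1)%:C%C)// -csumD; [|by do ?apply: csummableZ..].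
rewrite -(csumZ (2^-1)%:C%C s3) -(csumZ (2^-1)%:C%C); last exact: csummableZ.
congr csum; apply/funext => j.
rewrite /mB -twist_phase; set P := twist tau k; set Q := twist _ j; set S := twist _ (k - j).
have -> : dmul j = (j%:~R^-1)%:C%C * Complex 0 (-1) by apply: complex_ext => /=; ring.
have -> : dmul (k - j) = ((k - j)%:~R^-1)%:C%C * Complex 0 (-1) by apply: complex_ext => /=; ring.
have ii : Complex 0 (-1) * Complex 0 (-1) = -1 :> R[i] by apply: complex_ext => /=; ring.
have -> : (- (6^-1 / j%:~R / (k - j)%:~R))%:C%C =
   - (6^-1)%:C%C * (j%:~R^-1)%:C%C * ((k - j)%:~R^-1)%:C%C :> R[i].
  by apply: complex_ext => /=; ring.
have -> : (- 24^-1)%:C%C = - (24^-1)%:C%C :> R[i] by apply: complex_ext => /=; ring.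
have -> : (24^-1)%:C%C = (2^-1)%:C%C * (2^-1)%:C%C * (6^-1)%:C%C :> R[i].
  by apply: complex_ext => /=; field.
move: ((j%:~R^-1)%:C%C) (((k - j)%:~R^-1)%:C%C) (Complex 0 (-1)) ii => x y i ii.
transitivity ((2^-1)%:C%C * (2^-1)%:C%C * (6^-1)%:C%C * x * y * (P * (Q * S) - 1) * U j * U (k - j) * (i * i)).
  ring.
rewrite ii; ring.
Qed.

Lemma torus_fun_fourier0 f : torus_fun f -> fourier f 0 = 0.
Proof.
move=> [cf pf f0]; apply: complex_ext => /=.
  rewrite (_ : (fun x => _) = f) ?f0 ?mulr0//.
  by apply/funext => x; rewrite mul0r cos0 mulr1.
rewrite (_ : (fun x => _) = fun=> 0) ?torus_int_cst ?mulr0 ?oppr0//.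
by apply/funext => x; rewrite mul0r sin0 mulr0.
Qed.

Lemma fourier0_torus_fun f : continuous f -> periodic f (2 * pi) -> fourier f 0 = 0 -> torus_fun f.
Proof.
move=> cf pf f0; split => //.
have := congr1 (@complex.Re R) f0 => /= /eqP; rewrite mulf_eq0 invr_eq0 gt_eqF ?pi2_gt0//=.
move=> /eqP e; rewrite -[RHS]e; congr torus_int.
by apply/funext => x; rewrite mul0r cos0 mulr1.
Qed.

End MidpointMap.

(** * Contraction and limit of the iteration in the twisted variable *)

Section FixedPoint.
Context {R : realType}.
Local Notation jp := (japanese R).
Variables (tau M : R) (v : R -> R).
Hypothesis tau0 : 0 < tau.
Hypothesis M0 : 0 < M.
Hypothesis small : 18 * Num.sqrt tau * M <= 1.
Hypothesis tv : torus_fun v.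
Hypothesis vM : hb 1 (fourier v) M.

Let M0' := ltW M0.
Let tau0' := ltW tau0.
Let sq0 := sqrtr_ge0 tau.

Definition twisted_mean (X : int -> R[i]) k := (2^-1)%:C%C * (fourier v k + X k).
Definition twisted_map (X : int -> R[i]) k := fourier v k + cv (mB tau) (twisted_mean X) (twisted_mean X) k.

Lemma good_v : good v.
Proof. by case: tv => cv pv _; split => //; exists M. Qed.

Definition iterate n := iter n (midpoint_map tau v) v.
Definition coef n k := twist tau k * fourier (iterate n) k.

Lemma iterate_good n : good (iterate n).
Proof.
elim: n => [|n IH]; first exact: good_v.
by have [] := midpoint_map_good tau good_v IH.
Qed.

Lemma coefS n k : coef n.+1 k = twisted_map (coef n) k.
Proof. by have [_ H] := midpoint_map_good tau good_v (iterate_good n); exact: H. Qed.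

Lemma hb_mean X B : 0 <= B -> hb 1 X B -> hb 1 (twisted_mean X) (2^-1 * (M + B)).
Proof.
move=> B0 XB; have := hbZ (2^-1)%:C%C (hbD M0' B0 vM XB).
by rewrite normc_real ger0_norm ?invr_ge0.
Qed.

Lemma hb_mean2 X : hb 1 X (2 * M) -> hb 1 (twisted_mean X) (3 / 2 * M).
Proof.
move=> h; have := hb_mean (mulr_ge0 (ler0n _ 2) M0') h.
by rewrite (_ : 2^-1 * _ = 3 / 2 * M)//; field.
Qed.

Lemma twisted_map_ball X : hb 1 X (2 * M) -> hb 1 (twisted_map X) (2 * M).
Proof.
move=> h; have m := hb_mean2 h.
have m0 : 0 <= 3 / 2 * M by rewrite !mulr_ge0.
have H := B_hb tau0' m0 m0 m m.
have b0 : 0 <= 6 * Num.sqrt tau * (3 / 2 * M) * (3 / 2 * M) by rewrite mulr_ge0// mulr_ge0// mulr_ge0.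
apply: (hb_mono (addr_ge0 M0' b0)) (hbD M0' b0 vM H).
have := ler_wpM2r M0' small; rewrite mul1r => s.
have -> : M + 6 * Num.sqrt tau * (3 / 2 * M) * (3 / 2 * M) = M + 3 / 4 * (18 * Num.sqrt tau * M * M) by field.
lra.
Qed.

(** The means are at most 3/2 M and their difference is at most d / 2, so the two products give 9
    sqrt tau M d. The 18 in the smallness hypothesis is chosen to make the rate 1/2. *)
Lemma twisted_map_contract X Y d : 0 <= d -> hb 1 X (2 * M) -> hb 1 Y (2 * M) ->
  hb 1 (fun k => X k - Y k) d -> hb 1 (fun k => twisted_map X k - twisted_map Y k) (2^-1 * d).
Proof.
move=> d0 hX hY hd; have mX := hb_mean2 hX; have mY := hb_mean2 hY.
have m0 : 0 <= 3 / 2 * M by rewrite !mulr_ge0.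
have sX : sq (twisted_mean X) by exact: hb_sq mX.
have sY : sq (twisted_mean Y) by exact: hb_sq mY.
have hm : hb 1 (fun k => twisted_mean X k - twisted_mean Y k) (2^-1 * d).
  have := hbZ (2^-1)%:C%C hd; rewrite normc_real ger0_norm ?invr_ge0//.
  by apply: hb_le => k; rewrite /twisted_mean -mulrBr opprD addrACA subrr add0r.
have d20 : 0 <= 2^-1 * d by rewrite mulr_ge0.
have A := B_hb tau0' d20 m0 hm mX; have B := B_hb tau0' m0 d20 mY hm.
have A0 : 0 <= 6 * Num.sqrt tau * (2^-1 * d) * (3 / 2 * M) by rewrite mulr_ge0// mulr_ge0// mulr_ge0.
have B0 : 0 <= 6 * Num.sqrt tau * (3 / 2 * M) * (2^-1 * d) by rewrite mulr_ge0// mulr_ge0// mulr_ge0.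
apply: (hb_mono (addr_ge0 A0 B0)).
  have -> : 6 * Num.sqrt tau * (2^-1 * d) * (3 / 2 * M) + 6 * Num.sqrt tau * (3 / 2 * M) * (2^-1 * d) =
    2^-1 * ((18 * Num.sqrt tau * M) * d) by field.
  by apply: ler_wpM2l => //; rewrite -[leRHS]mul1r; apply: ler_wpM2r.
apply: hb_le (hbD A0 B0 A B) => k.
rewrite (_ : twisted_map X k - twisted_map Y k = cv (mB tau) (fun k => twisted_mean X k - twisted_mean Y k) (twisted_mean X) k +
   cv (mB tau) (twisted_mean Y) (fun k => twisted_mean X k - twisted_mean Y k) k)//.
have sm := symb_mB (R := R) tau.
by rewrite cvBl// cvBr// /twisted_map; ring.
Qed.

Lemma coef0 : hb 1 (coef 0) M.
Proof. exact: hb_mult (twist_le tau) vM. Qed.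

Lemma coef_ball n : hb 1 (coef n) (2 * M).
Proof.
elim: n => [|n IH]; first by apply: (hb_mono M0' _ coef0); rewrite mulr_natl mulr2n lerDl.
by apply: hb_le (twisted_map_ball IH) => k; rewrite coefS.
Qed.

Lemma coef_step n : hb 1 (fun k => coef n.+1 k - coef n k) (4 * M * 2^-1 ^+ n).
Proof.
elim: n => [|n IH].
  rewrite expr0 mulr1.
  have := hbB (mulr_ge0 (ler0n _ 2) M0') (mulr_ge0 (ler0n _ 2) M0') (coef_ball 1) (coef_ball 0).
  by rewrite (_ : 2 * M + 2 * M = 4 * M)//; ring.
have q0 : 0 <= 4 * M * 2^-1 ^+ n by rewrite mulr_ge0 ?mulr_ge0// exprn_ge0// invr_ge0.
have := twisted_map_contract q0 (coef_ball n.+1) (coef_ball n) IH.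
rewrite (_ : 2^-1 * _ = 4 * M * 2^-1 ^+ n.+1); last by rewrite exprS; ring.
by apply: hb_le => k; rewrite [in leLHS]coefS [coef n.+1 k]coefS.
Qed.

Lemma coef_tail n m : hb 1 (fun k => coef (m + n) k - coef n k) (8 * M * 2^-1 ^+ n).
Proof.
(* The difference of the two powers telescopes, which makes the induction on m go through. *)
suff H : hb 1 (fun k => coef (m + n) k - coef n k) (8 * M * (2^-1 ^+ n - 2^-1 ^+ (m + n))).
  apply: hb_mono H.
    rewrite mulr_ge0 ?mulr_ge0// subr_ge0; apply: ler_wiXn2l; rewrite ?invr_ge0 ?leq_addl//.
    by rewrite invf_le1// ler1n.
  rewrite ler_wpM2l ?mulr_ge0// lerBlDr lerDl exprn_ge0// invr_ge0//.
elim: m => [|m IH].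
  rewrite add0n subrr mulr0 => s us; rewrite big1 ?sqr_ge0// => k _.
  by rewrite subrr normc00 mulr0 expr0n.
have q0 i : 0 <= 4 * M * 2^-1 ^+ i by rewrite mulr_ge0 ?mulr_ge0// exprn_ge0// invr_ge0.
have q1 : 0 <= 8 * M * (2^-1 ^+ n - 2^-1 ^+ (m + n)).
  rewrite mulr_ge0 ?mulr_ge0// subr_ge0; apply: ler_wiXn2l; rewrite ?invr_ge0 ?leq_addl//.
  by rewrite invf_le1// ler1n.
have := hbD (q0 (m + n)%N) q1 (coef_step (m + n)) IH.
rewrite (_ : _ + _ = 8 * M * (2^-1 ^+ n - 2^-1 ^+ (m.+1 + n))); last first.
  by rewrite addSn exprS; field.
by apply: hb_le => k; rewrite addSn addrA subrK.
Qed.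

Lemma coef_lim k : exists z, ccvg (fun n => coef n k) z.
Proof.
have stepk n : normc (coef n.+1 k - coef n k) <= 4 * M * 2^-1 ^+ n.
  have q0 : 0 <= 4 * M * 2^-1 ^+ n by rewrite mulr_ge0 ?mulr_ge0// exprn_ge0// invr_ge0.
  have := hb_pt k q0 (coef_step n); apply: le_trans.
  by rewrite -[leLHS]mul1r; apply: ler_wpM2r; [exact: normc_ge0|exact: jpX_ge1].
have bndk n : normc (coef n k) <= 2 * M.
  have := hb_pt k (mulr_ge0 (ler0n _ 2) M0') (coef_ball n); apply: le_trans.
  by rewrite -[leLHS]mul1r; apply: ler_wpM2r; [exact: normc_ge0|exact: jpX_ge1].
have g : (fun n : nat => 8 * M * 2^-1 ^+ n) @ \oo --> (0 : R).
  rewrite -[X in _ --> X](mulr0 (8 * M)); apply: cvgM; first exact: cvg_cst.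
  by apply: cvg_expr; rewrite ger0_norm ?invr_ge0// invf_lt1// ltr1n.
(* Adding the geometric tail 8 M 2^-n makes the sequence nonincreasing, so monotone convergence
   gives the limit. *)
have real_lim (a : nat -> R) : (forall n, a n.+1 - a n <= 4 * M * 2^-1 ^+ n) ->
    (forall n, - (2 * M) <= a n) -> cvgn a.
  move=> astep abnd.
  have -> : a = (fun n => a n + 8 * M * 2^-1 ^+ n) \- (fun n => 8 * M * 2^-1 ^+ n).
    by apply/funext => n /=; rewrite addrK.
  apply: is_cvgB; last by apply/cvg_ex; exists 0.
  apply: nonincreasing_is_cvgn.
    apply/nonincreasing_seqP => n; have := astep n.
    have -> : 8 * M * 2^-1 ^+ n = 2 * (4 * M * 2^-1 ^+ n) by ring.
    have -> : 8 * M * 2^-1 ^+ n.+1 = 4 * M * 2^-1 ^+ n by rewrite exprS; field.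
    lra.
  exists (- (2 * M)) => _ [n _ <-]; apply: le_trans (abnd n) _.
  by rewrite lerDl mulr_ge0 ?mulr_ge0// exprn_ge0// invr_ge0.
have /cvg_ex[a Ha] : cvgn (fun n => Re (coef n k)).
  apply: real_lim => n; first by rewrite -Re_opp -Re_add; apply: le_trans (stepk n); apply: le_trans (ler_norm _) (Re_le _).
  by apply: lerNnormlW; apply: le_trans (bndk n); exact: Re_le.
have /cvg_ex[b Hb] : cvgn (fun n => Im (coef n k)).
  apply: real_lim => n; first by rewrite -Im_opp -Im_add; apply: le_trans (stepk n); apply: le_trans (ler_norm _) (Im_le _).
  by apply: lerNnormlW; apply: le_trans (bndk n); exact: Im_le.
by exists (Complex a b); apply/ccvgP.
Qed.

Lemma ccvg_shift (u : nat -> R[i]) z n : ccvg u z -> ccvg (fun m => u (m + n)%N) z.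
Proof. by move=> h; apply: (cvg_comp _ _ (cvg_addnr n) h). Qed.

(** Contraction carries the geometric rate to the next iterate, whose limit is then both X and its
    image. It is stated for any coefficientwise limit, since it serves both the limit constructed
    here and an arbitrary H^1 limit. *)
Lemma iterate_limit_fixed X : (forall k, ccvg (fun n => coef n k) (X k)) ->
  [/\ hb 1 X (2 * M), forall n, hb 1 (fun k => X k - coef n k) (8 * M * 2^-1 ^+ n) &
      forall k, X k = twisted_map X k].
Proof.
move=> cX.
have hX : hb 1 X (2 * M).
  by apply: (hb_lim cX coef_ball); exact: cvg_cst.
have hT n : hb 1 (fun k => X k - coef n k) (8 * M * 2^-1 ^+ n).
  apply: (@hb_lim _ 1 (fun m k => coef (m + n) k - coef n k) _ (fun=> 8 * M * 2^-1 ^+ n)).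
  - move=> k; apply: ccvgD; last exact: ccvg_cst.
    exact: (ccvg_shift n (cX k)).
  - by move=> m; exact: coef_tail.
  - exact: cvg_cst.
split => // k.
apply: (ccvg_unique (ccvg_shift 1 (cX k))).
apply: (@squeeze_cvgr _ _ _ _ (cst 0) (fun n : nat => 8 * M * 2^-1 ^+ n)).
- apply: nearW => n; rewrite normc_ge0 andTb addn1 coefS.
  have q0 : 0 <= 8 * M * 2^-1 ^+ n by rewrite mulr_ge0 ?mulr_ge0// exprn_ge0// invr_ge0.
  have := twisted_map_contract q0 hX (coef_ball n) (hT n) => /(hb_pt k (mulr_ge0 _ q0)).
  rewrite invr_ge0 => /(_ (ler0n _ _)) h.
  rewrite normc_distC; apply: (@le_trans _ _ (2^-1 * (8 * M * 2^-1 ^+ n))).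
    apply: le_trans h; rewrite -[leLHS]mul1r.
    by apply: ler_wpM2r; [exact: normc_ge0|exact: jpX_ge1].
  lra.
- exact: cvg_cst.
- rewrite -[X in _ --> X](mulr0 (8 * M)); apply: cvgM; first exact: cvg_cst.
  by apply: cvg_expr; rewrite ger0_norm ?invr_ge0// invf_lt1// ltr1n.
Qed.

(** The phase vanishes at k = 0, so the iteration conserves the zero mean. *)
Lemma twisted_map0 X : twisted_map X 0 = 0.
Proof.
rewrite /twisted_map torus_fun_fourier0// add0r /cv (csum_box (M := 0)).
  by apply: big1 => j _; rewrite /mB /phase mulr0 !mul0r mulr0 oppr0 cis0 subrr mulr0 !mul0r.
by move=> j _; rewrite /mB /phase mulr0 !mul0r mulr0 oppr0 cis0 subrr mulr0 !mul0r.
Qed.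

Lemma midpoint_exists : exists w, midpoint_lim tau v w.
Proof.
have [X cX] := choice coef_lim.
have [hX hT fX] := iterate_limit_fixed cX.
pose c k := twist (- tau) k * X k.
have hc : hb 1 c (2 * M) by exact: hb_mult (twist_le _) hX.
have M20 : 0 <= 2 * M by rewrite mulr_ge0.
have cc k : ccvg (fun n => fourier (iterate n) k) (c k).
  have := ccvgZ (twist (- tau) k) (cX k); rewrite /coef.
  by under eq_fun do rewrite twistNK.
(* The iterates are real functions; their Hermitian symmetry passes to the limit, so [synth]
   recovers the coefficients c. *)
have sc : csym c.
  move=> k; apply: (ccvg_unique (cc (- k))).
  have /ccvgP[h1 h2] := cc k; apply/ccvgP; rewrite Re_conjc Im_conjc.
  split; under eq_fun do rewrite (good_csym (iterate_good _)).
    by under eq_fun do rewrite Re_conjc.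
  by under eq_fun do rewrite Im_conjc; exact: cvgN.
have gw := good_synth M20 hc sc; have fw := fourierK (hb_l1c M20 hc) sc.
exists (synth c); split.
  have [cw pw _] := gw; split.
    by apply: fourier0_torus_fun => //; rewrite fw /c fX twisted_map0 mulr0.
  by apply: le_lt_trans (ltry (2 * M)); apply/HnormP; rewrite ?fw.
have E n : (Hnorm 1 (iterate n \- synth c)%R <= (8 * M * 2^-1 ^+ n)%:E)%E.
  apply/HnormP; first by rewrite mulr_ge0 ?mulr_ge0// exprn_ge0// invr_ge0.
  have [ci _ _] := iterate_good n; have [cw _ _] := gw.
  apply: hb_le (hT n) => k; rewrite fourierB// fw.
  rewrite -[leLHS]mul1r -(normc_cis (- (tau * k%:~R ^+ 3))) -normcMM.
  by rewrite mulrBr -/(twist tau k) twistK normc_distC.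
apply: (squeeze_cvge (f := cst 0%E) (h := fun n => (8 * M * 2^-1 ^+ n)%:E)).
- by apply: nearW => n; rewrite E andbT; exact: sqrte_ge0.
- exact: cvg_cst.
- apply: cvg_EFin; first exact: nearW.
  rewrite -[X in _ --> X](mulr0 (8 * M)); apply: cvgM; first exact: cvg_cst.
  by apply: cvg_expr; rewrite ger0_norm ?invr_ge0// invf_lt1// ltr1n.
Qed.

(** Any H^1 limit is treated, because [xget] does not say which one it selects. H^1 convergence
    forces coefficientwise convergence. *)
Lemma midpoint_spec w : midpoint_lim tau v w ->
  [/\ torus_fun w, hb 1 (fun k => twist tau k * fourier w k) (2 * M) &
      forall k, twist tau k * fourier w k = twisted_map (fun k => twist tau k * fourier w k) k].
Proof.
move=> [[tw wfin] lw].
have [cw pw _] := tw.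
have cX k : ccvg (fun n => coef n k) (twist tau k * fourier w k).
  apply: ccvgZ; apply/cvgr0Pnorm_le => e e0.
  have /fine_cvgP[fn /cvgrPdist_le/(_ e e0) fl] := lw.
  near=> n; rewrite ger0_norm ?normc_ge0//.
  have [ci _ _] := iterate_good n.
  have h : (Hnorm 1 (iterate n \- w)%R <= e%:E)%E.
    have fin : Hnorm 1 (iterate n \- w) \is a fin_num by near: n; exact: fn.
    rewrite -(fineK fin) lee_fin; apply: le_trans (ler_norm _) _; rewrite -normrN.
    near: n; apply: filterS fl => n /=; by rewrite sub0r.
  have /(hb_pt k (ltW e0)) := (HnormP 1 (iterate n \- w) (ltW e0)).1 h.
  rewrite fourierB//; apply: le_trans; rewrite -[leLHS]mul1r.
  by apply: ler_wpM2r; [exact: normc_ge0|exact: jpX_ge1].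
by have [h1 _ h2] := iterate_limit_fixed cX.
Unshelve. all: by end_near.
Qed.

End FixedPoint.

(** * The exact solution and convergence *)

Section ExactSolution.
Context {R : realType}.
Local Notation jp := (japanese R).

(** The test functions that extract Fourier coefficients, in a two-parameter form closed under
    differentiation. *)
Definition trig (c a b x : R) : R := a * cos (c * x) + b * sin (c * x).

Lemma is_derive_trig c a b x : is_derive x (1 : R) (trig c a b) (trig c (c * b) (- (c * a)) x).
Proof.
have := is_deriveD (is_deriveZ a (is_derive_cosc c x)) (is_deriveZ b (is_derive_sinc c x)).
move/is_derive_eq; apply; rewrite /trig /GRing.scale/=; ring.
Qed.

Lemma derive1_trig c a b : derive1 (trig c a b) = trig c (c * b) (- (c * a)).
Proof. by apply/funext => x; rewrite derive1E; apply: derive_val; exact: is_derive_trig. Qed.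

Lemma derive1n_trig c a b n : exists a' b', derive1n n (trig c a b) = trig c a' b'.
Proof.
elim: n => [|n [a' [b' IH]]]; first by exists a, b.
by exists (c * b'), (- (c * a')); rewrite derive1nS IH derive1_trig.
Qed.

Lemma torus_smooth_trig k a b : torus_smooth (trig k%:~R a b).
Proof.
split=> [x|n x].
  by rewrite /trig mulrDr cosD sinD cos_int_pi sin_int_pi; congr (_ * _ + _ * _); ring.
have [a' [b' ->]] := derive1n_trig k%:~R a b n.
by have [] := is_derive_trig k%:~R a' b' x.
Qed.

Lemma derive1n1_trig c a b : derive1n 1 (trig c a b) = trig c (c * b) (- (c * a)).
Proof. by rewrite derive1n1 derive1_trig. Qed.

Lemma derive1n3_trig c a b : derive1n 3 (trig c a b) = trig c (- (c ^+ 3 * b)) (c ^+ 3 * a).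
Proof.
rewrite !derive1nS derive1n0 !derive1_trig; congr trig; ring.
Qed.

Variables (T : R) (u : R -> R -> R) (u0 : R -> R).
Hypothesis sol : KdV_solution T u u0.

Let tu (t : R) : 0 <= t <= T -> torus_fun (u t). Proof. by case: sol => h _ _; exact: h. Qed.

Lemma cos_trig c : (fun x : R => cos (c * x)) = trig c 1 0.
Proof. by apply/funext => x; rewrite /trig mul1r mul0r addr0. Qed.

Lemma sin_trig c : (fun x : R => sin (c * x)) = trig c 0 1.
Proof. by apply/funext => x; rewrite /trig mul1r mul0r add0r. Qed.

Lemma fourier_cont k : ccont 0 T (fun t => fourier (u t) k).
Proof.
have [_ _ wk] := sol.
have [h1 _] := wk _ (torus_smooth_trig k 1 0).
have [h2 _] := wk _ (torus_smooth_trig k 0 1).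
rewrite -cos_trig in h1; rewrite -sin_trig in h2.
split=> /=.
  by move=> x; apply: cvgM; [exact: cvg_cst|exact: h1].
by move=> x; apply: cvgN; apply: cvgM; [exact: cvg_cst|exact: h2].
Qed.

(** Testing the weak equation with cos(kx) and sin(kx) turns it into a system of ordinary
    differential equations for the coefficients. *)
Lemma fourier_der k (t : R) : 0 < t < T ->
  cder (fun t => fourier (u t) k) t
    (Complex 0 (k%:~R ^+ 3) * fourier (u t) k +
     Complex 0 (k%:~R / 2) * fourier (fun x => u t x ^+ 2) k).
Proof.
move=> tI; have [_ _ wk] := sol.
have [cut _ _] : torus_fun (u t) by apply: tu; move: tI => /andP[? ?]; rewrite !ltW.
have [_ /(_ t tI) h1] := wk _ (torus_smooth_trig k 1 0).
have [_ /(_ t tI) h2] := wk _ (torus_smooth_trig k 0 1).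
have cu2 : continuous (fun x => u t x ^+ 2) by under eq_fun do rewrite expr2; exact: contM.
have E (f : R -> R) a b : continuous f -> torus_int (fun x => f x * trig k%:~R a b x) =
    a * torus_int (fun x => f x * cos (k%:~R * x)) + b * torus_int (fun x => f x * sin (k%:~R * x)).
  move=> cf; have cc : continuous (fun x => f x * cos (k%:~R * x)) by apply: contM => //; exact: cont_cosc.
  have cs : continuous (fun x => f x * sin (k%:~R * x)) by apply: contM => //; exact: cont_sinc.
  rewrite -!torus_intZ// -torus_intD; [|by apply: contM => //; exact: cont_cst..].
  by congr torus_int; apply/funext => x; rewrite /trig; ring.
rewrite derive1n3_trig derive1n1_trig !E// -cos_trig in h1.
rewrite derive1n3_trig derive1n1_trig !E// -sin_trig in h2.
split=> /=.
  apply: (is_derive_eq (is_deriveZ _ h1)); rewrite /GRing.scale/=.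
  by move: ((2 * pi)^-1) => q; field.
apply: (is_derive_eq (is_deriveN (is_deriveZ _ h2))); rewrite /GRing.scale/=.
by move: ((2 * pi)^-1) => q; field.
Qed.

Variables (tn tau rho : R).
Hypothesis tn0 : 0 <= tn.
Hypothesis tau0 : 0 < tau.
Hypothesis tnT : tn + tau <= T.

(** The twist restarts at each step: s is the time since [tn], so at s = 0 the twisted variable is
    the solution itself. *)
Definition twisted s k := twist s k * fourier (u (tn + s)) k.

Lemma twist_der k s : cder (fun s : R => twist s k) s (Complex 0 (- k%:~R ^+ 3) * twist s k).
Proof.
have e (x : R) : - (x * k%:~R ^+ 3) = (- k%:~R ^+ 3) * x by ring.
split=> /=.
  rewrite (_ : (fun s : R => cos _) = (fun s => cos ((- k%:~R ^+ 3) * s))); last first.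
    by apply/funext => x; rewrite e.
  by apply: (is_derive_eq (is_derive_cosc _ _)); rewrite e; ring.
rewrite (_ : (fun s : R => sin _) = (fun s => sin ((- k%:~R ^+ 3) * s))); last first.
  by apply/funext => x; rewrite e.
by apply: (is_derive_eq (is_derive_sinc _ _)); rewrite e; ring.
Qed.

Lemma shift_cont (f : R -> R) : {within `[0, T], continuous f} ->
  {within `[0, tau], continuous (fun s => f (tn + s))}.
Proof.
move=> /subspace_continuousP cf; apply/subspace_continuousP => x /=; rewrite in_itv/= => /andP[x0 xt].
have xI : `[0, T]%classic (tn + x) by rewrite /= in_itv/= addr_ge0//= (le_trans _ tnT)// lerD2l.
apply/cvgrPdist_lt => e e0.
have /cvgrPdist_lt/(_ e e0) := cf _ xI.
rewrite !near_withinE => /nbhs_ballP[d /= d0 Hd].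
apply/nbhs_ballP; exists d => // y /= xy; rewrite in_itv/= => /andP[y0 yt].
apply: Hd => /=; last by rewrite in_itv/= addr_ge0//= (le_trans _ tnT)// lerD2l.
by rewrite /ball/= opprD addrACA subrr add0r.
Qed.

Lemma shift_der (f : R -> R) s d : is_derive (tn + s) (1 : R) f d ->
  is_derive s (1 : R) (fun s => f (tn + s)) d.
Proof.
move=> h; have hs : is_derive s (1 : R) (fun s => tn + s) 1.
  have := is_deriveD (is_derive_cst tn s (1 : R)) (is_derive_id s (1 : R)); by rewrite add0r.
have := is_derive1_comp h hs; by rewrite mulr1.
Qed.

Lemma twisted_cont k : ccont 0 tau (fun s => twisted s k).
Proof.
apply: ccontM.
  by apply: cder_cont => s; exists (Complex 0 (- k%:~R ^+ 3) * twist s k); exact: twist_der.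
by have [h1 h2] := fourier_cont k; split; [exact: (shift_cont h1)|exact: (shift_cont h2)].
Qed.

Lemma in_time (s : R) : 0 <= s <= tau -> 0 <= tn + s <= T.
Proof. by move=> /andP[s0 st]; rewrite addr_ge0//= (le_trans _ tnT)// lerD2l. Qed.

Hypothesis u1 : forall t : R, 0 <= t <= T -> exists M, 0 <= M /\ hb 1 (fourier (u t)) M.

Lemma good_u (t : R) : 0 <= t <= T -> good (u t).
Proof. by move=> tI; have [cu pu _] := tu tI; split => //; exact: u1. Qed.

(** The derivative of the twist cancels the linear term i k^3, and untwisting the factors of the
    square produces the phase. *)
Lemma twisted_der (s : R) : 0 < s < tau -> forall k,
  cder (fun s => twisted s k) s (cv (mN s) (twisted s) (twisted s) k).
Proof.
move=> /andP[s0 st] k.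
have tI : 0 < tn + s < T.
  by apply/andP; split; [exact: ltr_wpDl|apply: lt_le_trans tnT; rewrite ltrD2l].
have tI' : 0 <= tn + s <= T by apply: in_time; rewrite (ltW s0) (ltW st).
have [d1 d2] := fourier_der k tI.
have H := cderM (twist_der k s) (conj (shift_der d1) (shift_der d2)).
have gu := good_u tI'.
have [_ _ [M [M0 uM]]] := gu.
have su : sq (fourier (u (tn + s))) by exact: hb_sq uM.
have st' : sq (twisted s) by apply: (hb_sq M0); exact: hb_mult (twist_le s) uM.
have E : cv (mN s) (twisted s) (twisted s) k =
   Complex 0 (k%:~R / 2) * (twist s k * fourier (fun x => u (tn + s) x ^+ 2) k).
  rewrite fourier_sqr// /cv -csumZ; last exact: (cv_csummable k symb_one su su).
  rewrite -csumZ; last by apply: csummableZ; exact: (cv_csummable k symb_one su su).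
  congr csum; apply/funext => j; rewrite /mN -twist_phase /twisted mul1r.
  have h1 := twistNK s j (fourier (u (tn + s)) j).
  have h2 := twistNK s (k - j) (fourier (u (tn + s)) (k - j)).
  rewrite -[in RHS]h1 -[in RHS]h2; ring.
rewrite E; move: H; congr cder.
have -> : Complex 0 (- k%:~R ^+ 3) = - Complex 0 (k%:~R ^+ 3) :> R[i].
  by apply: complex_ext => /=; rewrite ?oppr0.
ring.
Qed.

Lemma twisted_z (s : R) : 0 <= s <= tau -> twisted s 0 = 0.
Proof. by move=> sI; rewrite /twisted torus_fun_fourier0 ?mulr0//; exact/tu/in_time. Qed.

Lemma twisted_hb r (s M : R) : (forall t : R, 0 <= t <= T -> hb r (fourier (u t)) M) ->
  0 <= s <= tau -> hb r (twisted s) M.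
Proof. by move=> h sI; apply: hb_mult (twist_le s) (h _ (in_time sI)). Qed.

End ExactSolution.

(** * Accumulation of the errors and choice of the step size *)

Section Convergence.
Context {R : realType}.
Local Notation jp := (japanese R).

Lemma twist0 k : twist (0 : R) k = 1.
Proof. by rewrite /twist mul0r oppr0 cis0. Qed.

(** An error of at most rho keeps the numerical value in the ball of radius 2 rho, where the
    fixed-point results apply. The error estimate is then [step_error] with V the mean of the exact
    twisted values. *)
Lemma one_step (T rho tn tau E0 eta : R) (u : R -> R -> R) (u0 un : R -> R) :
  KdV_solution T u u0 -> 0 < tau -> 0 < rho -> 0 <= tn -> tn + tau <= T ->
  (forall t : R, 0 <= t <= T -> hb 3 (fourier (u t)) rho) ->
  hb 1 (defect tau (twisted u tn)) eta -> torus_fun un ->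
  0 <= E0 -> E0 <= rho -> 0 <= eta ->
  54 * rho * Num.sqrt tau <= 1 -> 6 * Num.sqrt tau * (2 * E0 + eta) <= tau ->
  (6 * rho + 1) * tau <= 1 ->
  hb 1 (fun k => fourier (u tn) k - fourier un k) E0 ->
  (exists w, midpoint_lim tau un w) /\
  forall w, midpoint_lim tau un w -> torus_fun w /\
    hb 1 (fun k => fourier (u (tn + tau)) k - fourier w k) ((1 + (12 * rho + 2) * tau) * E0 + 2 * eta).
Proof.
move=> sol t0 r0 tn0 tnT u3 dE tun E00 E0r eta0 sm1 sm2 sm3 e0E.
have r0' := ltW r0; have t0' := ltW t0; have sq0 := sqrtr_ge0 tau.
have tnI : 0 <= tn <= T by rewrite tn0 (le_trans _ tnT)// lerDl.
have tnI' : 0 <= tn + tau <= T by rewrite addr_ge0.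
have [sol1 _ _] := sol.
have [cu pu _] := sol1 _ tnI; have [cu' pu' _] := sol1 _ tnI'.
have [cn pn _] := tun.
have u1 (t : R) : 0 <= t <= T -> hb 1 (fourier (u t)) rho by move=> /u3; exact: hb_w.
have unM : hb 1 (fourier un) (2 * rho).
  have := hbB r0' E00 (u1 _ tnI) e0E => h.
  apply: (hb_mono (addr_ge0 r0' E00)); first by rewrite mulr_natl mulr2n lerD2l.
  by apply: hb_le h => k; rewrite subKr.
have M0 : 0 < 2 * rho by rewrite mulr_gt0.
have small : 18 * Num.sqrt tau * (2 * rho) <= 1.
  apply: le_trans sm1; rewrite [leLHS](_ : _ = 36 * (rho * Num.sqrt tau)); last by ring.
  by rewrite -mulrA; apply: ler_wpM2r; [exact: mulr_ge0|rewrite ler_nat].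
split; first exact: (midpoint_exists t0 M0 small tun unM).
move=> w lw; have [tw X4 Xfix] := midpoint_spec t0 M0 small tun unM lw.
split => //.
have [cw pw _] := tw.
set v := twisted u tn.
set X := fun k => twist tau k * fourier w k in X4 Xfix.
have r4 : 0 <= 2 * (2 * rho) by rewrite mulr_ge0// ltW.
pose e0 k := fourier (u tn) k - fourier un k.
pose e1 k := v tau k - X k.
have v0 k : v 0 k = fourier (u tn) k by rewrite /v /twisted twist0 mul1r addr0.
have vr s : 0 <= s <= tau -> hb 3 (v s) rho.
  by move=> sI; apply: (twisted_hb tn0 tnT u3 sI).
have I0 : 0 <= (0 : R) <= tau by rewrite lexx.
have I1 : 0 <= tau <= tau by rewrite lexx t0'.
have V3 : hb 3 (midv tau v) rho by apply: hb_midv => //; exact: vr.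
have H : hb 1 e1 ((1 + (12 * rho + 2) * tau) * E0 + 2 * eta).
  apply: (@step_error _ tau rho E0 eta e0 e1 (midv tau v) (defect tau v)) => //.
  - by move=> k; rewrite /e0 !fourier_csym// rmorphB.
  - move=> k; rewrite /e1 /v /twisted /X !fourier_csym// twist_csym -!conjc_mul rmorphB//.
  (* The new error is at most rho + 4 rho by the ball of the iteration, so the mean error is at most
     3 rho, within the allowed 4 rho. *)
  - have e1b : hb 1 e1 (rho + 2 * (2 * rho)).
      by apply: hbB => //; apply: (@hb_w _ 1 3) => //; exact: vr.
    have b0 : 0 <= rho + 2 * (2 * rho) by exact: addr_ge0.
    have := hbZ (2^-1)%:C%C (hbD E00 b0 e0E e1b).
    rewrite normc_real ger0_norm ?invr_ge0//; apply: hb_mono.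
      by rewrite mulr_ge0 ?invr_ge0// addr_ge0.
    by lra.
  - move=> k; set eb := fun k => _.
    (* The numerical mean is midv - eb; expanding the bilinear form at it gives the error equation,
       with the defect as inhomogeneity. *)
    have mE : twisted_mean un X = fun k => midv tau v k - eb k.
      apply/funext => j; rewrite /twisted_mean /midv /eb /e0 /e1 v0.
      move: (fourier un j) (X j) (fourier (u tn) j) (v tau j) => [a a'] [b b'] [c c'] [d d'].
      by apply: complex_ext => /=; ring.
    have sV : sq (midv tau v) by exact: hb_sq V3.
    have sm : sq (twisted_mean un X).
      by apply: sqZ; apply: sqD; [apply: hb_sq unM; rewrite mulr_ge0|exact: hb_sq X4].
    have seb : sq eb.
      have -> : eb = fun k => midv tau v k - twisted_mean un X k by apply/funext => j; rewrite mE subKr.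
      exact: sqB.
    have E1 : e1 k = v tau k - twisted_map tau un X k by rewrite /e1 [X k]Xfix.
    rewrite E1 /twisted_map mE /e0 -v0.
    rewrite cvBl ?cvBr//; [|exact: symb_mB|exact: symb_mB|exact: symb_mB|exact: sqB].
    by rewrite /defect; ring.
apply: hb_le H => k.
rewrite -[leLHS]mul1r -(normc_cis (- (tau * k%:~R ^+ 3))) -normcMM mulrBr.
exact: lexx.
Qed.

Definition first_order_rate (rho : R) := 12 * 24 * rho ^+ 3.

(** The smallness needed at each step is drawn from the first-order rate through [B], while the
    conclusion is stated with the actual defect bound [eta]. The same induction thus yields both
    orders. *)
Lemma main_induction (T rho tau eta : R) (u : R -> R -> R) (u0 : R -> R)
    (B := 2 * T * expR ((12 * rho + 2) * T) * first_order_rate rho) :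
  KdV_solution T u u0 -> 0 < T -> 0 < tau -> 0 < rho -> 0 <= eta ->
  eta <= first_order_rate rho * tau ^+ 2 ->
  (forall t : R, 0 <= t <= T -> hb 3 (fourier (u t)) rho) ->
  (forall tn : R, 0 <= tn -> tn + tau <= T -> hb 1 (defect tau (twisted u tn)) eta) ->
  54 * rho * Num.sqrt tau <= 1 -> (6 * rho + 1) * tau <= 1 -> tau <= 1 ->
  6 * Num.sqrt tau * (2 * B + first_order_rate rho) <= 1 -> B * tau <= rho ->
  forall n : nat, n%:R * tau <= T ->
  [/\ torus_fun (midpoint_iter tau u0 n),
      hb 1 (fun k => fourier (u (n%:R * tau)) k - fourier (midpoint_iter tau u0 n) k)
        (2 * T * expR ((12 * rho + 2) * T) * (eta / tau)) &
      n.+1%:R * tau <= T -> exists w, midpoint_lim tau (midpoint_iter tau u0 n) w].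
Proof.
move=> sol T0 t0 r0 eta0 etaB u3 dE sm1 sm3 t1 sm2 Br.
have r0' := ltW r0; have t0' := ltW t0; have sq0 := sqrtr_ge0 tau.
set L := 12 * rho + 2.
have L0 : 0 <= L by rewrite addr_ge0// mulr_ge0.
have fr0 : 0 <= first_order_rate rho by rewrite /first_order_rate; nneg.
(* An explicit supersolution of the error recursion with growth factor 1 + L tau and source 2 eta;
   the factor n replaces the geometric sum. *)
pose A n : R := n%:R * (2 * eta) * (1 + L * tau) ^+ n.
have LT0 : 0 <= L * tau by exact: mulr_ge0.
have g1 : 1 <= 1 + L * tau by rewrite lerDl.
have A0 n : 0 <= A n by rewrite /A !mulr_ge0// exprn_ge0// (le_trans ler01).
have Ale n : n%:R * tau <= T -> A n <= 2 * T * expR (L * T) * (eta / tau).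
  move=> nT.
  have e1 : (1 + L * tau) ^+ n <= expR (L * T).
    apply: (@le_trans _ _ (expR (L * tau) ^+ n)).
      by apply: lerXn2r; rewrite ?nnegrE ?expR_ge0 ?(le_trans ler01 g1)//; exact: expR_ge1Dx.
    rewrite -expRM_natl ler_expR mulrCA; exact: ler_wpM2l.
  have e2 : n%:R <= T / tau by rewrite ler_pdivlMr.
  rewrite (_ : 2 * T * _ * _ = T / tau * (2 * eta) * expR (L * T)); last by ring.
  apply: ler_pM => //; first by rewrite !mulr_ge0.
    by rewrite exprn_ge0// (le_trans ler01).
  by apply: ler_wpM2r => //; rewrite mulr_ge0.
have AB n : n%:R * tau <= T -> A n <= B * tau.
  move=> nT; apply: le_trans (Ale n nT) _; rewrite /B -[leRHS]mulrA.
  apply: ler_wpM2l; first by rewrite !mulr_ge0 ?expR_ge0// ltW.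
  by rewrite ler_pdivrMr// -mulrA -expr2.
have AS n : (1 + L * tau) * A n + 2 * eta <= A n.+1.
  have : 1 <= (1 + L * tau) ^+ n.+1 by exact: exprn_ege1.
  have e20 : 0 <= 2 * eta by exact: mulr_ge0.
  move=> h; rewrite (_ : A n.+1 = (1 + L * tau) * A n + 2 * eta * (1 + L * tau) ^+ n.+1); last first.
    by rewrite /A exprS -natr1; ring.
  by rewrite lerD2l -[leLHS]mulr1; apply: ler_wpM2l.
have step n : n.+1%:R * tau <= T -> torus_fun (midpoint_iter tau u0 n) ->
    hb 1 (fun k => fourier (u (n%:R * tau)) k - fourier (midpoint_iter tau u0 n) k) (A n) ->
    (exists w, midpoint_lim tau (midpoint_iter tau u0 n) w) /\
    forall w, midpoint_lim tau (midpoint_iter tau u0 n) w -> torus_fun w /\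
    hb 1 (fun k => fourier (u (n.+1%:R * tau)) k - fourier w k) (A n.+1).
  move=> nT tn hn.
  have nE : n.+1%:R * tau = n%:R * tau + tau by rewrite -natr1 mulrDl mul1r.
  have nT' : n%:R * tau <= T by apply: le_trans nT; rewrite nE lerDl.
  have tn0 : 0 <= n%:R * tau by rewrite mulr_ge0.
  have tnT : n%:R * tau + tau <= T by rewrite -nE.
  have Ar : A n <= rho by exact: le_trans (AB n nT') Br.
  (* A n and eta are both O(tau), by B tau and by the first-order rate times tau, so the remaining
     sqrt tau makes the condition hold. *)
  have As : 6 * Num.sqrt tau * (2 * A n + eta) <= tau.
    apply: (@le_trans _ _ (6 * Num.sqrt tau * (2 * B + first_order_rate rho) * tau)); last first.
      by rewrite -[leRHS]mul1r; apply: ler_wpM2r.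
    rewrite -[leRHS]mulrA; apply: ler_wpM2l; first by rewrite mulr_ge0.
    rewrite [leRHS]mulrDl; apply: lerD.
      by rewrite -[leRHS]mulrA; apply: ler_wpM2l => //; exact: AB.
    apply: (le_trans etaB); apply: ler_wpM2l => //.
    by rewrite expr2 -[leRHS]mulr1; apply: ler_wpM2l.
  have [ex sp] := one_step sol t0 r0 tn0 tnT u3 (dE _ tn0 tnT) tn (A0 n) Ar eta0 sm1 As sm3 hn.
  split => // w /sp[tw hw]; split => //; rewrite nE.
  apply: hb_mono hw; last exact: AS.
  by apply: addr_ge0; [apply: mulr_ge0 => //; exact: le_trans ler01 g1|exact: mulr_ge0].
have main n : n%:R * tau <= T -> torus_fun (midpoint_iter tau u0 n) /\
    hb 1 (fun k => fourier (u (n%:R * tau)) k - fourier (midpoint_iter tau u0 n) k) (A n).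
  elim: n => [_|n IH nT].
    have [s1 s2 _] := sol; split.
      by rewrite /midpoint_iter/= -s2; apply: s1; rewrite lexx ltW.
    move=> s us; rewrite mul0r s2 big1 ?sqr_ge0// => k _.
    by rewrite -[midpoint_iter _ _ _]/u0 subrr normc00 mulr0 expr0n.
  have nT' : n%:R * tau <= T.
    by apply: le_trans nT; apply: ler_wpM2r => //; rewrite ler_nat.
  have [tn hn] := IH nT'.
  have [[w0 ex] sp] := step n nT tn hn.
  (* A limit exists, so [xget] returns one and not its default. *)
  by apply: sp; rewrite /midpoint_iter/= /midpoint_step; exact: (xgetI _ ex).
move=> n nT; have [tn hn] := main n nT; split => //.
  by apply: hb_mono hn => //; exact: Ale.
by move=> nS; have [] := step n nS tn hn.
Qed.

Lemma Hsup_hb r (T M : R) (u : R -> R -> R) : 0 <= M -> (Hsup r T u < M%:E)%E ->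
  forall t : R, 0 <= t <= T -> hb r (fourier (u t)) M.
Proof.
move=> M0 h t tI; apply/HnormP => //; apply: ltW; apply: le_lt_trans h.
by apply: ereal_sup_ubound; exists t => //=; rewrite in_itv.
Qed.

End Convergence.

Theorem corollary4p3 (R : realType) (T rho : R) (hT : 0 < T) (hrho : 0 < rho) :
  exists tau_R c C : R,
    [/\ 0 < tau_R, 0 < c, 0 < C &
      forall (tau : R) (u0 : R -> R) (u : R -> R -> R),
        0 < tau < tau_R ->
        KdV_solution T u u0 ->
        [/\ (Hsup 3 T u < (rho / 2)%:E)%E ->
              forall n : nat, n%:Z < Num.floor (T / tau) ->
                exists w, midpoint_lim tau (midpoint_iter tau u0 n) w,
            (Hsup 3 T u < (rho / 2)%:E)%E ->
              forall n : nat, n%:Z <= Num.floor (T / tau) ->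
                (Hnorm 1 (u (n%:R * tau) \- midpoint_iter tau u0 n)%R
                   <= (c * tau)%:E)%E
          & (Hsup 5 T u < (rho / 2)%:E)%E ->
              forall n : nat, n%:Z <= Num.floor (T / tau) ->
                (Hnorm 1 (u (n%:R * tau) \- midpoint_iter tau u0 n)%R
                   <= (C * tau ^+ 2)%:E)%E]].
Proof.
have r0' := ltW hrho.
set D1 := first_order_rate rho; set D2 := second_order_constant rho.
set G := 2 * T * expR ((12 * rho + 2) * T).
have D10 : 0 < D1 by rewrite /D1 /first_order_rate mulr_gt0 ?exprn_gt0// mulr_gt0.
have D20 : 0 < D2.
  have r3 : 0 < rho ^+ 4 by exact: exprn_gt0.
  rewrite /D2 /second_order_constant; apply: ltr_wpDl; first by nneg.
  by apply: mulr_gt0.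
have G0 : 0 < G by rewrite /G !mulr_gt0 ?expR_gt0.
pose B := G * D1.
have B0 : 0 < B by exact: mulr_gt0.
(* The sum of all the factors that sqrt tau must compensate. For tau < K^-2, sqrt tau K <= 1 bounds
   each of them; as K >= 1, also tau <= sqrt tau <= 1, which serves the conditions linear in tau. *)
pose K := 54 * rho + (6 * rho + 1) + 6 * (2 * B + D1) + B / rho + 1.
have K1 : 1 <= K.
  rewrite /K lerDr; have : 0 <= B / rho by rewrite divr_ge0// ltW.
  by lra.
have K0 : 0 < K by exact: lt_le_trans K1.
exists (K^-1 ^+ 2), B, (G * D2).
split; [by rewrite exprn_gt0// invr_gt0|exact: B0|exact: mulr_gt0|].
move=> tau u0 u /andP[t0 tK] sol.
have t0' := ltW t0; set s := Num.sqrt tau; have s0 : 0 <= s by exact: sqrtr_ge0.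
have sE : s ^+ 2 = tau by rewrite sqr_sqrtr.
have sK : s * K <= 1.
  rewrite -ler_pdivlMr// mul1r -(@ler_pXn2r _ 2) ?nnegrE ?invr_ge0 ?(ltW K0)// sE.
  exact: ltW.
have Br0 : 0 <= B / rho by rewrite divr_ge0// ltW.
have c1 : s * (54 * rho) <= 1.
  by apply: le_trans sK; apply: ler_wpM2l => //; rewrite /K; lra.
have c2 : s * (6 * rho + 1) <= 1.
  by apply: le_trans sK; apply: ler_wpM2l => //; rewrite /K; lra.
have c3 : s * (6 * (2 * B + D1)) <= 1.
  by apply: le_trans sK; apply: ler_wpM2l => //; rewrite /K; lra.
have c4 : s * (B / rho) <= 1.
  by apply: le_trans sK; apply: ler_wpM2l => //; rewrite /K; lra.
have s1 : s <= 1.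
  by apply: le_trans sK; rewrite -[leLHS]mulr1; apply: ler_wpM2l.
have ts : tau <= s by rewrite -sE expr2 -[leRHS]mulr1; apply: ler_wpM2l.
have h1 : 54 * rho * Num.sqrt tau <= 1 by rewrite mulrC.
have h3 : (6 * rho + 1) * tau <= 1.
  by apply: le_trans c2; rewrite mulrC; apply: ler_wpM2r => //; rewrite addr_ge0// mulr_ge0.
have h4 : tau <= 1 by exact: le_trans s1.
have h2 : 6 * Num.sqrt tau * (2 * B + D1) <= 1 by rewrite mulrAC mulrC.
have h5 : B * tau <= rho.
  have : B / rho * tau <= 1 by apply: le_trans c4; rewrite mulrC; apply: ler_wpM2r.
  by rewrite mulrAC ler_pdivrMr// mul1r.
have nT (n : nat) : n%:Z <= Num.floor (T / tau) -> n%:R * tau <= T.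
  by rewrite floor_ge_int ler_pdivlMr.
have p2 : 0 <= rho / 2 by exact: divr_ge0.
have p2r : rho / 2 <= rho by lra.
have half : (Hsup 3 T u < (rho / 2)%:E)%E -> forall t : R, 0 <= t <= T -> hb 3 (fourier (u t)) rho.
  by move=> hs t tI; apply: (hb_mono p2 p2r); exact: (Hsup_hb p2 hs tI).
have sob : (Hsup 3 T u < (rho / 2)%:E)%E -> forall t : R, 0 <= t <= T ->
    exists M, 0 <= M /\ hb 1 (fourier (u t)) M.
  by move=> /half h t tI; exists rho; split => //; apply: (@hb_w _ 1 3) => //; exact: h.
have first (hs : (Hsup 3 T u < (rho / 2)%:E)%E) (tn : R) : 0 <= tn -> tn + tau <= T ->
    hb 1 (defect tau (twisted u tn)) (D1 * tau ^+ 2).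
  move=> tn0 tnT; rewrite /D1 /first_order_rate.
  have w1 k : ccont 0 tau (fun s => twisted u tn s k) by exact: (twisted_cont sol).
  have w2 (r : R) (rI : 0 < r < tau) k := twisted_der sol tn0 tnT (sob hs) rI k.
  have w3 (r : R) (rI : 0 <= r <= tau) := twisted_z sol tn0 tnT rI.
  have w4 (r : R) (rI : 0 <= r <= tau) := twisted_hb tn0 tnT (half hs) rI.
  exact: (defect_first t0 hrho w1 w2 w3 w4).
have eta1 : 0 <= D1 * tau ^+ 2 by rewrite mulr_ge0 ?exprn_ge0// ltW.
have conclude (b : R) n : 0 <= b -> torus_fun (midpoint_iter tau u0 n) -> n%:R * tau <= T ->
    hb 1 (fun k => fourier (u (n%:R * tau)) k - fourier (midpoint_iter tau u0 n) k) b ->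
    (Hnorm 1 (u (n%:R * tau) \- midpoint_iter tau u0 n)%R <= b%:E)%E.
  move=> b0 [cn _ _] nTT hb1; apply/HnormP => //; apply: hb_le hb1 => k.
  have [s' _ _] := sol; have [cu _ _] : torus_fun (u (n%:R * tau)) by apply: s'; rewrite mulr_ge0.
  by rewrite fourierB.
have run1 hs := main_induction sol hT t0 hrho eta1 (lexx _) (half hs) (first hs) h1 h3 h4 h2 h5.
split=> [hs n nf|hs n /nT nTT|hs n /nT nTT].
- have [_ _] := run1 hs n (nT n (ltW nf)).
  (* n < floor (T / tau) means (n + 1) tau <= T, so the step from n to n + 1 stays within [0, T]. *)
  by apply; apply: nT; rewrite -lezD1 in nf; move: nf; rewrite -addn1 PoszD.
- have [tn hn _] := run1 hs n nTT; apply: conclude => //; first by rewrite mulr_ge0// ltW.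
  by move: hn; congr (hb _ _ _); rewrite -/G /B; field; rewrite gt_eqF.
have u5 (t : R) : 0 <= t <= T -> hb 5 (fourier (u t)) rho.
  by move=> tI; apply: (hb_mono p2 p2r); exact: (Hsup_hb p2 hs tI).
have u3 (t : R) : 0 <= t <= T -> hb 3 (fourier (u t)) rho by move=> /u5; exact: hb_w.
have u1 (t : R) : 0 <= t <= T -> exists M, 0 <= M /\ hb 1 (fourier (u t)) M.
  by move=> /u5 h; exists rho; split => //; exact: hb_w h.
(* The minimum of both defect bounds: the first-order one is needed to run the bootstrap. *)
pose eta := Num.min (D1 * tau ^+ 2) (D2 * tau ^+ 3).
have eta2 : 0 <= D2 * tau ^+ 3 by rewrite mulr_ge0 ?exprn_ge0// ltW.
have eta0 : 0 <= eta by rewrite le_min eta1 eta2.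
have second (tn : R) : 0 <= tn -> tn + tau <= T -> hb 1 (defect tau (twisted u tn)) eta.
  move=> tn0 tnT.
  have w1 k : ccont 0 tau (fun s => twisted u tn s k) by exact: (twisted_cont sol).
  have w2 (r : R) (rI : 0 < r < tau) k := twisted_der sol tn0 tnT u1 rI k.
  have w3 (r : R) (rI : 0 <= r <= tau) := twisted_z sol tn0 tnT rI.
  rewrite /eta; case: leP => _.
    have w4 (r : R) (rI : 0 <= r <= tau) := twisted_hb tn0 tnT u3 rI.
    rewrite /D1 /first_order_rate; exact: (defect_first t0 hrho w1 w2 w3 w4).
  have w4 (r : R) (rI : 0 <= r <= tau) := twisted_hb tn0 tnT u5 rI.
  exact: (defect_second t0 hrho w1 w2 w3 w4).
have etaD : eta <= D1 * tau ^+ 2 by rewrite ge_min lexx.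
have [tn hn _] := main_induction sol hT t0 hrho eta0 etaD u3 second h1 h3 h4 h2 h5 nTT.
apply: conclude => //; first by rewrite mulr_ge0 ?exprn_ge0 ?mulr_ge0// ltW.
apply: hb_mono hn; first by rewrite mulr_ge0 ?divr_ge0// ltW.
rewrite -/G -[leRHS]mulrA; apply: ler_wpM2l; first exact: ltW.
rewrite ler_pdivrMr// -mulrA -exprSr.
by rewrite ge_min lexx orbT.
Qed.
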